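(* Let $n \ge 1$ and $b\ne 0$ be fixed integers. Then, as $H\to\infty$, $\mathcal{E}_{n,b}(G_1; H) \asymp H^{n}\log H$. Moreover, if $n\ge 2$, then $\mathcal{E}_{n,b}^{\mathrm{monic}}(G_1; H) \asymp H^{n-1}\log H$.
   Context: A polynomial $f(x)=\sum_{i=0}^{2n} a_i x^i \in \mathbb{Z}[x]$ of degree $2n$ is $b$-reciprocal if $a_{n+i} = b^i a_{n-i}$ for $i=0,\dots,n$. For such $f$ let $g\in\mathbb{Z}[u]$ be the unique degree-$n$ polynomial with $f(x)=x^n g(x+b/x)$; let $G_g\subseteq S_n$ be the Galois group of $g$ on its roots $\beta_1,\dots,\beta_n$ and $G_f$ the Galois group of $f$ on its roots $\alpha_1, b/\alpha_1,\dots,\alpha_n,b/\alpha_n$, where $\beta_i=\alpha_i+b/\alpha_i$. Then $G_f$ lies in $G_0=S_2\wr S_n$, the group of permutations of the roots preserving the pairs $\{\alpha_i,b/\alpha_i\}$. Write elements of $G_0$ as $(\mathbf v,\sigma)\in\mathbb{F}_2^n\rtimes S_n$, where $\sigma$ is the induced permutation of pairs and $v_i=1$ iff $\alpha_i$ is sent to $b/\alpha_{\sigma(i)}$ (rather than to $\alpha_{\sigma(i)}$). Let $G_1=\{(\mathbf v,\sigma): \sum_i v_i = 0 \in \mathbb{F}_2\}$, an index-$2$ normal subgroup of $G_0$. For a subgroup $G\subseteq G_0$ and $H\ge 2$, $\mathcal{E}_{n,b}(G;H)$ denotes the number of separable $b$-reciprocal polynomials $f$ of degree $2n$ with coefficients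 in $[-H,H]$ such that $G_g=S_n$ and $G_f\subseteq G$; $\mathcal{E}_{n,b}^{\mathrm{monic}}(G;H)$ counts those among them that are monic. $A\asymp B$ means $A\ll B\ll A$ with constants depending on $n,b$.
   Formalization: The b-reciprocal relation is taken as a_{n-i} = b^i a_{n+i} instead of the printed a_{n+i} = b^i a_{n-i}, since for |b| ≥ 2 the printed one admits no g with f(x) = x^n g(x+b/x) and no monic f; both agree for b = ±1. *)

(* Defs.v *)
From HB Require Import structures.
From mathcomp Require Import all_boot all_order all_algebra all_fingroup all_field.
From mathcomp Require Import finmap zify.
From mathcomp Require Import boolp classical_sets cardinality reals.
From mathcomp Require Import topology normedtype exp.

Set Implicit Arguments.
Unset Strict Implicit.
Unset Printing Implicit Defensive.

Import Order.TTheory GRing.Theory Num.Theory.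
Import numFieldNormedType.Exports.

Local Open Scope ring_scope.

(* The relation is the one forced by f(x) = x^n g(x + b/x): expanding the
   right-hand side, the coefficient of x^(n-i) is b^i times that of x^(n+i). *)
Definition reciprocal (n : nat) (b : int) (f : {poly int}) : Prop :=
  size f = n.*2.+1 /\
  forall i : nat, (i <= n)%N -> f`_(n - i) = b ^+ i * f`_(n + i).

(* g is the degree n polynomial with f(x) = x^n g(x + b/x); algC being
   infinite, the pointwise equation is an identity of rational functions, and
   it determines g. *)
Definition trace_poly (n : nat) (b : int) (f g : {poly int}) : Prop :=
  size g = n.+1 /\
  forall x : algC, x != 0 ->
    (map_poly intr f).[x] = x ^+ n * (map_poly intr g).[x + b%:~R / x].

Definition lists_roots (I : finType) (L : fieldType) (p : {poly int})
    (r : I -> L) : Prop :=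
  map_poly intr p = (lead_coef p)%:~R *: \prod_(i : I) ('X - (r i)%:P).

(* If r lists the roots of a separable rational polynomial, the subfield
   generated by r is its splitting field, and this is its Galois group over the
   rationals as a set of permutations of the indices of the roots. *)
Definition galois_perms (I : finType) (L : splittingFieldType rat)
    (r : I -> L) : {set {perm I}} :=
  let E := <<1 & codom r>>%AS in
  [set s : {perm I} |
    [exists t : gal_of E,
      (t \in 'Gal(E / 1)%g) && [forall i, t (r i) == r (s i)]]]%SET.

Section SignedPermutations.
Variable n : nat.

(* The pair (i, false) indexes alpha_i and (i, true) indexes b / alpha_i. *)
Definition paired_roots (L : fieldType) (b : int) (alpha : 'I_n -> L)
    (k : 'I_n * bool) : L :=
  if k.2 then b%:~R / alpha k.1 else alpha k.1.

Implicit Types s t : {perm ('I_n * bool)}.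

Definition G0 : {set {perm ('I_n * bool)}} :=
  [set s : {perm ('I_n * bool)} |
    [forall i, (s (i, true)).1 == (s (i, false)).1]]%SET.

Definition flip s (i : 'I_n) : 'F_2 := ((s (i, false)).2)%:R.

Definition G1 : {set {perm ('I_n * bool)}} :=
  [set s in G0 | \sum_(i < n) flip s i == 0]%SET.

Lemma G0_fst s (i : 'I_n) (c : bool) :
  s \in G0 -> (s (i, c)).1 = (s (i, false)).1.
Proof. by rewrite inE => /forallP/(_ i)/eqP h; case: c. Qed.

Lemma G0_snd s (i : 'I_n) (c : bool) :
  s \in G0 -> (s (i, c)).2 = c (+) (s (i, false)).2.
Proof.
move=> sG; case: c => //=.
have : s (i, true) != s (i, false) by rewrite (inj_eq perm_inj) -pair_eqE /= andbF.
rewrite [s (i, true)]surjective_pairing [s (i, false)]surjective_pairing.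
rewrite (G0_fst i true sG) -pair_eqE /= eqxx /=.
by case: (_.2); case: (_.2).
Qed.

Lemma G0_group_set : group_set G0.
Proof.
apply/group_setP; split=> [|s t sG tG].
  by rewrite inE; apply/forallP => i; rewrite !perm1.
rewrite inE; apply/forallP => i; rewrite !permM.
rewrite [s (i, true)]surjective_pairing [s (i, false)]surjective_pairing.
by rewrite G0_fst // [in eqbRHS]G0_fst // (G0_fst i true sG).
Qed.

Canonical G0_group := Group G0_group_set.

Lemma flipM s t (i : 'I_n) : t \in G0 ->
  flip (s * t)%g i = flip s i + flip t (s (i, false)).1.
Proof.
move=> tG; rewrite /flip permM.
case: (s (i, false)) => j c /=; rewrite [in LHS](G0_snd _ _ tG).
by case: c (t _).2 => [] []; apply: val_inj.
Qed.

Lemma G0_fst_inj s : s \in G0 -> injective (fun i => (s (i, false)).1).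
Proof.
move=> sG i j eij.
suff /(congr1 fst) : (i, false) = (j, (s (i, false)).2 (+) (s (j, false)).2).
  by [].
apply: (@perm_inj _ s); rewrite [RHS]surjective_pairing G0_fst // -eij G0_snd //.
by rewrite -addbA addbb addbF -surjective_pairing.
Qed.

Lemma G1_group_set : group_set G1.
Proof.
apply/group_setP; split=> [|s t].
  rewrite inE group1 /=; apply/eqP/big1 => i _.
  by rewrite /flip perm1.
rewrite !inE -/G0 => /andP[sG /eqP s0] /andP[tG /eqP t0].
have sG' : s \in G0 by rewrite inE.
have tG' : t \in G0 by rewrite inE.
have : (s * t)%g \in G0 by rewrite groupM.
rewrite inE => -> /=; apply/eqP.
under eq_bigr => i _ do rewrite flipM //.
rewrite big_split /= s0 add0r -[RHS]t0.
by rewrite [RHS](reindex_inj (G0_fst_inj sG')).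
Qed.

Canonical G1_group := Group G1_group_set.

End SignedPermutations.

(* Separability makes the roots b-paired without repetition, so that a family
   alpha as below exists. Both L and alpha are unique up to isomorphism and
   up to conjugating the group on the roots inside G0; in particular the choice
   is immaterial for the normal subgroup G1. *)
Definition admissible (n : nat) (b : int) (G : {set {perm ('I_n * bool)}})
    (f : {poly int}) : Prop :=
  [/\ reciprocal n b f,
      separable_poly (map_poly intr f : {poly rat})
    & exists (g : {poly int}) (L : splittingFieldType rat) (alpha : 'I_n -> L),
        let beta i := alpha i + b%:~R / alpha i in
        [/\ trace_poly n b f g,
            lists_roots f (paired_roots b alpha),
            lists_roots g beta,
            galois_perms beta = [set: {perm 'I_n}]%SET
          & galois_perms (paired_roots b alpha) \subset G]].

Local Open Scope classical_set_scope.

Definition coef_bounded (R : realType) (H : R) (f : {poly int}) : Prop :=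
  forall i : nat, - H <= (f`_i)%:~R <= H.

Definition Eset (R : realType) (n : nat) (b : int)
    (G : {set {perm ('I_n * bool)}}) (H : R) : set {poly int} :=
  [set f | admissible b G f /\ coef_bounded H f].

(* fset_set is empty on infinite sets, so the counts below rely on this. *)
Lemma finite_Eset (R : realType) (n : nat) (b : int)
    (G : {set {perm ('I_n * bool)}}) (H : R) : finite_set (Eset b G H).
Proof.
pose M := Num.truncn `|H|.
pose F (c : {ffun 'I_(n.*2.+1) -> 'I_(M.*2.+1)}) : {poly int} :=
  \poly_(i < n.*2.+1) ((c (inord i) : nat)%:Z - M%:Z).
apply: (@sub_finite_set _ _ [set F c | c in setT]); last first.
  exact/finite_image/finite_finset.
move=> f [[[sf _] _ _] bf].
have bM i : (`|(f`_i)%R| <= M)%N.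
  rewrite truncn_ge_nat // -[_%:R]/((`|(f`_i)%R|%N : int)%:~R) abszE intr_norm.
  by rewrite ler_norml; have /andP[h1 h2] := bf i;
     rewrite (le_trans h2 (ler_norm _)) andbT (le_trans _ h1) // lerN2 ler_norm.
exists [ffun i : 'I_(n.*2.+1) => inord `|(f`_i + M%:Z)%R|%N] => //.
apply/polyP => i; rewrite coef_poly; case: ltnP => hi; last first.
  by rewrite nth_default // sf.
have := bM i; rewrite ffunE (inordK hi) => hM.
rewrite inordK; lia.
Qed.

Definition Ecount (R : realType) (n : nat) (b : int)
    (G : {set {perm ('I_n * bool)}}) (H : R) : nat :=
  #|` fset_set (Eset b G H)|.

Definition Ecount_monic (R : realType) (n : nat) (b : int)
    (G : {set {perm ('I_n * bool)}}) (H : R) : nat :=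
  #|` fset_set (Eset b G H `&` [set f | f \is monic])|.

Definition dominated (R : realType) (A B : R -> R) : Prop :=
  exists2 C : R, 0 < C & \forall H \near +oo, `|A H| <= C * `|B H|.

Definition asymp (R : realType) (A B : R -> R) : Prop :=
  dominated A B /\ dominated B A.

(* Main.v *)
Require Import Defs.
From HB Require Import structures.
From mathcomp Require Import all_boot all_order all_algebra all_fingroup all_field.
From mathcomp Require Import finmap zify ring lra.
From mathcomp Require Import boolp classical_sets cardinality reals.
From mathcomp Require Import topology normedtype sequences exp.
From mathcomp Require Import cyclic ring_quotient.

Set Implicit Arguments.
Unset Strict Implicit.
Unset Printing Implicit Defensive.

Import Order.TTheory GRing.Theory Num.Theory.
Import numFieldNormedType.Exports.
Local Open Scope ring_scope.


(** Write f(x) = x^n g(x + b/x) and g(u) = E(u^2) + u O(u^2); put A = E(4b) and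
    B = O(4b). The product of the alpha_i - b/alpha_i changes sign under (v, s)
    according to the parity of the v_i, and its square is
    (A^2 - 4bB^2) / lead(g)^2; hence G_f lies in G_1 iff A^2 - 4bB^2 = C^2 for
    an integer C. Since g is determined by A, B and its coefficients of degree
    at least 2, everything reduces to counting pairs (A, B) with A, B = O(H).

    Upper bound: (A - C)(A + C) = 4bB^2 forces |A - C| = x y^2 and
    4|b||A + C| = x v^2 with x squarefree, which leaves O(sum_x H/x) pairs.

    Lower bound: A = k(y^2 + b z^2), B = k y z give C = k(y^2 - b z^2), with
    (k, y, z) determined by (A, B) for k squarefree; summing over k yields
    H log H again. To force G_g = S_n, g is kept in a fixed residue class
    modulo three primes, chosen so that Frobenius elements act on the roots of
    g as an n-cycle, an (n-1)-cycle and a transposition. *)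

(** The lower bound asks the same polynomials to have a full group G_g and a square norm, so the
    residue class modulo each of the three primes must itself meet the family in k, y, z. A root r
    of g contributes r^2 - 4b to the norm, and r = w + b/w turns this into (w - b/w)^2. Taking w a
    generator of the field with p^m elements, m > 2, makes the norm of the degree m factor a square
    in the prime field; m = 2 needs another choice of r. A square norm modulo p is then brought to
    the form k, y, z by a rational parametrization of the conic. The residue class fixes k only up
    to squares: k may be the squarefree part of any term of an arithmetic progression, and the
    reciprocals of these parts still sum to at least a constant times log H. Frobenius elements are
    read off in a residue field of the ring of all algebraic integers. This needs integral roots:
    those of g are multiplied by its leading coefficient, which is 1 modulo the primes, so the
    reductions do not change. Separability of f comes from C != 0, which separates each alpha_i from
    b/alpha_i, and from the distinctness of the roots of g. *)

(** * Maximal ideals and residue fields *)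

Section ResidueField.
Variables (R : comNzRingType) (a : R).
Local Open Scope classical_set_scope.

Definition ideal_over (I : set R) : Prop :=
  [/\ I a, ~ I 1 & forall c x y, I x -> I y -> I (c * x + y)].

Lemma maximal_ideal_over : (forall x, a * x != 1) -> exists I : set R,
  ideal_over I /\ forall x, ~ I x -> exists y, I (1 - x * y).
Proof.
move=> a_nunit.
have [|I [Iid Imax]] := @Zorn_bigcup R (fun I => I = set0 \/ ideal_over I).
  move=> F FP Ftot.
  have [[I FI [x Ix]]|F0] := pselect (exists2 I, F I & exists x, I x); last first.
    left; apply/seteqP; split => // x [I FI Ix]; apply: F0; exists I => //.
    by exists x.
  have idI J y : F J -> J y -> ideal_over J.
    by move=> /FP[->|//].
  right; split.
  - by exists I => //; have [] := idI _ _ FI Ix.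
  - by move=> [J FJ J1]; have [_ nJ1 _] := idI _ _ FJ J1; exact: nJ1.
  - move=> c y z [J FJ Jy] [K FK Kz].
    have [JK|KJ] := Ftot _ _ FJ FK.
      by exists K => //; have [_ _ KM] := idI _ _ FK Kz; apply: KM => //; apply: JK.
    by exists J => //; have [_ _ JM] := idI _ _ FJ Jy; apply: JM => //; apply: KJ.
pose aR : set R := [set x | exists y, x = a * y].
have aRid : ideal_over aR.
  split; first by exists 1; rewrite mulr1.
    by move=> [y /esym/eqP]; rewrite (negPf (a_nunit y)).
  by move=> c x y [u ->] [v ->]; exists (c * u + v); ring.
have {}Iid : ideal_over I.
  case: Iid => // I0; case: (Imax aR); last by right.
  by rewrite I0; split => // /(_ a); apply; have [] := aRid.
exists I; split => // x nIx.
have [Ia I1 IM] := Iid.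
have I0 : I 0 by have := IM (- 1) a a Ia Ia; rewrite mulN1r addNr.
(* [J] is the ideal generated by [I] and [x]. By maximality it is not proper, and writing 1 in it
   gives the inverse of [x] modulo [I]. *)
pose J : set R := [set u | exists2 i, I i & exists y, u = i + x * y].
apply: contrapT => nex; case: (Imax J).
  split; first by move=> i Ii; exists i => //; exists 0; ring.
  by move=> JI; apply/nIx/JI; exists 0 => //; exists 1; ring.
right; split.
- by exists a => //; exists 0; ring.
- by move=> [i Ii [y e1]]; apply: nex; exists y; rewrite e1 addrK.
- move=> c u v [i Ii [y ->]] [j Ij [z ->]].
  by exists (c * i + j); [exact: IM|exists (c * y + z); ring].
Qed.

End ResidueField.

(** The quotient by a maximal ideal containing [a]. For the ring of all algebraic integers and [a] a
    prime p, it is a field of characteristic p in which the roots of monic integer polynomials can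
    be reduced. *)
Lemma residue_field (R : comNzRingType) (a : R) : (forall x, a * x != 1) ->
  exists (K : fieldType) (phi : {rmorphism R -> K}), phi a = 0.
Proof.
move=> /maximal_ideal_over[I [[Ia I1 IM] Imax]].
have I0 : I 0 by have := IM (- 1) a a Ia Ia; rewrite mulN1r addNr.
pose S : pred R := fun x => `[< I x >].
have Sid : idealr_closed S.
  split; first exact/asboolP.
    by apply/negP => /asboolP.
  by move=> c x y /asboolP Ix /asboolP Iy; apply/asboolP/IM.
pose SI : idealr R := HB.pack S (isIdealr.Build R S Sid).
pose Q : comNzRingType := {ideal_quot SI}.
pose pi : {rmorphism R -> Q} := \pi_({ideal_quot SI})%qT.
have piE x : (pi x == 0) = `[< I x >].
  by rewrite -(rmorph0 pi) -Quotient.idealrBE subr0.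
have pi_surj (q : Q) : exists x, pi x = q by exists (generic_quotient.repr q); exact: reprK.
have invex (q : Q) : exists r, if q == 0 then r = 0 else r * q = 1.
  case: eqP => [_|/eqP q0]; first by exists 0.
  have [x xq] := pi_surj q; move: q0; rewrite -xq piE => /asboolPn/Imax[y Iy].
  exists (pi y); apply/eqP; rewrite -subr_eq0 -oppr_eq0 opprB -(rmorph1 pi) -rmorphM -rmorphB.
  by rewrite piE; apply/asboolP; rewrite mulrC.
pose inv q := projT1 (cid (invex q)).
have invP q : q != 0 -> inv q * q = 1.
  by rewrite /inv; case: cid => r /=; case: eqP.
have inv0 : inv 0 = 0 by rewrite /inv; case: cid => r /=; rewrite eqxx.
pose K : fieldType := HB.pack Q (GRing.ComNzRing_isField.Build Q invP inv0).
exists K, pi.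
by apply/eqP; rewrite piE; apply/asboolP.
Qed.

(** * The ring of algebraic integers *)

Definition algint := {x : algC | x \in Aint}.
HB.instance Definition _ := SubChoice.on algint.
HB.instance Definition _ := [SubChoice_isSubComNzRing of algint by <:].

Lemma algintP (x : algint) : val x \in Aint.
Proof. exact: valP. Qed.

(** An inverse of p would be rational and integral, hence an ordinary integer. *)
Lemma natr_algint_nunit (p : nat) (x : algint) : prime p -> p%:R * x != 1.
Proof.
move=> p_pr; apply/eqP => /(congr1 val); rewrite rmorphM rmorph_nat rmorph1 => e1.
have p0 : p%:R != 0 :> algC by rewrite pnatr_eq0 -lt0n prime_gt0.
have xE : val x = (p%:R)^-1 by apply: (mulfI p0); rewrite e1 mulfV.
have /intrP[m mE] : val x \in Num.int.
  by apply: Cint_rat_Aint (algintP x); rewrite xE rpredV rpred_nat.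
have : p%:R * m%:~R = 1 :> algC by rewrite -mE xE mulfV.
rewrite -[p%:R]/((p%:Z)%:~R) -intrM => /eqP.
rewrite -[1]/(1%:~R) eqr_int => /eqP /(congr1 absz).
rewrite abszM /= => /eqP; rewrite muln_eq1 => /andP[/eqP p1].
by rewrite p1 in p_pr.
Qed.

(** * Galois action on listed roots *)

Lemma intr_eq0_ratext (L : fieldExtType rat) (z : int) :
  (z%:~R == 0 :> L) = (z == 0).
Proof. by rewrite -(rmorph_int (in_alg L)) fmorph_eq0 intr_eq0. Qed.

Lemma prod_XsubC_codom (I : finType) (K : comNzRingType) (r : I -> K) :
  \prod_i ('X - (r i)%:P) = \prod_(y <- codom r) ('X - y%:P).
Proof. by rewrite codomE big_map big_enum. Qed.

Section Roots.
Variables (I : finType) (L : splittingFieldType rat).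
Implicit Types (p : {poly int}) (r : I -> L).

Lemma map_intr_fixed (K K' : nzRingType) (t : {rmorphism K -> K'}) p :
  map_poly t (map_poly intr p) = map_poly intr p.
Proof. by rewrite -map_poly_comp; apply: eq_map_poly => z /=; rewrite rmorph_int. Qed.

Lemma root_lists_roots p r (x : L) : p != 0 -> lists_roots p r ->
  reflect (exists i, x = r i) (root (map_poly intr p) x).
Proof.
move=> p0 ->.
have l0 : (lead_coef p)%:~R != 0 :> L by rewrite intr_eq0_ratext lead_coef_eq0.
rewrite rootZ // prod_XsubC_codom root_prod_XsubC.
by apply: (iffP codomP) => [[i ->]|[i ->]]; exists i.
Qed.

Lemma gal_perm p r (t : {rmorphism L -> L}) : p != 0 -> lists_roots p r ->
  injective r -> exists s : {perm I}, forall i, t (r i) = r (s i).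
Proof.
move=> p0 pr rI.
have /choice[s sE] i : exists j, t (r i) = r j.
  apply/(root_lists_roots _ p0 pr); rewrite -(map_intr_fixed t) fmorph_root.
  by apply/(root_lists_roots _ p0 pr); exists i.
have sI : injective s by move=> i j e; apply/rI/(fmorph_inj t); rewrite !sE e.
by exists (perm sI) => i; rewrite permE.
Qed.

Lemma galois_roots p r : p != 0 -> lists_roots p r -> injective r ->
  galois 1 <<1 & codom r>>%AS.
Proof.
move=> p0 pr rI.
have l0 : (lead_coef p)%:~R != 0 :> L by rewrite intr_eq0_ratext lead_coef_eq0.
apply/splitting_galoisField; exists (map_poly intr p); split.
- by apply/polyOverP => i; rewrite coef_map /= rpred_int.
- rewrite pr (eqp_separable (eqp_scale _ l0)) prod_XsubC_codom.
  by rewrite separable_prod_XsubC; apply/injectiveP.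
- exists (codom r) => //; rewrite pr prod_XsubC_codom.
  exact: eqp_scale.
Qed.

End Roots.

(** * Frobenius elements *)

Section Frobenius.
Variables (n : nat) (L : splittingFieldType rat) (iota : {rmorphism L -> algC}).
Variables (gam : 'I_n -> L) (g : {poly int}).
Hypotheses (g_monic : g \is monic) (g_roots : lists_roots g gam).

Let E : {subfield L} := <<1 & codom gam>>%AS.

Let gamE i : gam i \in E.
Proof. by apply/seqv_sub_adjoin/codom_f. Qed.

Lemma root_Aint (x : L) : root (map_poly intr g) x -> iota x \in Aint.
Proof.
move=> gx; apply: (@root_monic_Aint (map_poly intr g)).
- by rewrite -(map_intr_fixed iota) fmorph_root.
- exact: monic_map.
- by apply/polyOverP => i; rewrite coef_map /= intr_int.
Qed.

Let conj_root (t : gal_of E) i : root (map_poly intr g) (t (gam i)).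
Proof.
rewrite -(map_intr_fixed t) fmorph_root.
by apply/(root_lists_roots _ (monic_neq0 g_monic) g_roots); exists i.
Qed.

Definition conj_int (t : gal_of E) i : algint :=
  exist _ (iota (t (gam i))) (root_Aint (conj_root t i)).

(* The coefficients of this resolvent in two variables are fixed by the Galois
   group and integral, hence rational integers; reducing them modulo p and
   applying the Frobenius gives the Frobenius element. *)
Definition resolvent (t : gal_of E) : {poly algint} := \poly_(i < n) (if insub i is Some j then conj_int t j else 0).

Lemma resolvent_int : injective gam -> exists P : {poly {poly int}},
  \prod_(t in 'Gal(E / 1)%g) ('X - (resolvent t)%:P) =
  map_poly (map_poly intr) P.
Proof.
move=> gamI; set Phi := \prod_(t in _) _.
have [v vE] : exists v : {rmorphism algint -> algC}, v =1 val by exists \val.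
(* The same resolvents with coefficients in [L], where the Galois group acts; [iota] identifies the
   two products. *)
pose th (t : gal_of E) : {poly L} := \poly_(i < n) (if insub i is Some j then t (gam j) else 0).
pose PhiL : {poly {poly L}} := \prod_(t in 'Gal(E / 1)%g) ('X - (th t)%:P).
have PhiE : map_poly (map_poly v) Phi = map_poly (map_poly iota) PhiL.
  rewrite !rmorph_prod /=; apply: eq_bigr => t _.
 rewrite !rmorphB /= !map_polyX !map_polyC /=.
  congr ('X - _%:P).
  apply/polyP => i; rewrite !coef_map !coef_poly /=.
  by case: ltnP => // hi; [rewrite insubT vE|rewrite !rmorph0].
have thE t : th t \is a polyOver E.
  apply/polyOver_poly => i hi; rewrite insubT //=.
  exact: memv_gal.
have PhiLE j k : PhiL`_j`_k \in E.
  have : PhiL \is a polyOver (polyOver_pred E).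
    by apply: rpred_prod => t _; rewrite rpredB ?polyOverX ?polyOverC ?thE.
  by move/polyOverP/(_ j)/polyOverP/(_ k).
have Phi_fix (u : gal_of E) : u \in 'Gal(E / 1)%g -> map_poly (map_poly u) PhiL = PhiL.
  move=> uG; rewrite rmorph_prod [RHS](reindex_acts 'R _ uG) ?astabsR //=.
  apply: eq_bigr => t tG; rewrite rmorphB /= map_polyX map_polyC /=.
  congr ('X - _%:P); apply/polyP => i; rewrite coef_map !coef_poly.
  case: ltnP => hi; last by rewrite /= linear0.
  by rewrite insubT /= galM.
have Phi_int j k : v Phi`_j`_k \in Num.int.
  rewrite vE; apply: Cint_rat_Aint (algintP _); rewrite -vE.
  have -> : v Phi`_j`_k = iota PhiL`_j`_k.
    by have := congr1 (fun P : {poly {poly algC}} => P`_j`_k) PhiE; rewrite !coef_map /= ?coef_map.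
  have : PhiL`_j`_k \in fixedField 'Gal(E / 1)%g.
    apply/fixedFieldP => // u uG.
    by have := congr1 (fun P : {poly {poly L}} => P`_j`_k) (Phi_fix u uG); rewrite !coef_map /= ?coef_map.
  rewrite (galois_fixedField (galois_roots (monic_neq0 g_monic) g_roots gamI)).
  by move=> /vlineP[q ->]; rewrite alg_num_field fmorph_rat; apply: Crat_rat.
pose P : {poly {poly int}} := \poly_(j < size Phi) \poly_(k < size Phi`_j) Num.floor (v Phi`_j`_k).
exists P; apply/polyP => j; rewrite coef_map coef_poly.
case: ltnP => hj; last by rewrite nth_default //= map_poly0.
apply/polyP => k; rewrite coef_map coef_poly.
case: ltnP => hk; last by rewrite nth_default.
by apply: val_inj; rewrite -!vE rmorph_int floorK.
Qed.

End Frobenius.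

(** The product of the Y - theta_t, over t in the Galois group, has integer coefficients, so the
    Frobenius of the residue field permutes the roots of its reduction. Hence it sends the reduction
    of theta_1 to that of some theta_t. Since theta_t is the polynomial whose coefficient of degree
    i is t (gam i), this single equality says that t acts as the p-th power on all reduced roots at
    once. *)
Lemma frobenius_perm (n p : nat) (L : splittingFieldType rat)
    (iota : {rmorphism L -> algC}) (gam : 'I_n -> L) (g : {poly int}) :
  prime p -> g \is monic -> lists_roots g gam ->
  exists (K : fieldType) (x : 'I_n -> K),
    [/\ p \in [pchar K], lists_roots g x
      & injective x -> injective gam /\ exists2 s, s \in galois_perms gam
                                           & forall i, x (s i) = x i ^+ p].
Proof.
move=> p_pr g_monic g_roots.
have [K [phi phip]] := residue_field (fun x => natr_algint_nunit x p_pr).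
have pcharK : p \in [pchar K] by rewrite inE p_pr -(rmorph_nat phi) phip eqxx.
have gr i : root (map_poly intr g) (gam i).
  by apply/(root_lists_roots _ (monic_neq0 g_monic) g_roots); exists i.
pose u i : algint := exist _ (iota (gam i)) (root_Aint iota g_monic (gr i)).
pose x i := phi (u i).
have [v vE] : exists v : {rmorphism algint -> algC}, v =1 val by exists \val.
have vI : injective v by move=> y z; rewrite !vE; apply: val_inj.
have lead1 (D : nzRingType) : (lead_coef g)%:~R = 1 :> D by rewrite (monicP g_monic).
have prod_phi : map_poly intr g = \prod_i ('X - (phi (u i))%:P).
  have gu : map_poly intr g = \prod_i ('X - (u i)%:P).
    apply: (map_inj_poly vI (rmorph0 v)); rewrite map_intr_fixed rmorph_prod /=.
    rewrite -(map_intr_fixed iota) g_roots lead1 scale1r rmorph_prod /=.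
    apply: eq_bigr => i _; rewrite !rmorphB /= !map_polyX !map_polyC /=.
    by rewrite vE.
  rewrite -(map_intr_fixed phi) gu rmorph_prod /=; apply: eq_bigr => i _.
  by rewrite rmorphB /= map_polyX map_polyC.
exists K, x; split => //; first by rewrite /lists_roots lead1 scale1r prod_phi.
move=> xI.
have gamI : injective gam.
  by move=> i j e; apply: xI; rewrite /x; apply: congr1; apply: val_inj; rewrite /= e.
have [P PE] := resolvent_int iota g_monic g_roots gamI.
pose Phi : {poly {poly K}} := map_poly (map_poly intr) P.
pose th (t : gal_of <<1 & codom gam>>) : {poly K} := map_poly phi (resolvent iota g_monic g_roots t).
have PhiE : Phi = \prod_(t in 'Gal(<<1 & codom gam>> / 1)%g) ('X - (th t)%:P).
  have -> : Phi = map_poly (map_poly phi) (map_poly (map_poly intr) P).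
    rewrite -map_poly_comp; apply: eq_map_poly => q /=.
    by rewrite map_intr_fixed.
  rewrite -PE rmorph_prod /=; apply: eq_bigr => t _.
  by rewrite rmorphB /= map_polyX map_polyC.
pose F := pFrobenius_aut pcharK.
have root1 : Phi.[th 1%g] = 0.
  by rewrite PhiE horner_prod (bigD1 1%g) ?group1 //= hornerXsubC subrr mul0r.
have : Phi.[map_poly F (th 1%g)] = 0.
  have PhiF : map_poly (map_poly F) Phi = Phi.
    rewrite -map_poly_comp; apply: eq_map_poly => q /=.
    by rewrite map_intr_fixed.
  by rewrite -PhiF horner_map root1 rmorph0.
move/eqP; rewrite PhiE horner_prod prodf_seq_eq0 => /hasP[t _ /andP[tG]].
rewrite hornerXsubC subr_eq0 => /eqP eF.
have [s sE] := gal_perm t (monic_neq0 g_monic) g_roots gamI.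
split=> //; exists s.
  by rewrite inE; apply/existsP; exists t; rewrite tG; apply/forallP => i; rewrite sE.
move=> i; have := congr1 (fun q : {poly K} => q`_i) eF.
rewrite !coef_map !coef_poly ltn_ord valK /= => /esym.
rewrite /F pFrobenius_autE.
have cE (w : gal_of <<1 & codom gam>>) j k : w (gam j) = gam k ->
    phi (conj_int iota g_monic g_roots w j) = x k.
  by move=> e; rewrite /x; apply: congr1; apply: val_inj; rewrite /= e.
rewrite (cE _ _ _ (sE i)) (cE _ _ i) //.
by rewrite gal_id.
Qed.

(** * Cycles from factorizations modulo p *)

(** Modulo p, [g] is an irreducible [h] of degree m times distinct linear factors: no root of [h]
    lies in the field with p^j elements for 0 < j < m. All fields of characteristic p are quantified
    over because the residue field in which the roots of [g] reduce is not explicit. *)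
Definition splits_mod (p n m : nat) (g : {poly int}) : Prop :=
  exists (h : {poly int}) (c : seq int),
    [/\ h \is monic, size h = m.+1, size c = (n - m)%N
      & forall K : fieldType, p \in [pchar K] ->
        [/\ map_poly intr g = map_poly intr h * \prod_(z <- c) ('X - (z%:~R)%:P) :> {poly K},
            uniq [seq z%:~R : K | z <- c],
            {in c, forall z, ~~ root (map_poly intr h) (z%:~R : K)}
          & forall x : K, root (map_poly intr h) x ->
              forall j, (0 < j < m)%N -> x ^+ (p ^ j) != x]].

Section FrobeniusOrbit.
Variables (p m : nat) (K : fieldType) (pcharK : p \in [pchar K]).
Variables (h : {poly int}) (h_monic : h \is monic) (sz_h : size h = m.+1).
Hypothesis h_prim : forall x : K, root (map_poly intr h) x ->
  forall j, (0 < j < m)%N -> x ^+ (p ^ j) != x.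
Local Notation hK := (map_poly intr h : {poly K}).

Lemma root_frob (x : K) j : root hK x -> root hK (x ^+ (p ^ j)).
Proof.
move=> hx; elim: j => [|j IHj]; first by rewrite expn0 expr1.
rewrite expnSr exprM -(pFrobenius_autE pcharK).
by rewrite -(map_intr_fixed (pFrobenius_aut pcharK)) fmorph_root.
Qed.

Lemma frob_exprn_inj i : injective (fun x : K => x ^+ (p ^ i)).
Proof.
elim: i => [|i IHi] x y /=; first by rewrite !expn0 !expr1.
rewrite expnSr !exprM -!(pFrobenius_autE pcharK) => /fmorph_inj.
exact: IHi.
Qed.

(** The m iterated Frobenius images of [y] are roots of [h], pairwise distinct by [h_prim], and as
    many as its degree. *)
Lemma frob_orbit (y : K) : root hK y ->
  hK = \prod_(z <- [seq y ^+ (p ^ j) | j <- iota 0 m]) ('X - z%:P) /\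
  uniq [seq y ^+ (p ^ j) | j <- iota 0 m].
Proof.
move=> hy.
have U : uniq [seq y ^+ (p ^ j) | j <- iota 0 m].
  rewrite map_inj_in_uniq ?iota_uniq // => i j; rewrite !mem_iota !add0n /=.
  wlog ij : i j / (i <= j)%N => [H|im jm e].
    by have [/H//|/ltnW/H H' im jm e] := leqP i j; rewrite H'.
  apply/eqP; apply: contraT => nij.
  have ij' : (i < j)%N by rewrite ltn_neqAle nij.
  move: e; rewrite -(subnK ij) expnD exprM => /(@frob_exprn_inj i)/esym/eqP.
  rewrite (negPf (h_prim hy _)) // subn_gt0 ij' /=.
  exact: leq_ltn_trans (leq_subr _ _) jm.
split=> //.
rewrite [LHS](@all_roots_prod_XsubC _ _ [seq y ^+ (p ^ j) | j <- iota 0 m]).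
- by rewrite (monicP (monic_map _ h_monic)) scale1r.
- by rewrite size_map size_iota size_map_poly_id0 ?sz_h // (monicP h_monic) rmorph1 oner_neq0.
- by apply/allP => _ /mapP[j _ ->]; exact: root_frob.
- by rewrite uniq_rootsE.
Qed.

End FrobeniusOrbit.

(** The Frobenius element fixes the reduced roots that come from [c], which lie in the prime field,
    and permutes those of [h] in one orbit. Being trivial off [U] with powers transitive on [U] is
    what is needed of an m-cycle. *)
Lemma frobenius_cycle (n p m : nat) (L : splittingFieldType rat)
    (iota : {rmorphism L -> algC}) (gam : 'I_n -> L) (g : {poly int}) :
  prime p -> g \is monic -> lists_roots g gam ->
  (0 < m <= n)%N -> splits_mod p n m g ->
  injective gam /\ exists2 s, s \in galois_perms gam & exists U : {set 'I_n},
    [/\ #|U| = m, forall i, i \notin U -> s i = i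
      & {in U &, forall i j, exists k, j = (s ^+ k)%g i}].
Proof.
move=> p_pr g_monic g_roots /andP[m0 mn] [h [c [h_monic sz_h sz_c hK]]].
have [K [x [pcharK gx sP]]] := frobenius_perm iota p_pr g_monic g_roots.
have {hK} [gE c_uniq c_h h_prim] := hK K pcharK.
pose hK : {poly K} := map_poly intr h.
have gx1 : \prod_(z <- codom x) ('X - z%:P) = hK * \prod_(z <- c) ('X - (z%:~R)%:P).
  by rewrite -gE gx (monicP g_monic) scale1r prod_XsubC_codom.
have sz_hK : size hK = m.+1.
  by rewrite size_map_poly_id0 ?sz_h // (monicP h_monic) rmorph1 oner_neq0.
(* [K] need not be algebraically closed, but [g] splits in it, so its factor [h] of positive degree
   has a root there. *)
have [y hy] : exists y, root hK y.
  have /dvdp_prod_XsubC[M] : hK %| \prod_(z <- codom x) ('X - z%:P) by rewrite gx1 dvdp_mulr.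
  case E: (mask M _) => [|y s].
    by move/eqp_size; rewrite big_nil size_poly1 sz_hK => -[m_0]; rewrite m_0 in m0.
  move=> e; exists y; rewrite (eqp_root e) root_prod_XsubC.
  by rewrite mem_head.
have orb z (hz : root hK z) := frob_orbit pcharK h_monic sz_h h_prim hz.
have [] := orb y hy; rewrite -/hK => hE o_uniq.
set o := [seq _ | j <- _] in hE o_uniq.
have xo : perm_eq (codom x) (o ++ [seq z%:~R | z <- c]).
  by apply/prod_XsubC_eq; rewrite gx1 big_cat /= -hE big_map.
have oc_uniq : uniq (o ++ [seq z%:~R | z <- c]).
  rewrite cat_uniq o_uniq c_uniq /= andbT; apply/hasPn => _ /mapP[z zc ->].
  by have := c_h z zc; rewrite -/hK hE root_prod_XsubC.
have xI : injective x by apply/injectiveP; rewrite /injectiveb /dinjectiveb -/(codom x) (perm_uniq xo).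
have [gamI [s sG sE]] := sP xI.
split => //; exists s => //; exists [set i | root hK (x i)]%SET; split.
- have -> : #|[set i | root hK (x i)]%SET| = count (root hK) (codom x).
    rewrite cardE /enum_mem size_filter codomE count_map enumT.
    by apply: eq_count => i; rewrite /= !inE.
  rewrite (seq.permP xo) count_cat.
  have -> : count (root hK) o = m.
    rewrite -[RHS](size_iota 0) -(size_map (fun j => y ^+ (p ^ j))); apply/eqP.
    by rewrite -all_count; apply/allP => z; rewrite hE root_prod_XsubC.
  rewrite (eq_in_count (a2 := pred0)) ?count_pred0 ?addn0 //.
  by move=> _ /mapP[z zc ->]; apply/negbTE/c_h.
- move=> i; rewrite inE => hi; apply: xI; rewrite sE.
  have : x i \in o ++ [seq z%:~R | z <- c] by rewrite -(perm_mem xo) codom_f.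
  rewrite mem_cat => /orP[|/mapP[z _ ->]].
    by rewrite -root_prod_XsubC -hE (negPf hi).
  by rewrite -(pFrobenius_autE pcharK) rmorph_int.
- move=> i j; rewrite !inE => hi hj.
  move: hj; rewrite /hK (orb _ hi).1 root_prod_XsubC => /mapP[k _ jE].
  exists k; apply: xI; rewrite jE {jE hi}; elim: k => [|k IHk].
    by rewrite expn0 expr1 expg0 perm1.
  by rewrite expgSr permM sE -IHk expnSr exprM.
Qed.

(** * Generating the symmetric group *)

(** Transitivity conjugates the given transposition to one that moves [x0], and the stabilizer of
    [x0] then carries it to every (x0 y); these generate the symmetric group. *)
Lemma transitive_tperm_full (T : finType) (G : {group {perm T}}) (x0 y1 y2 : T) :
  y1 != y2 -> tperm y1 y2 \in G ->
  (forall x y, exists2 s, s \in G & s x = y) ->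
  (forall x y, x != x0 -> y != x0 -> exists2 s, s \in G & s x0 = x0 /\ s x = y) ->
  G = [set: {perm T}]%G.
Proof.
move=> y12 tG trG trx0; apply/group_inj/eqP; rewrite finset.eqEsubset finset.subsetT /=.
rewrite -(gen_tperm x0) gen_subG; apply/fintype.subsetP => _ /imsetP[y _ ->].
have [->|yx0] := eqVneq y x0; first by rewrite tperm1 group1.
have [s sG sy1] := trG y1 x0.
have sy2 : s y2 != x0 by rewrite -sy1 (inj_eq perm_inj) eq_sym.
have [u uG [ux0 uy]] := trx0 _ _ sy2 yx0.
have : (tperm y1 y2 ^ (s * u))%g \in G by rewrite groupJ ?groupM.
by rewrite tpermJ !permM sy1 ux0 uy.
Qed.

Lemma galois_perms_group (I : finType) (L : splittingFieldType rat) (r : I -> L) :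
  group_set (galois_perms r).
Proof.
apply/group_setP; split=> [|s1 s2].
  rewrite inE; apply/existsP; exists 1%g; rewrite group1 /=.
  by apply/forallP => i; rewrite perm1 gal_id.
rewrite !inE => /existsP[t1 /andP[t1G /forallP t1E]] /existsP[t2 /andP[t2G /forallP t2E]].
apply/existsP; exists (t1 * t2)%g; rewrite groupM //=; apply/forallP => i.
rewrite galM; last exact/seqv_sub_adjoin/codom_f.
by rewrite (eqP (t1E i)) (eqP (t2E _)) permM.
Qed.

(** The n-cycle gives transitivity, the (n-1)-cycle transitivity of the stabilizer of its fixed
    point, and the 2-cycle is a transposition. *)
Lemma galois_perms_full (n p1 p2 p3 : nat) (L : splittingFieldType rat)
    (iota : {rmorphism L -> algC}) (gam : 'I_n -> L) (g : {poly int}) :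
  (1 < n)%N -> prime p1 -> prime p2 -> prime p3 ->
  g \is monic -> lists_roots g gam ->
  splits_mod p1 n n g -> ((2 < n)%N -> splits_mod p2 n (n - 1) g) -> splits_mod p3 n 2 g ->
  injective gam /\ galois_perms gam = [set: {perm 'I_n}]%SET.
Proof.
move=> n1 pr1 pr2 pr3 g_monic g_roots sp1 sp2 sp3.
have := frobenius_cycle iota pr1 g_monic g_roots _ sp1.
case=> [|gamI [s1 s1G [U1 [cU1 _ trU1]]]]; first by rewrite (ltnW n1) leqnn.
split=> //.
have := frobenius_cycle iota pr3 g_monic g_roots _ sp3.
case=> [|_ [s3 s3G [U3 [cU3 s3U3 trU3]]]]; first by rewrite n1.
pose G := Group (galois_perms_group gam).
have U1T : U1 = [set: 'I_n]%SET.
  by apply/eqP; rewrite eqEcard finset.subsetT cU1 cardsT card_ord leqnn.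
have trG x y : exists2 s, s \in G & s x = y.
  have [||k ->] := trU1 x y; rewrite ?U1T ?inE //.
  by exists (s1 ^+ k)%g; rewrite ?groupX.
have /eqP/cards2P[y1 [y2 [y12 U3E]]] := cU3.
have s3T : s3 = tperm y1 y2.
  have s3y1 : s3 y1 = y2.
    apply/eqP; apply: contraT => s3y1.
    have s3y1' : s3 y1 = y1.
      apply/eqP; apply: contraT => s3y1'.
      have s3f : s3 y1 \notin U3 by rewrite U3E !inE negb_or s3y1 s3y1'.
      by have /perm_inj e := s3U3 _ s3f; rewrite e eqxx in s3y1'.
    have [||k] := trU3 y1 y2; rewrite ?U3E ?inE ?eqxx ?orbT //.
    have -> : (s3 ^+ k)%g y1 = y1 by elim: k => [|k IHk]; rewrite ?expg0 ?perm1 // expgSr permM IHk.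
    by move=> e; rewrite e eqxx in y12.
  have s3y2 : s3 y2 = y1.
    apply/eqP; apply: contraT => s3y2.
    have s3y2' : s3 y2 != y2 by rewrite -{2}s3y1 (inj_eq perm_inj) eq_sym.
    have s3f : s3 y2 \notin U3 by rewrite U3E !inE negb_or s3y2 s3y2'.
    by have /perm_inj e := s3U3 _ s3f; rewrite e eqxx in s3y2'.
  apply/permP => x; case: tpermP => [->|->|xy1 xy2] //.
  by apply: s3U3; rewrite U3E !inE negb_or; apply/andP; split; apply/eqP.
have tG : tperm y1 y2 \in G by rewrite -s3T.
suff [x0 Hx0] : exists x0, forall x y, x != x0 -> y != x0 ->
    exists2 s, s \in G & s x0 = x0 /\ s x = y.
  by rewrite -[LHS]/(gval G) (transitive_tperm_full y12 tG trG Hx0).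
(* For n = 2 only one point differs from [y1], and the identity is enough. *)
have [n2|n2] := leqP n 2.
  exists y1 => x y xy1 yy1; exists 1%g; rewrite ?group1 // !perm1; split=> //.
  apply: ord_inj; move: xy1 yy1; rewrite -!val_eqE /=.
  by have := ltn_ord x; have := ltn_ord y; have := ltn_ord y1; lia.
have := frobenius_cycle iota pr2 g_monic g_roots _ (sp2 n2).
case=> [|_ [s2 s2G [U2 [cU2 s2U2 trU2]]]]; first by rewrite subn_gt0 n1 leq_subr.
have /eqP/cards1P[x0 U2E] : #|~: U2| = 1%N by rewrite cardsCs finset.setCK cU2 card_ord; lia.
have memU2 x : x != x0 -> x \in U2.
  by move=> xx0; have := finset.in_set1 x x0; rewrite -U2E inE (negPf xx0) => /negbFE.
exists x0 => x y xx0 yx0.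
have [||k ->] := trU2 x y; rewrite ?memU2 //.
exists (s2 ^+ k)%g; rewrite ?groupX //; split=> //.
have s2x0 : s2 x0 = x0.
  by apply: s2U2; have := finset.set11 x0; rewrite -U2E inE.
by elim: k => [|k IHk]; rewrite ?expg0 ?perm1 // expgSr permM IHk.
Qed.

(** * The norm form of a polynomial *)

Section EvenOddNorm.
Implicit Types R S : comNzRingType.

Definition even_val R (c : R) (q : {poly R}) : R := (even_poly q).[c].
Definition odd_val R (c : R) (q : {poly R}) : R := (odd_poly q).[c].
(** This is q(s) q(-s) for a square root s of [c], written without s. Hence it is multiplicative in
    q, and X - r contributes (s - r)(- s - r) = r^2 - c. *)
Definition even_odd_norm R (c : R) (q : {poly R}) : R :=
  even_val c q ^+ 2 - c * odd_val c q ^+ 2.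

Lemma even_odd_norm_mulXsubC R (c r : R) (q : {poly R}) :
  even_odd_norm c (q * ('X - r%:P)) = even_odd_norm c q * (r ^+ 2 - c).
Proof.
rewrite /even_odd_norm /even_val /odd_val mulrBr [q * r%:P]mulrC mul_polyC -scaleNr.
by rewrite even_polyD odd_polyD even_polyZ odd_polyZ even_polyMX odd_polyMX !(hornerD, hornerZ, hornerMX); ring.
Qed.

Lemma even_odd_norm_prod R (c a : R) (s : seq R) :
  even_odd_norm c (a *: \prod_(z <- s) ('X - z%:P)) = a ^+ 2 * \prod_(z <- s) (z ^+ 2 - c).
Proof.
elim: s => [|z s IHs].
  rewrite !big_nil /even_odd_norm /even_val /odd_val even_polyZ odd_polyZ.
  by rewrite -polyC1 even_polyC odd_polyC !(hornerZ, hornerC); ring.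
by rewrite !big_cons [('X - _) * _]mulrC scalerAl even_odd_norm_mulXsubC IHs; ring.
Qed.

Lemma even_odd_norm_map R S (f : {rmorphism R -> S}) (c : R) (q : {poly R}) :
  even_odd_norm (f c) (map_poly f q) = f (even_odd_norm c q).
Proof.
have ev : even_poly (map_poly f q) = map_poly f (even_poly q).
  by apply/polyP => i; rewrite coef_map !coef_even_poly coef_map.
have od : odd_poly (map_poly f q) = map_poly f (odd_poly q).
  by apply/polyP => i; rewrite coef_map !coef_odd_poly coef_map.
by rewrite /even_odd_norm /even_val /odd_val ev od !horner_map -!rmorphXn -rmorphM -rmorphB.
Qed.

End EvenOddNorm.

(** * Polynomials over the prime field *)

(** The resultant of monic integer polynomials commutes with reduction, so whether it vanishes
    depends on p alone and not on the field of characteristic p. *)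
Lemma common_root_transfer (p : nat) (K K' : fieldType) (h q : {poly int}) (x : K') :
  p \in [pchar K] -> p \in [pchar K'] -> h \is monic -> q \is monic ->
  root (map_poly intr h) x -> root (map_poly intr q) x ->
  (1 < size (gcdp (map_poly intr h : {poly K}) (map_poly intr q)))%N.
Proof.
move=> pK pK' hm qm hx qx.
(* Coefficients become constant polynomials, to be evaluated at 0, because [map_resultant] concerns
   morphisms out of a polynomial ring. *)
pose r := (resultant (map_poly polyC h) (map_poly polyC q)).[0].
have rE (F : fieldType) : r%:~R = resultant (map_poly intr h : {poly F}) (map_poly intr q).
  pose ev0 : {rmorphism {poly int} -> F} := intr \o horner_eval (0 : int).
  have ev0E (f : {poly int}) : map_poly intr f = map_poly ev0 (map_poly polyC f).
    rewrite -map_poly_comp; apply: eq_map_poly => z /=.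
    by rewrite /ev0 /= /horner_eval hornerC.
  rewrite -[LHS]/(ev0 _) map_resultant ?ev0E //;
    by rewrite lead_coef_map_inj ?(monicP hm) ?(monicP qm) ?rmorph1 ?oner_neq0 //; exact: polyC_inj.
have r0 : (p %| r)%Z.
  rewrite (dvdz_pcharf pK') rE resultant_eq0.
  have : 'X - x%:P %| gcdp (map_poly intr h) (map_poly intr q).
    by rewrite dvdp_gcd !dvdp_XsubCl hx qx.
  move/dvdp_leq; rewrite size_XsubC; apply.
  by rewrite gcdp_eq0 negb_and monic_neq0 ?monic_map.
by rewrite -resultant_eq0 -rE -(dvdz_pcharf pK).
Qed.

Section PrimeField.
Variables (p : nat) (K : fieldType) (pcharK : p \in [pchar K]).
Local Notation F := (pFrobenius_aut pcharK).

(** The integers 0, ..., p - 1 already exhaust the p roots that X^p - X can have. *)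
Lemma frob_fixed_int (x : K) : F x = x -> exists z : int, x = z%:~R.
Proof.
have p_pr := pcharf_prime pcharK.
rewrite pFrobenius_autE => xp.
pose s := [seq i%:R : K | i <- iota 0 p].
suff /mapP[i _ ->] : x \in s by exists i.
apply: contraT => xs.
have U : uniq (x :: s).
  rewrite /= xs /= map_inj_in_uniq ?iota_uniq // => i j; rewrite !mem_iota !add0n /= => ip jp.
  move=> /eqP; rewrite -subr_eq0 -[i%:R]/(i%:Z%:~R) -[j%:R]/(j%:Z%:~R) -intrB.
  rewrite -(dvdz_pcharf pcharK) -eqz_mod_dvd => /eqP.
  by rewrite !modz_small ?le0z_nat ?ltz_nat ?ip ?jp // => -[].
have q0 : 'X^p - 'X != 0 :> {poly K}.
  by rewrite -size_poly_gt0 size_polyDl size_polyXn // size_polyN size_polyX ltnS prime_gt1.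
have := max_poly_roots q0 _ U; rewrite size_polyDl size_polyXn ?size_polyN ?size_polyX ?ltnS ?prime_gt1 //.
rewrite /= size_map size_iota ltnn; apply.
have rt y : y ^+ p = y -> root ('X^p - 'X) y by move=> yp; rewrite /root hornerD hornerN hornerXn hornerX yp subrr.
rewrite rt //=; apply/allP => _ /mapP[i _ ->]; apply: rt.
by rewrite -(pFrobenius_autE pcharK) rmorph_nat.
Qed.

Lemma frob_fixed_poly (q : {poly K}) : q \is monic -> map_poly F q = q ->
  exists q' : {poly int}, [/\ q' \is monic, size q' = size q & map_poly intr q' = q].
Proof.
move=> qm qF.
have /choice[c cE] i : exists z : int, q`_i = z%:~R.
  by apply: frob_fixed_int; rewrite -[in RHS]qF coef_map.
have [d sz_q] : exists d, size q = d.+1.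
  by exists (size q).-1; rewrite prednK // size_poly_gt0 monic_neq0.
have szr : (size (\poly_(i < d) c i) < size ('X^d : {poly int}))%N.
  by rewrite size_polyXn ltnS size_poly.
(* The leading coefficient is set to 1 instead of being lifted, which makes the integer polynomial
   monic. *)
exists ('X^d + \poly_(i < d) c i); split.
- by rewrite monicE lead_coefDl // lead_coefXn.
- by rewrite size_polyDl // size_polyXn sz_q.
- apply/polyP => i; rewrite coef_map /= coefD coefXn coef_poly intrD.
  have [->|ni] := eqVneq i d.
    by rewrite ltnn addr0 -[d]/(d.+1.-1) -sz_q -lead_coefE (monicP qm).
  rewrite add0r; case: ltnP => hi; first by rewrite cE.
  by rewrite nth_default // sz_q ltn_neqAle eq_sym ni.
Qed.

End PrimeField.

Lemma finfield_prim_root (K : finFieldType) : exists w : K, (#|K|.-1).-primitive_root w.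
Proof.
have K1 : (1 < #|K|)%N := finNzRing_gt1 K.
have := @has_prim_root K #|K|.-1 (enum (predC1 (0 : K))).
case/(_ _ _ _ _)/hasP=> [||||w _ wP]; last by exists w.
- by rewrite -ltnS prednK // ltnW.
- apply/allP => x; rewrite mem_enum => /= x0; apply/unity_rootP.
  by apply: (mulfI x0); rewrite -exprS prednK ?(ltnW K1) // expf_card mulr1.
- exact: enum_uniq.
- by rewrite -cardE cardC1.
Qed.

Section FrobeniusPowers.
Variables (p : nat) (K : fieldType) (pcharK : p \in [pchar K]).
Implicit Types x y : K.

Lemma exprD_frob x y i : (x + y) ^+ (p ^ i) = x ^+ (p ^ i) + y ^+ (p ^ i).
Proof.
apply: exprDn_pchar; rewrite pnatX; apply/orP; left.
by rewrite pnatE ?(pcharf_prime pcharK).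
Qed.

Lemma intr_frob (z : int) i : (z%:~R : K) ^+ (p ^ i) = z%:~R.
Proof.
elim: i => [|i IHi]; first by rewrite expn0 expr1.
by rewrite expnSr exprM IHi -(pFrobenius_autE pcharK) rmorph_int.
Qed.

(* The product over a Frobenius orbit of length m is fixed by the Frobenius. *)
Lemma prod_frob_orbit (S : comNzRingType) (G : K -> S) (x : K) m : x ^+ (p ^ m) = x ->
  \prod_(i < m) G ((x ^+ (p ^ i)) ^+ p) = \prod_(i < m) G (x ^+ (p ^ i)).
Proof.
case: m => [|m] xm; first by rewrite !big_ord0.
rewrite big_ord_recr big_ord_recl /= expn0 expr1 mulrC -exprM -expnSr xm.
by congr (_ * _); apply: eq_bigr => i _; rewrite -exprM -expnSr.
Qed.

End FrobeniusPowers.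

(** * Local polynomials with square norm *)

(** With w a primitive root of the field with p^m elements and beta = w + b/w, beta^2 - 4b is the
    square of w - b/w, so [D] is the norm of w - b/w down to the prime field. What must be checked
    is that beta still has degree m. *)
Lemma conj_generator (p m : nat) (b : int) :
  prime p -> (2 < p)%N -> ~~ (p %| b)%Z -> (1 < m)%N ->
  exists (K : fieldType) (beta D : K),
    [/\ p \in [pchar K], beta ^+ (p ^ m) = beta,
        forall j, (0 < j < m)%N -> beta ^+ (p ^ j) != beta,
        D ^+ p = D
      & D ^+ 2 = \prod_(i < m) ((beta ^+ (p ^ i)) ^+ 2 - (4 * b)%:~R)].
Proof.
move=> p_pr p2 pb m1.
have [K pK cK] := pPrimePowerField p_pr (ltnW m1).
have [w wP] := finfield_prim_root K.
rewrite cK in wP.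
have q1 : (p ^ m).-1.+1 = (p ^ m)%N by rewrite prednK // expn_gt0 prime_gt0.
have wq : w ^+ (p ^ m) = w by rewrite -cK expf_card.
have p_gt1 := prime_gt1 p_pr.
have q_gt0 : (0 < (p ^ m).-1)%N.
  by have := ltn_exp2l 0 m p_gt1; rewrite (ltnW m1); lia.
have w0 : w != 0.
  apply/eqP => e; have := prim_expr_order wP; rewrite e expr0n.
  by rewrite gtn_eqF // => /eqP; rewrite eq_sym oner_eq0.
have b0 : b%:~R != 0 :> K by rewrite -(dvdz_pcharf pK).
have wj j : (0 < j < m)%N -> w ^+ (p ^ j) != w.
  move=> /andP[j0 jm]; apply/eqP => e.
  have : ((p ^ m).-1 %| (p ^ j).-1)%N.
    rewrite (prim_order_dvd wP); apply/eqP/(mulfI w0).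
    by rewrite -exprS prednK ?expn_gt0 ?prime_gt0 // e mulr1.
  move/dvdn_leq; have := ltn_exp2l j m p_gt1; have := ltn_exp2l 0 j p_gt1; rewrite expn0.
  by rewrite jm j0; lia.
have fr x i : x ^+ (p ^ i) ^+ p = x ^+ p ^+ (p ^ i) :> K by rewrite -!exprM mulnC.
have [m2|m2] := leqP m 2.
  have {m2 m1} m2 : m = 2 by lia.
  subst m.
  (* For m = 2, w + b/w would lie in the prime field if w^(p+1) = b. This [beta] is negated by the
     Frobenius instead: its square is fixed, the two factors coincide, and [D] is their common
     value. Here p must be odd, so that beta != - beta. *)
  pose beta := w - w ^+ p.
  have bp : beta ^+ p = - beta.
    rewrite /beta -(pFrobenius_autE pK) rmorphB /= !pFrobenius_autE.
    by rewrite -exprM mulnn wq opprB.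
  have sq : beta ^+ p ^+ 2 = beta ^+ 2 by rewrite bp sqrrN.
  exists K, beta, (beta ^+ 2 - (4 * b)%:~R); split => //.
  - by rewrite -cK expf_card.
  - move=> j j1; have -> : j = 1%N by lia.
    rewrite expn1 bp -subr_eq0 -opprD oppr_eq0 -mulr2n -mulr_natl mulf_eq0.
    rewrite -(dvdn_pcharf pK) gtnNdvd //= subr_eq0 eq_sym.
    by have := wj 1%N isT; rewrite expn1.
  - rewrite -(pFrobenius_autE pK) rmorphB rmorphXn rmorph_int /=.
    by rewrite pFrobenius_autE sq.
  - by rewrite !big_ord_recl big_ord0 /= expn0 expr1 expn1 sq; ring.
pose beta := w + b%:~R / w.
have wi0 i : w ^+ i != 0 by rewrite expf_neq0.
have bj i : beta ^+ (p ^ i) = w ^+ (p ^ i) + b%:~R / w ^+ (p ^ i).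
  by rewrite /beta (exprD_frob pK) expr_div_n (intr_frob pK).
exists K, beta, (\prod_(i < m) (w ^+ (p ^ i) - b%:~R / w ^+ (p ^ i))); split => //.
- by rewrite -cK expf_card.
- move=> j j1; rewrite bj; apply/eqP => e.
  have {e} : (w ^+ (p ^ j) - w) * (w ^+ (p ^ j).+1 - b%:~R) = 0.
    have -> : (w ^+ (p ^ j) - w) * (w ^+ (p ^ j).+1 - b%:~R) =
       ((w ^+ (p ^ j) + b%:~R / w ^+ (p ^ j)) - (w + b%:~R / w)) * (w * w ^+ (p ^ j)).
      by rewrite exprS; move: (wi0 (p ^ j)%N) w0 => h1 h2; field; rewrite h1 h2.
    by rewrite e subrr mul0r.
  move/eqP; rewrite mulf_eq0 !subr_eq0 (negPf (wj _ j1)) /= => /eqP wb.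
  (* The (p-1)-th power of w^(p^j+1) = b is 1, so the order p^m - 1 of w divides (p^j + 1)(p - 1).
     That number is positive and smaller, as j < m and m > 2. *)
  have : ((p ^ m).-1 %| (p ^ j).+1 * p.-1)%N.
    rewrite (prim_order_dvd wP) exprM wb; apply/eqP/(mulfI b0).
    rewrite -exprS prednK ?prime_gt0 // mulr1.
    by have := intr_frob pK b 1; rewrite expn1.
  move/dvdn_leq; rewrite muln_gt0 /= -subn1 subn_gt0 p_gt1 => /(_ isT).
  have jm : (p ^ j <= p ^ m.-1)%N by rewrite leq_exp2l //; lia.
  have : (p ^ 1 < p ^ m.-1)%N by rewrite ltn_exp2l //; lia.
  rewrite expn1.
  have : (p ^ m = p * p ^ m.-1)%N by rewrite -expnS prednK // ltnW.
  by move: (p ^ m)%N (p ^ m.-1)%N (p ^ j)%N jm => q r s; nia.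
- rewrite -(pFrobenius_autE pK) rmorph_prod /=.
  rewrite -[RHS](prod_frob_orbit (p := p) (fun x => x - b%:~R / x) wq).
  apply: eq_bigr => i _; rewrite rmorphB /= rmorphM fmorphV rmorph_int /=.
  by rewrite pFrobenius_autE.
- rewrite -prodrXl; apply: eq_bigr => i _; rewrite bj intrM.
  by move: (wi0 (p ^ i)%N) => h; field.
Qed.

(** Take k = (A + C)/2, y = 1 and z = B/k: from 4bB^2 = (A + C)(A - C) the term k b z^2 equals (A -
    C)/2. If A + C = 0, the sign of C is changed; if A - C vanishes too, then A = B = 0. *)
Lemma norm_square_param (F : fieldType) (b A B C : F) :
  2%:R != 0 :> F -> b != 0 -> A ^+ 2 - 4%:R * b * B ^+ 2 = C ^+ 2 ->
  exists k y z : F, A = k * (y ^+ 2 + b * z ^+ 2) /\ B = k * y * z.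
Proof.
move=> two0 b0 e.
wlog AC : C e / A + C != 0 => [H|].
  have [AC|/(H _ e)//] := eqVneq (A + C) 0.
  have [AC'|AC'] := eqVneq (A - C) 0; last first.
    by apply: (H (- C)) => //; rewrite sqrrN.
  have C0 : C = 0.
    have : 2%:R * C = (A + C) - (A - C) by ring.
    by rewrite AC AC' subrr => /eqP; rewrite mulf_eq0 (negPf two0) => /eqP.
  have A0 : A = 0 by rewrite -AC C0 addr0.
  exists 0, 0, 0; rewrite !mul0r; split=> //.
  have : (2%:R * 2%:R) * b * B ^+ 2 = 0.
    have -> : (2%:R * 2%:R) * b * B ^+ 2 = A ^+ 2 - (A ^+ 2 - 4%:R * b * B ^+ 2) by ring.
    by rewrite e C0 A0; ring.
  by move/eqP; rewrite !mulf_eq0 (negPf two0) (negPf b0) /= ?orbb => /eqP.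
exists ((A + C) / 2%:R), 1, (B / ((A + C) / 2%:R)).
split; last by field; rewrite AC two0.
have eB : 4%:R * b * B ^+ 2 = (A + C) * (A - C).
  by transitivity (A ^+ 2 - C ^+ 2); [rewrite -e|]; ring.
transitivity ((A + C) / 2%:R + (4%:R * b * B ^+ 2) / (2%:R * (A + C))); last by field; rewrite AC two0.
by rewrite eB; field; rewrite AC two0.
Qed.

Lemma norm_square_param_mod (p : nat) (b A B C : int) :
  prime p -> (2 < p)%N -> ~~ (p %| b)%Z -> (p %| A ^+ 2 - 4 * b * B ^+ 2 - C ^+ 2)%Z ->
  exists k y z : int, (p %| A - k * (y ^+ 2 + b * z ^+ 2))%Z /\ (p %| B - k * y * z)%Z.
Proof.
move=> p_pr p2; have pK := pchar_Fp p_pr; rewrite !(dvdz_pcharf pK) => b0.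
rewrite intrB subr_eq0 => /eqP e.
have two0 : 2%:R != 0 :> 'F_p by rewrite -(dvdn_pcharf pK) gtnNdvd.
have [|k [y [z [e1 e2]]]] := @norm_square_param _ b%:~R A%:~R B%:~R C%:~R two0 b0.
  have -> : C%:~R ^+ 2 = (C ^+ 2)%:~R :> 'F_p by rewrite rmorphXn.
  by rewrite -e; ring.
have lift (x : 'F_p) : ((x : nat)%:Z)%:~R = x by rewrite -[LHS]/((x : nat)%:R) natr_Zp.
exists (k : nat)%:Z, (y : nat)%:Z, (z : nat)%:Z.
rewrite !(dvdz_pcharf pK) !(intrB, intrM, intrD, rmorphXn) /= !lift.
by rewrite -e1 -e2 !subrr.
Qed.

(** The difference of u + b/u and v + b/v is (u - v)(uv - b)/(uv). For u and v of the form |b| + i +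
    1, these bounds make uv - b nonzero modulo every prime above the upper one. *)
Lemma shifted_mul_bounds (b : int) (n i j : nat) : (i < n)%N -> (j < n)%N ->
  (0 < `|((`|b| + i).+1%:Z * (`|b| + j).+1%:Z - b)%R| <= (`|b| + n).+1 ^ 2 + `|b|)%N.
Proof.
move=> hi hj; rewrite -PoszM.
have : ((`|b| + i).+1 * (`|b| + j).+1 <= (`|b| + n).+1 ^ 2)%N.
  by rewrite expnS expn1 leq_mul // ltnS leq_add2l ltnW.
have : (`|b| + i < (`|b| + i).+1 * (`|b| + j).+1)%N by rewrite mulnS leq_addr.
move: (_ * _)%N (_ ^ 2)%N => u v; lia.
Qed.

(** The roots are the conjugates of the [beta] of [conj_generator] and n - m elements u + b/u of the
    prime field. The latter contribute the squares (u - b/u)^2 to the norm, so the norm is C^2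
    modulo p, and [norm_square_param_mod] supplies k, y, z. *)
Lemma local_poly (p m n : nat) (b : int) :
  prime p -> (2 < p)%N -> ((`|b| + n).+1 ^ 2 + `|b| < p)%N -> b != 0 -> (1 < m <= n)%N ->
  exists (g : {poly int}) (k y z : int),
    [/\ g \is monic, size g = n.+1, splits_mod p n m g,
        (p %| even_val (4 * b) g - k * (y ^+ 2 + b * z ^+ 2))%Z
      & (p %| odd_val (4 * b) g - k * y * z)%Z].
Proof.
move=> p_pr p2 p_big b_nz /andP[m1 mn].
have pb : ~~ (p %| b)%Z.
  rewrite dvdzE /= gtnNdvd //; first by rewrite lt0n absz_eq0.
  by apply: leq_trans p_big; rewrite ltnS leq_addl.
have p_big' : ((`|b| + n).+1 < p)%N.
  apply: leq_trans p_big; rewrite ltnS (leq_trans _ (leq_addr _ _)) //.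
  by rewrite -mulnn leq_pmulr.
have [K [beta [D [pK bm bj Dp D2]]]] := conj_generator p_pr p2 pb m1.
have F_int (z : int) : pFrobenius_aut pK z%:~R = z%:~R by rewrite rmorph_int.
(* Starting above |b| keeps the products W i W j away from b; staying below p keeps W j
   invertible. *)
pose W j : int := (`|b| + j).+1.
have W0 j : (j < n - m)%N -> (W j)%:~R != 0 :> K.
  by move=> jn; rewrite -(dvdz_pcharf pK) dvdzE /= gtnNdvd //; move: p_big'; clear -jn; lia.
have /choice[c cE] j : exists z : int, (W j)%:~R + b%:~R / (W j)%:~R = z%:~R :> K.
  by apply: (frob_fixed_int (pcharK := pK)); rewrite rmorphD rmorphM fmorphV /= !F_int.
pose cs := [seq c j | j <- iota 0 (n - m)].
pose orb := [seq beta ^+ (p ^ i) | i <- iota 0 m].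
have orbE (S : comNzRingType) (G : K -> S) : \prod_(z <- orb) G z = \prod_(i < m) G (beta ^+ (p ^ i)).
  by rewrite big_map -{1}[m]subn0 -/(index_iota 0 m) big_mkord.
have [h [hm sz_h hE]] : exists h : {poly int},
    [/\ h \is monic, size h = m.+1 & map_poly intr h = \prod_(z <- orb) ('X - z%:P)].
  have [||h [hm sz_h hE]] := @frob_fixed_poly p K pK (\prod_(z <- orb) ('X - z%:P)).
  - exact: monic_prod_XsubC.
  - rewrite rmorph_prod /= !orbE -[RHS](prod_frob_orbit (p := p) (fun x => 'X - x%:P) bm).
    by apply: eq_bigr => i _; rewrite rmorphB /= map_polyX map_polyC /= pFrobenius_autE.
  - by exists h; rewrite sz_h size_prod_XsubC size_map size_iota.
(* A root of [h] fixed by a smaller power of the Frobenius is a common root with X^(p^j) - X; such a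
   common factor would already appear in [K], where the roots of [h] are the conjugates of
   [beta]. *)
have hprim (K' : fieldType) (x : K') : p \in [pchar K'] -> root (map_poly intr h) x ->
    forall j, (0 < j < m)%N -> x ^+ (p ^ j) != x.
  move=> pK' hx j jm; apply/eqP => xj.
  have q1 : (1 < p ^ j)%N by have := ltn_exp2l 0 j (prime_gt1 p_pr); rewrite expn0; lia.
  have sz_q : (size (- 'X : {poly int}) < size ('X^(p ^ j) : {poly int}))%N.
    by rewrite size_polyN size_polyX size_polyXn ltnS.
  have qm : ('X^(p ^ j) - 'X : {poly int}) \is monic.
    by rewrite monicE lead_coefDl // lead_coefXn.
  have qE (K'' : fieldType) : map_poly intr ('X^(p ^ j) - 'X : {poly int}) = 'X^(p ^ j) - 'X :> {poly K''}.
    by rewrite rmorphB /= map_polyXn map_polyX.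
  have : root (map_poly intr ('X^(p ^ j) - 'X : {poly int})) x.
    by rewrite qE /root hornerD hornerN hornerXn hornerX xj subrr.
  move/(common_root_transfer pK pK' hm qm hx).
  suff /eqP -> : coprimep (map_poly intr h : {poly K}) (map_poly intr ('X^(p ^ j) - 'X : {poly int})) by [].
  rewrite hE qE big_map.
  elim: (iota 0 m) => [|i r IH]; first by rewrite big_nil coprime1p.
  rewrite big_cons coprimepMl IH andbT coprimep_sym coprimep_XsubC.
  rewrite /root hornerD hornerN hornerXn hornerX subr_eq0 -exprM mulnC exprM.
  by apply: contra (bj j jm) => /eqP/(frob_exprn_inj pK) ->.
pose g := h * \prod_(z <- cs) ('X - z%:P).
have gm : g \is monic by rewrite monicMr // monic_prod_XsubC.
have sz_g : size g = n.+1.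
  rewrite size_monicM ?monic_neq0 ?monic_prod_XsubC // sz_h size_prod_XsubC.
  by rewrite size_map size_iota; lia.
have gK (K' : fieldType) : map_poly intr g =
    map_poly intr h * \prod_(z <- cs) ('X - (z%:~R)%:P) :> {poly K'}.
  rewrite rmorphM rmorph_prod /=; congr (_ * _); apply: eq_bigr => z _.
  by rewrite rmorphB /= map_polyX map_polyC.
have [C CE] : exists C : int, D * \prod_(j <- iota 0 (n - m)) ((W j)%:~R - b%:~R / (W j)%:~R) = C%:~R.
  apply: (frob_fixed_int (pcharK := pK)); rewrite rmorphM rmorph_prod /= pFrobenius_autE Dp.
  congr (_ * _); apply: eq_bigr => j _.
  by rewrite rmorphB rmorphM fmorphV /= !F_int.
have nC : (p %| even_val (4 * b) g ^+ 2 - 4 * b * odd_val (4 * b) g ^+ 2 - C ^+ 2)%Z.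
  rewrite (dvdz_pcharf pK) -/(even_odd_norm (4 * b) g) intrB subr_eq0.
  rewrite -(even_odd_norm_map intr) gK hE.
  have -> : \prod_(z <- cs) ('X - (z%:~R)%:P) = \prod_(z <- [seq z%:~R : K | z <- cs]) ('X - z%:P).
    by rewrite big_map.
  rewrite -big_cat -[X in even_odd_norm _ X]scale1r even_odd_norm_prod expr1n mul1r big_cat /=.
  rewrite orbE -D2 big_map /cs big_map rmorphXn /= -CE exprMn; apply/eqP; congr (_ * _).
  rewrite -prodrXl !big_seq; apply: eq_bigr => j; rewrite mem_iota add0n => /W0 Wj0.
  by rewrite -cE intrM; move: (W j)%:~R Wj0 => u u0; field.
have [k [y [z [eA eB]]]] := norm_square_param_mod p_pr p2 pb nC.
exists g, k, y, z; split=> //.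
exists h, cs; split=> //; first by rewrite size_map size_iota.
move=> K' pK'; split=> //; last by move=> x; apply: hprim.
  rewrite -map_comp map_inj_in_uniq ?iota_uniq // => i j.
  rewrite !mem_iota !add0n /= => im jm /eqP.
  rewrite -subr_eq0 -intrB -(dvdz_pcharf pK') (dvdz_pcharf pK) intrB -!cE => /eqP e.
  have : ((W i - W j) * (W i * W j - b))%:~R = 0 :> K.
    rewrite intrM !intrB intrM.
    move: (W0 _ im) (W0 _ jm) e; move: (W i)%:~R (W j)%:~R => u v u0 v0 e.
    transitivity ((u + b%:~R / u - (v + b%:~R / v)) * (u * v)); last by rewrite e mul0r.
    by field; rewrite u0 v0.
  move/eqP; rewrite -(dvdz_pcharf pK) dvdzE abszM Euclid_dvdM //.
  have [->//|nij] := eqVneq i j.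
  case/orP => /dvdn_leq; last first.
    have /andP[Wij0 Wij] := shifted_mul_bounds b (leq_trans im (leq_subr _ _)) (leq_trans jm (leq_subr _ _)).
    by move=> /(_ Wij0); rewrite leqNgt (leq_ltn_trans Wij p_big).
  by rewrite /W; move: nij p_big'; clear -im jm; lia.
(* An integer is fixed by the Frobenius, which [hprim] with j = 1 < m forbids for a root of [h]. *)
move=> z' z'cs; apply/negP => hz'.
have := hprim K' _ pK' hz' 1%N; rewrite m1 => /(_ isT).
by rewrite (intr_frob pK') eqxx.
Qed.

(** * Residue classes and the Chinese remainder theorem *)

Definition poly_mod (M : int) (g g' : {poly int}) : Prop :=
  exists q : {poly int}, g = g' + M *: q.

Lemma poly_modP (M : int) (g g' : {poly int}) :
  (forall i, (M %| g`_i - g'`_i)%Z) -> poly_mod M g g'.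
Proof.
move=> dv; exists (\poly_(i < maxn (size g) (size g')) ((g`_i - g'`_i) %/ M)%Z).
apply/polyP => i; rewrite coefD coefZ coef_poly; case: ltnP => [_|].
  by rewrite mulrC divzK // addrC subrK.
by rewrite geq_max => /andP[h1 h2]; rewrite !nth_default // mulr0 addr0.
Qed.

Lemma poly_mod_even_val (M c : int) (g g' : {poly int}) :
  poly_mod M g g' -> (M %| even_val c g - even_val c g')%Z.
Proof.
move=> [q ->]; rewrite /even_val even_polyD even_polyZ hornerD hornerZ.
by rewrite addrAC subrr add0r dvdz_mulr.
Qed.

Lemma poly_mod_odd_val (M c : int) (g g' : {poly int}) :
  poly_mod M g g' -> (M %| odd_val c g - odd_val c g')%Z.
Proof.
move=> [q ->]; rewrite /odd_val odd_polyD odd_polyZ hornerD hornerZ.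
by rewrite addrAC subrr add0r dvdz_mulr.
Qed.

Lemma poly_modW (M N : int) (g g' : {poly int}) :
  (N %| M)%Z -> poly_mod M g g' -> poly_mod N g g'.
Proof.
move=> /dvdzP[d ->] [q ->]; exists (d *: q).
by rewrite scalerA mulrC.
Qed.

Lemma poly_mod_trans (M : int) (g1 g2 g3 : {poly int}) :
  poly_mod M g1 g2 -> poly_mod M g2 g3 -> poly_mod M g1 g3.
Proof. by move=> [q ->] [r ->]; exists (r + q); rewrite scalerDr addrA. Qed.

Lemma splits_mod_congr (p n m : nat) (g g' : {poly int}) :
  poly_mod p g g' -> splits_mod p n m g' -> splits_mod p n m g.
Proof.
move=> [q ->] [h [c [hm sz_h sz_c hK]]]; exists h, c; split=> // K pK.
have [gE ? ? ?] := hK K pK; split=> //.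
rewrite -gE -mul_polyC rmorphD rmorphM /= map_polyC /=.
by rewrite -[p%:~R]/(p%:R) (pcharf0 pK) mul0r addr0.
Qed.

Lemma int_crt (M N x y : int) : coprimez M N ->
  exists z : int, (M %| z - x)%Z /\ (N %| z - y)%Z.
Proof.
move=> /coprimezP[[u v] /= e]; exists (x * (v * N) + y * (u * M)); split.
  have -> : x * (v * N) + y * (u * M) - x = (y * u - x * u) * M.
    transitivity (x * (v * N) + y * (u * M) - x * (u * M + v * N)); first by rewrite e mulr1.
    by ring.
  exact: dvdz_mull.
have -> : x * (v * N) + y * (u * M) - y = (x * v - y * v) * N.
  transitivity (x * (v * N) + y * (u * M) - y * (u * M + v * N)); first by rewrite e mulr1.
  by ring.
exact: dvdz_mull.
Qed.

Section ResidueClass.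
Variables (n : nat) (b : int).

(** A residue class that meets the family in k, y, z. Leading coefficient 1 serves the monic count
    and makes rescaling of the roots invisible modulo [M]. *)
Definition norm_class (M : int) (g : {poly int}) (k y z : int) : Prop :=
  [/\ size g = n.+1, (M %| g`_n - 1)%Z,
      (M %| even_val (4 * b) g - k * (y ^+ 2 + b * z ^+ 2))%Z
    & (M %| odd_val (4 * b) g - k * y * z)%Z].

Lemma norm_class_congr (M : int) (g g' : {poly int}) (k y z k' y' z' : int) :
  size g = n.+1 -> poly_mod M g g' -> (M %| k - k')%Z -> (M %| y - y')%Z -> (M %| z - z')%Z ->
  norm_class M g' k' y' z' -> norm_class M g k y z.
Proof.
move=> sz gg' hk hy hz [sz' lg' hA hB]; split=> //.
- have -> : g`_n - 1 = (g - g')`_n + (g'`_n - 1) by rewrite coefB; ring.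
  by case: gg' => q ->; rewrite addrAC subrr add0r coefZ rpredD // dvdz_mulr.
- have -> : even_val (4 * b) g - k * (y ^+ 2 + b * z ^+ 2) =
     (even_val (4 * b) g - even_val (4 * b) g') +
     (even_val (4 * b) g' - k' * (y' ^+ 2 + b * z' ^+ 2)) -
     ((k - k') * (y ^+ 2 + b * z ^+ 2) + (y - y') * (k' * (y + y')) + (z - z') * (k' * b * (z + z'))) by ring.
  apply: rpredB; first by apply: rpredD => //; exact: poly_mod_even_val.
  by apply: rpredD; [apply: rpredD|]; apply: dvdz_mulr.
- have -> : odd_val (4 * b) g - k * y * z =
     (odd_val (4 * b) g - odd_val (4 * b) g') + (odd_val (4 * b) g' - k' * y' * z') -
     ((k - k') * (y * z) + (y - y') * (k' * z) + (z - z') * (k' * y')) by ring.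
  apply: rpredB; first by apply: rpredD => //; exact: poly_mod_odd_val.
  by apply: rpredD; [apply: rpredD|]; apply: dvdz_mulr.
Qed.

Lemma norm_class_crt (M1 M2 : int) g1 g2 k1 y1 z1 k2 y2 z2 :
  M1 * M2 != 0 -> coprimez M1 M2 ->
  norm_class M1 g1 k1 y1 z1 -> norm_class M2 g2 k2 y2 z2 ->
  exists g k y z, [/\ norm_class (M1 * M2) g k y z, poly_mod M1 g g1 & poly_mod M2 g g2].
Proof.
move=> M0 co c1 c2.
have [sz1 _ _ _] := c1; have [sz2 _ _ _] := c2.
have /choice[d dE] i := int_crt (g1`_i) (g2`_i) co.
have [k [k1E k2E]] := int_crt k1 k2 co.
have [y [y1E y2E]] := int_crt y1 y2 co.
have [z [z1E z2E]] := int_crt z1 z2 co.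
(* A zero representative is replaced by the nonzero M1 M2 of the same class, so that the degree is
   exactly n. *)
pose d' i := if d i == 0 then M1 * M2 else d i.
have d'0 i : d' i != 0 by rewrite /d'; case: ifPn.
have d'E i : (M1 %| d' i - g1`_i)%Z /\ (M2 %| d' i - g2`_i)%Z.
  have [h1 h2] := dE i; rewrite /d'; case: eqVneq h1 h2 => [->|//].
  rewrite !sub0r => h1 h2.
  by split; apply: rpredD => //; rewrite -?sub0r //; [apply: dvdz_mulr|apply: dvdz_mull].
pose g := \poly_(i < n.+1) d' i.
have sz : size g = n.+1 by rewrite size_poly_eq.
have gg1 : poly_mod M1 g g1.
  apply: poly_modP => i; rewrite coef_poly; case: ltnP => [_|hi]; first by have [] := d'E i.
  by rewrite nth_default ?sz1 // subrr dvdz0.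
have gg2 : poly_mod M2 g g2.
  apply: poly_modP => i; rewrite coef_poly; case: ltnP => [_|hi]; first by have [] := d'E i.
  by rewrite nth_default ?sz2 // subrr dvdz0.
exists g, k, y, z; split=> //.
have [_ l1 A1 B1] := norm_class_congr sz gg1 k1E y1E z1E c1.
have [_ l2 A2 B2] := norm_class_congr sz gg2 k2E y2E z2E c2.
by split=> //; rewrite Gauss_dvdz // ?l1 ?A1 ?B1.
Qed.
End ResidueClass.

(** * Passage to a monic polynomial *)

Lemma coef_prod_XsubC_scale (K : comNzRingType) (a : K) (s : seq K) i : (i <= size s)%N ->
  (\prod_(z <- s) ('X - (a * z)%:P))`_i = a ^+ (size s - i) * (\prod_(z <- s) ('X - z%:P))`_i.
Proof.
elim: s i => [|z s IHs] i; first by rewrite leqn0 => /eqP->; rewrite !big_nil mul1r.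
rewrite !big_cons -[size (z :: s)]/(size s).+1 => hi; rewrite !mulrBl !coefB !mul_polyC !coefZ !coefXM.
have [e|ne] := eqVneq i (size s).+1.
  have z0 (w : K -> K) : (\prod_(z <- s) ('X - (w z)%:P))`_(size s).+1 = 0.
    by apply: nth_default; rewrite size_prod_XsubC.
  rewrite e /= (z0 (fun z => a * z)) (z0 id).
  by rewrite !mulr0 !subr0 IHs // subnn subnn.
have {}hi : (i <= size s)%N by lia.
rewrite (IHs i) // subSn // exprS.
case: i hi ne => [|i] hi ne /=; first by ring.
rewrite (IHs i (ltnW hi)).
have -> : (size s - i = (size s - i.+1).+1)%N by lia.
by rewrite exprS; ring.
Qed.

Lemma galois_perms_scale (I : finType) (L : splittingFieldType rat) (r : I -> L) (a : int) :
  a != 0 -> galois_perms (fun i => a%:~R * r i) = galois_perms r.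
Proof.
move=> a0; have aL : a%:~R != 0 :> L by rewrite intr_eq0_ratext.
set r' := fun i => a%:~R * r i.
have EE : <<1 & codom r'>>%AS = <<1 & codom r>>%AS.
  apply/val_inj/eqP; rewrite /= eqEsubv; apply/andP; split; apply/Fadjoin_seqP; split;
    rewrite ?subv_adjoin_seq // => _ /codomP[i ->].
    by rewrite rpredM ?rpred_int // seqv_sub_adjoin ?codom_f.
  rewrite -[r i](mulKf aL) rpredM ?rpredV ?rpred_int //.
  by rewrite seqv_sub_adjoin //; apply/codomP; exists i.
rewrite /galois_perms EE; apply/setP => s; rewrite !inE; apply: eq_existsb => t.
congr (_ && _); apply: eq_forallb => i.
by rewrite rmorphM rmorph_int (inj_eq (mulfI aL)).
Qed.

(* The monic polynomial whose roots are the roots of g multiplied by its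
   leading coefficient. *)
Definition monicization (n : nat) (g : {poly int}) : {poly int} :=
  'X^n + \poly_(i < n) (g`_n ^+ (n - i.+1) * g`_i).

Lemma monicization_monic n (g : {poly int}) : monicization n g \is monic.
Proof. by rewrite monicE lead_coefDl ?lead_coefXn // size_polyXn ltnS size_poly. Qed.

Lemma monicization_roots n (L : splittingFieldType rat) (g : {poly int}) (r : 'I_n -> L) :
  size g = n.+1 -> lists_roots g r ->
  lists_roots (monicization n g) (fun i => (g`_n)%:~R * r i).
Proof.
move=> sz gr; have lg : lead_coef g = g`_n by rewrite lead_coefE sz.
have g0 : g`_n != 0 by rewrite -lg lead_coef_eq0 -size_poly_eq0 sz.
rewrite /lists_roots (monicP (monicization_monic n g)) scale1r.
have cE : size (codom r) = n by rewrite size_codom card_ord.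
have -> : \prod_i ('X - ((g`_n)%:~R * r i)%:P) = \prod_(z <- codom r) ('X - ((g`_n)%:~R * z)%:P).
  by rewrite codomE big_map big_enum.
apply/polyP => i; rewrite coef_map /= coefD coefXn coef_poly.
have gi j : (g`_j)%:~R = (g`_n)%:~R * (\prod_(z <- codom r) ('X - z%:P))`_j.
  by have := congr1 (fun q : {poly L} => q`_j) gr; rewrite coef_map coefZ /= lg prod_XsubC_codom.
have [hi|hi] := ltnP n i.
  rewrite gtn_eqF // ltnNge (ltnW hi) addr0 nth_default //.
  have -> : \prod_(z <- codom r) ('X - ((g`_n)%:~R * z)%:P) =
     \prod_(z <- [seq (g`_n)%:~R * z | z <- codom r]) ('X - z%:P) by rewrite big_map.
  by rewrite size_prod_XsubC size_map cE.
rewrite coef_prod_XsubC_scale cE //.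
have [->|ne] := eqVneq i n.
  rewrite ltnn addr0 subnn mul1r; apply/(mulfI (x := (g`_n)%:~R)).
    by rewrite intr_eq0_ratext.
  by rewrite -gi mulr1.
have {ne}hi : (i < n)%N by lia.
rewrite hi add0r intrM gi rmorphXn /= mulrA -exprSr.
by congr (_ ^+ _ * _); lia.
Qed.

(** The leading coefficient and its powers are 1 modulo [M]; hence the factorizations prescribed for
    [g] hold for a monic polynomial, to which the Frobenius argument applies. *)
Lemma monicization_mod (M : int) n (g : {poly int}) : size g = n.+1 -> (M %| g`_n - 1)%Z ->
  poly_mod M (monicization n g) g.
Proof.
move=> sz hM; apply: poly_modP => i; rewrite coefD coefXn coef_poly.
have [hi|hi] := ltnP n i.
  by rewrite gtn_eqF // ltnNge (ltnW hi) /= nth_default ?sz // subrr dvdz0.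
have [->|ne] := eqVneq i n; first by rewrite ltnn addr0 -opprB rpredN.
have -> : (i < n)%N by lia.
rewrite add0r -{2}[g`_i]mul1r -mulrBl dvdz_mulr // -(expr1n _ (n - i.+1)) subrXX.
exact: dvdz_mulr.
Qed.

(** * A residue class with full Galois group *)

Lemma full_class_exists (n : nat) (b : int) : (0 < n)%N -> b != 0 ->
  exists (M : nat) (g0 : {poly int}) (k y z : int),
    [/\ (0 < M)%N, norm_class n b M g0 k y z
      & forall (g : {poly int}) (L : splittingFieldType rat) (iota : {rmorphism L -> algC})
          (r : 'I_n -> L),
        size g = n.+1 -> poly_mod M g g0 -> lists_roots g r ->
        injective r /\ galois_perms r = [set: {perm 'I_n}]%SET].
Proof.
move=> n0 b0; have [n1|n1] := leqP n 1.
  have {n0} n1 : n = 1%N by lia.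
  subst n; exists 1%N, 'X, 0, 0, 0; split=> //.
    by split; rewrite ?dvd1z // size_polyX.
  move=> g L iota r _ _ _; split=> [i j _|]; first by rewrite !ord1.
  apply/setP => s; rewrite [RHS]inE.
  have -> : s = 1%g by apply/permP => i; rewrite !ord1.
  exact: (group1 (Group (galois_perms_group r))).
(* Primes above [N] are larger than 2 and satisfy the size condition of [local_poly]. *)
pose N := ((`|b| + n).+1 ^ 2 + `|b|).+2%N.
have [p1 Np1 pr1] := prime_above N.
have [p2 p12 pr2] := prime_above p1.
have [p3 p23 pr3] := prime_above p2.
have big p : (N < p)%N -> (2 < p)%N /\ ((`|b| + n).+1 ^ 2 + `|b| < p)%N.
  by rewrite /N; move: (_ ^ 2 + _)%N => u; lia.
have [[p1_2 p1b] [[p2_2 p2b] [p3_2 p3b]]] := (big _ Np1, (big _ (ltn_trans Np1 p12), big _ (ltn_trans Np1 (ltn_trans p12 p23)))).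
(* For n = 2 no (n-1)-cycle is asked for; the value 2 only keeps the degree in the range of
   [local_poly]. *)
pose m2 := if (2 < n)%N then (n - 1)%N else 2.
have [|g1 [k1 [y1 [z1 [gm1 sz1 sp1 A1 B1]]]]] := @local_poly p1 n n b pr1 p1_2 p1b b0.
  by rewrite n1 leqnn.
have [|g2 [k2 [y2 [z2 [gm2 sz2 sp2 A2 B2]]]]] := @local_poly p2 m2 n b pr2 p2_2 p2b b0.
  by rewrite /m2; case: ifP; lia.
have [|g3 [k3 [y3 [z3 [gm3 sz3 sp3 A3 B3]]]]] := @local_poly p3 2 n b pr3 p3_2 p3b b0.
  by rewrite n1.
have lead (g : {poly int}) (p : nat) : g \is monic -> size g = n.+1 -> (p %| g`_n - 1)%Z.
  by move=> /monicP; rewrite lead_coefE => + sz; rewrite sz => ->; rewrite subrr dvdz0.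
have c1 : norm_class n b p1 g1 k1 y1 z1 by split=> //; exact: lead.
have c2 : norm_class n b p2 g2 k2 y2 z2 by split=> //; exact: lead.
have c3 : norm_class n b p3 g3 k3 y3 z3 by split=> //; exact: lead.
have cop p q : prime p -> prime q -> (p < q)%N -> coprimez p q.
  move=> pp pq pltq; rewrite coprimezE /= prime_coprime // dvdn_prime2 //.
  by rewrite ltn_eqF.
have P0 p : prime p -> p%:Z != 0 by move=> /prime_gt0; case: p.
have [||g12 [k12 [y12 [z12 [c12 e1 e2]]]]] := norm_class_crt _ _ c1 c2.
- by rewrite mulf_neq0 ?P0.
- exact: cop.
have [||g0 [k [y [z [c123 e12 e3]]]]] := norm_class_crt _ _ c12 c3.
- by rewrite !mulf_neq0 ?P0.
- by rewrite coprimezMl !cop // (ltn_trans p12).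
exists (p1 * p2 * p3)%N, g0, k, y, z; split=> //.
  by rewrite !muln_gt0 !prime_gt0.
move=> g L iota r sz gg0 gr.
have [_ lg _ _] := c123.
have ln : ((p1 * p2 * p3)%N %| g`_n - 1)%Z.
  have -> : g`_n - 1 = (g - g0)`_n + (g0`_n - 1) by rewrite coefB; ring.
  case: gg0 => q ->; rewrite addrAC subrr add0r coefZ; apply: rpredD => //.
  exact: dvdz_mulr.
have gt0 := poly_mod_trans (monicization_mod sz ln) gg0.
have d12 : ((p1 * p2)%N %| (p1 * p2 * p3)%N%:Z)%Z by rewrite dvdzE /= dvdn_mulr.
have gt12 := poly_mod_trans (poly_modW d12 gt0) e12.
have d1 : (p1 %| (p1 * p2)%N%:Z)%Z by rewrite dvdzE /= dvdn_mulr.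
have d2 : (p2 %| (p1 * p2)%N%:Z)%Z by rewrite dvdzE /= dvdn_mull.
have d3 : (p3 %| (p1 * p2 * p3)%N%:Z)%Z by rewrite dvdzE /= dvdn_mull.
have s1 := splits_mod_congr (poly_mod_trans (poly_modW d1 gt12) e1) sp1.
have s2 := splits_mod_congr (poly_mod_trans (poly_modW d2 gt12) e2) sp2.
have s3 := splits_mod_congr (poly_mod_trans (poly_modW d3 gt0) e3) sp3.
have gn0 : g`_n != 0 by rewrite -[n]/(n.+1.-1) -sz -lead_coefE lead_coef_eq0 -size_poly_eq0 sz.
have s2' : (2 < n)%N -> splits_mod p2 n (n - 1) (monicization n g).
  by move=> n2; move: s2; rewrite /m2 n2.
have [rI full] := galois_perms_full iota n1 pr1 pr2 pr3 (monicization_monic n g)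
  (monicization_roots sz gr) s1 s2' s3.
split; last by rewrite -full galois_perms_scale.
by move=> i j e; apply: rI; rewrite /= e.
Qed.

(** * The lift from g to f *)

Section RecipLift.
Implicit Types (R S : comNzRingType) (F : fieldType).

(* x^n g(x + b/x), written without denominators. *)
Definition recip_basis R (n : nat) (b : R) (k : nat) : {poly R} :=
  'X^(n - k) * ('X^2 + b%:P) ^+ k.

Definition recip_lift R (n : nat) (b : R) (g : {poly R}) : {poly R} :=
  \sum_(k < n.+1) g`_k *: recip_basis n b k.

Lemma recip_lift_map R S (f : {rmorphism R -> S}) n (b : R) (g : {poly R}) :
  map_poly f (recip_lift n b g) = recip_lift n (f b) (map_poly f g).
Proof.
rewrite /recip_lift rmorph_sum; apply: eq_bigr => k _.
rewrite /= map_polyZ coef_map /=; congr (_ *: _); rewrite /recip_basis.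
by rewrite rmorphM /= map_polyXn rmorphXn /= rmorphD /= map_polyXn map_polyC.
Qed.

Lemma recip_lift_horner F n (b : F) (g : {poly F}) x : (size g <= n.+1)%N -> x != 0 ->
  (recip_lift n b g).[x] = x ^+ n * g.[x + b / x].
Proof.
move=> sz x0; rewrite (horner_coef_wide _ sz) /recip_lift horner_sum big_distrr /=.
apply: eq_bigr => k _; rewrite hornerZ /recip_basis hornerM hornerXn horner_exp hornerD hornerXn hornerC.
rewrite [RHS]mulrCA; congr (_ * _).
have kn : (k <= n)%N by rewrite -ltnS.
have -> : x ^+ n = x ^+ (n - k) * x ^+ k by rewrite -exprD subnK.
rewrite -mulrA; congr (_ * _).
by rewrite -exprMn; congr (_ ^+ _); field.
Qed.

Lemma recip_basis_monic R n (b : R) k : recip_basis n b k \is monic.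
Proof.
rewrite /recip_basis monicMl ?monicXn // monic_exp // monicE lead_coefDl ?lead_coefXn //.
by rewrite size_polyXn size_polyC; case: (b != 0).
Qed.

Lemma size_recip_basis R n (b : R) k : (k <= n)%N -> size (recip_basis n b k) = (n + k).+1.
Proof.
move=> kn.
have m2 : ('X^2 + b%:P : {poly R}) \is monic.
  by rewrite monicE lead_coefDl ?lead_coefXn // size_polyXn size_polyC; case: (b != 0).
have sz2 : size ('X^2 + b%:P : {poly R}) = 3.
  by rewrite size_polyDl ?size_polyXn // size_polyC; case: (b != 0).
have szk : size (('X^2 + b%:P : {poly R}) ^+ k) = (k.*2).+1.
  elim: k {kn} => [|k IHk]; first by rewrite expr0 size_poly1.
  by rewrite exprS size_monicM ?monic_neq0 ?monic_exp // IHk sz2; lia.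
by rewrite /recip_basis size_monicM ?monicXn ?monic_neq0 ?monic_exp // szk size_polyXn; lia.
Qed.

(** Unitriangularity: the upper half of the coefficients of f determines those of g, from the top
    down, with 1 on the diagonal. This gives the degree and leading coefficient of the lift and the
    bound for its inverse. *)
Lemma recip_basis_top R n (b : R) k j : (k <= n)%N ->
  (k <= j)%N -> (recip_basis n b k)`_(n + j) = (k == j)%:R.
Proof.
move=> kn; rewrite leq_eqVlt => /orP[/eqP <-|kj].
  by rewrite eqxx -[(n + k)%N]/((n + k).+1.-1) -(size_recip_basis b kn) -lead_coefE (monicP (recip_basis_monic _ _ _)).
by rewrite (ltn_eqF kj) nth_default // size_recip_basis // ltn_add2l.
Qed.

Lemma coef_recip_lift R n (b : R) (g : {poly R}) i :
  (recip_lift n b g)`_i = \sum_(k < n.+1) g`_k * (recip_basis n b k)`_i.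
Proof. by rewrite coef_sum; apply: eq_bigr => k _; rewrite coefZ. Qed.

Lemma recip_lift_top R n (b : R) (g : {poly R}) j : (j <= n)%N ->
  (recip_lift n b g)`_(n + j) =
  g`_j + \sum_(k < n.+1 | (j < k)%N) g`_k * (recip_basis n b k)`_(n + j).
Proof.
move=> jn; rewrite coef_recip_lift (bigD1 (Ordinal (jn : (j < n.+1)%N))) //=.
rewrite recip_basis_top // eqxx mulr1; congr (_ + _).
rewrite [LHS](bigID (fun k : 'I_n.+1 => (j < k)%N)) /= [X in _ + X]big1 ?addr0.
  apply: eq_bigl => k; rewrite -val_eqE /= andbC.
  by case: ltngtP.
move=> k /andP[kj]; rewrite -leqNgt => kj'.
rewrite recip_basis_top //; last by rewrite -ltnS.
by rewrite -val_eqE /= in kj; rewrite (negPf kj) mulr0.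
Qed.

Lemma size_recip_lift R n (b : R) (g : {poly R}) : size g = n.+1 ->
  size (recip_lift n b g) = n.*2.+1 /\ lead_coef (recip_lift n b g) = lead_coef g.
Proof.
move=> sz.
have top : (recip_lift n b g)`_(n.*2) = g`_n.
  rewrite -addnn recip_lift_top // big1 ?addr0 // => k nk.
  by have := ltn_ord k; rewrite ltnS leqNgt nk.
have gn : g`_n != 0 by rewrite -[n]/(n.+1.-1) -sz -lead_coefE lead_coef_eq0 -size_poly_eq0 sz.
have szf : size (recip_lift n b g) = n.*2.+1.
  apply/eqP; rewrite eqn_leq; apply/andP; split.
    apply/leq_sizeP => j hj; rewrite coef_recip_lift big1 // => k _.
    rewrite [X in _ * X]nth_default ?mulr0 // size_recip_basis; last by rewrite -ltnS.
    by have := ltn_ord k; lia.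
  by rewrite ltnNge; apply: contra gn => /leq_sizeP/(_ _ (leqnn _)); rewrite top => ->.
by split=> //; rewrite !lead_coefE szf sz /= top.
Qed.

(** The symmetry of [reciprocal] with the degree only bounded, so that it can be built factor by
    factor: X and X^2 + b each move the centre [c] up by one. *)
Definition centered R (c : nat) (b : R) (q : {poly R}) : Prop :=
  (size q <= c.*2.+1)%N /\ forall i, (i <= c)%N -> q`_(c - i) = b ^+ i * q`_(c + i).

Lemma centered_mulX R c (b : R) q : centered c b q -> centered c.+1 b ('X * q).
Proof.
move=> [sz qc].
have q0 m : (c.*2 < m)%N -> q`_m = 0 by move=> hm; apply: nth_default; exact: leq_trans sz hm.
split.
  apply/leq_sizeP => m hm; rewrite coefXM; case: eqP => // _; apply: q0; lia.
move=> i; rewrite leq_eqVlt => /orP[/eqP ->|ic].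
  by rewrite subnn !coefXM eqxx /= addnS /= q0 ?mulr0 //; lia.
by rewrite subSn // !coefXM /= ?addSn /= qc.
Qed.

Lemma centered_mulX2 R c (b : R) q : centered c b q -> centered c.+1 b (('X^2 + b%:P) * q).
Proof.
move=> [sz qc].
have q0 m : (c.*2 < m)%N -> q`_m = 0 by move=> hm; apply: nth_default; exact: leq_trans sz hm.
have qE m : (('X^2 + b%:P) * q)`_m = (if (m < 2)%N then 0 else q`_(m - 2)) + b * q`_m.
  by rewrite mulrDl coefD coefXnM coefCM.
split.
  apply/leq_sizeP => m hm; rewrite qE ltnNge.
  have -> : (1 < m)%N by lia.
  by rewrite !q0 ?mulr0 ?addr0 //; lia.
case=> [|i] ic; first by rewrite subn0 addn0 mul1r.
rewrite !qE subSS.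
have -> : (c.+1 + i.+1 < 2)%N = false by lia.
have -> : (c.+1 + i.+1 - 2 = c + i)%N by lia.
rewrite qc //.
have [e|[e|e]] : i = c \/ i.+1 = c \/ (i.+2 <= c)%N by lia.
- rewrite e subnn /= add0r [q`_(c.+1 + _)]q0; last by lia.
  by rewrite exprS; ring.
- have -> : (c - i < 2)%N by lia.
  rewrite [q`_(c.+1 + _)]q0; last by lia.
  by rewrite exprS; ring.
- have -> : (c - i < 2)%N = false by lia.
  have -> : (c - i - 2 = c - i.+2)%N by lia.
  rewrite qc //.
  have -> : (c.+1 + i.+1 = c + i.+2)%N by lia.
  by rewrite !exprS; ring.
Qed.

Lemma centered_recip_basis R n (b : R) k : (k <= n)%N -> centered n b (recip_basis n b k).
Proof.
move=> kn; rewrite /recip_basis -[in centered _](subnK kn).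
have : centered k b (('X^2 + b%:P) ^+ k).
  elim: k {kn} => [|k IHk]; last by rewrite exprS; apply: centered_mulX2.
  by rewrite expr0; split=> [|i]; rewrite ?size_poly1 // leqn0 => /eqP->; rewrite mul1r.
move: (_ ^+ k) => q qc; elim: (n - k)%N => [|m IHm]; first by rewrite mul1r.
by rewrite exprS -mulrA addSn; apply: centered_mulX.
Qed.

Lemma centered_recip_lift R n (b : R) (g : {poly R}) i : (i <= n)%N ->
  (recip_lift n b g)`_(n - i) = b ^+ i * (recip_lift n b g)`_(n + i).
Proof.
move=> hi; rewrite !coef_recip_lift big_distrr /=; apply: eq_bigr => k _.
have [_ ->] // := centered_recip_basis b (ltnSE (ltn_ord k)).
by rewrite mulrCA.
Qed.

End RecipLift.

Lemma recip_lift_reciprocal n (b : int) (g : {poly int}) : size g = n.+1 ->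
  reciprocal n b (recip_lift n b g).
Proof.
by move=> sz; split; [have [] := size_recip_lift b sz|move=> i; exact: centered_recip_lift].
Qed.

Lemma poly_eq_nonzero (F : fieldType) (q r : {poly F}) : [pchar F] =i pred0 ->
  (forall x, x != 0 -> q.[x] = r.[x]) -> q = r.
Proof.
move=> /pcharf0P F0 qr; apply/eqP; rewrite -subr_eq0; apply: contraT => d0.
have := max_poly_roots d0 (rs := [seq (i.+1)%:R | i <- iota 0 (size (q - r))]).
rewrite size_map size_iota ltnn; apply.
  apply/allP => _ /mapP[i _ ->]; rewrite /root hornerD hornerN qr ?subrr //.
  by rewrite F0.
rewrite map_inj_uniq ?iota_uniq // => i j.
wlog ij : i j / (i <= j)%N => [H|/esym/eqP].
  by have [/H//|/ltnW/H H' /esym/H'] := leqP i j.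
by rewrite -subr_eq0 -natrB // subSS F0 subn_eq0 => ji; apply/eqP; rewrite eqn_leq ij.
Qed.

Lemma trace_polyP n (b : int) (f g : {poly int}) :
  trace_poly n b f g <-> size g = n.+1 /\ f = recip_lift n b g.
Proof.
have liftE (h : {poly int}) : size h = n.+1 -> forall x : algC, x != 0 ->
    (map_poly intr (recip_lift n b h)).[x] = x ^+ n * (map_poly intr h).[x + b%:~R / x].
  move=> sz x x0; rewrite recip_lift_map recip_lift_horner //.
  by rewrite -sz; apply: size_poly.
split=> [[sz fg]|[sz ->]]; split=> //; last exact: liftE.
apply: (@map_inj_poly _ algC intr) => //; first exact: intr_inj.
apply: poly_eq_nonzero => [|x x0]; first exact: pchar_num.
by rewrite fg // liftE.
Qed.

(** Each factor comes from x (x + b/x - alpha - b/alpha) = (x - alpha)(x - b/alpha). *)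
Lemma paired_rootsP n (b : int) (F : fieldType) (g : {poly int}) (alpha : 'I_n -> F) :
  [pchar F] =i pred0 -> size g = n.+1 -> (forall i, alpha i != 0) ->
  lists_roots g (fun i => alpha i + b%:~R / alpha i) ->
  lists_roots (recip_lift n b g) (paired_roots b alpha).
Proof.
move=> F0 sz a0 gr; rewrite /lists_roots (size_recip_lift b sz).2.
apply: poly_eq_nonzero => // x x0.
rewrite recip_lift_map recip_lift_horner //; last by rewrite -sz; apply: size_poly.
rewrite gr !hornerZ mulrCA; congr (_ * _); rewrite !horner_prod.
rewrite -(pair_bigA _ (fun i c => ('X - (paired_roots b alpha (i, c))%:P).[x])) /=.
have -> : x ^+ n = \prod_(i < n) x by rewrite prodr_const card_ord.
rewrite -big_split /=; apply: eq_bigr => i _; rewrite big_bool /= !hornerXsubC /paired_roots /=.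
by have := a0 i; move: (alpha i) => a ai; field; rewrite x0 ai.
Qed.

(** * The group G1 and square norms *)

Section Discriminant.
Variables (n : nat) (b : int) (F : fieldType) (alpha : 'I_n -> F).

Definition sqrt_norm : F := \prod_(i < n) (alpha i - b%:~R / alpha i).

Lemma sqrt_norm_sqr : (forall i, alpha i != 0) ->
  sqrt_norm ^+ 2 = \prod_(i < n) ((alpha i + b%:~R / alpha i) ^+ 2 - (4 * b)%:~R).
Proof.
move=> a0; rewrite -prodrXl; apply: eq_bigr => i _; rewrite intrM.
by have := a0 i; move: (alpha i) => a ai; field.
Qed.

Lemma paired_roots_partner (i : 'I_n) c : alpha i != 0 -> b%:~R != 0 :> F ->
  b%:~R / paired_roots b alpha (i, c) = paired_roots b alpha (i, ~~ c).
Proof.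
rewrite /paired_roots /=; case: c => //= ai b0.
by rewrite invf_div mulrC divfK.
Qed.

(** Since t fixes b, it commutes with x -> b/x and so preserves the pairs; a factor alpha_i -
    b/alpha_i goes to the factor of the image pair, with a minus sign exactly when the pair is
    flipped. *)
Lemma gal_sqrt_norm (t : {rmorphism F -> F}) (s : {perm ('I_n * bool)}) :
  (forall i, alpha i != 0) -> b%:~R != 0 :> F -> injective (paired_roots b alpha) ->
  (forall k, t (paired_roots b alpha k) = paired_roots b alpha (s k)) ->
  s \in G0 n /\ t sqrt_norm = (-1) ^+ (\sum_(i < n) (s (i, false)).2) * sqrt_norm.
Proof.
move=> a0 b0 rI ts.
have sE i : s (i, true) = ((s (i, false)).1, ~~ (s (i, false)).2).
  apply: rI; rewrite -ts -paired_roots_partner // -surjective_pairing -ts.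
  by rewrite -[paired_roots b alpha (i, true)]/(b%:~R / paired_roots b alpha (i, false)) rmorphM fmorphV rmorph_int.
have sG : s \in G0 n by rewrite inE; apply/forallP => i; rewrite sE.
split=> //; rewrite rmorph_prod /=.
have -> : \prod_(i < n) t (alpha i - b%:~R / alpha i) = \prod_(i < n)
    ((-1) ^+ (s (i, false)).2 * (alpha (s (i, false)).1 - b%:~R / alpha (s (i, false)).1)).
  apply: eq_bigr => i _; rewrite rmorphB /= rmorphM fmorphV rmorph_int.
  have := ts (i, false); rewrite [paired_roots _ _ _]/= => ->.
  move: (s (i, false)) => [j c] /=; rewrite paired_roots_partner // /paired_roots.
  by case: c => /=; rewrite ?expr0 ?expr1 ?mul1r // mulN1r opprB.
rewrite big_split /= prodrXr; congr (_ * _).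
by rewrite [RHS](reindex_inj (G0_fst_inj sG)).
Qed.

End Discriminant.

Lemma mem_G1 n (s : {perm ('I_n * bool)}) : s \in G0 n ->
  (s \in G1 n) = ~~ odd (\sum_(i < n) (s (i, false)).2).
Proof.
move=> sG; rewrite inE sG /= /flip -natr_sum -(dvdn_pcharf (pchar_Fp (isT : prime 2))).
by rewrite dvdn2.
Qed.

(** A rational root of the monic polynomial X^2 - z is an algebraic integer, hence an integer. *)
Lemma rat_sqr_int (q : rat) (z : int) : q ^+ 2 = z%:~R -> exists c : int, z = c ^+ 2.
Proof.
move=> e; have /intrP[c cE] : (ratr q : algC) \in Num.int.
  apply: Cint_rat_Aint; first exact: Crat_rat.
  have sz : (size (- (z%:P) : {poly int}) < size ('X^2 : {poly int}))%N.
    by rewrite size_polyN size_polyXn size_polyC; case: (z != 0).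
  apply: (@root_monic_Aint (map_poly intr ('X^2 - z%:P))).
  - rewrite rmorphB /= map_polyXn map_polyC /= /root hornerD hornerN hornerXn hornerC.
    by rewrite -rmorphXn e /= ratr_int subrr.
  - by apply: monic_map; rewrite monicE lead_coefDl // lead_coefXn.
  - by apply/polyOverP => i; rewrite coef_map /= intr_int.
exists c; apply: (@intr_inj algC); rewrite rmorphXn /= -cE -rmorphXn e.
by rewrite /= ratr_int.
Qed.

Lemma pchar0_ratext (L : fieldExtType rat) : [pchar L] =i pred0.
Proof. by move=> p; rewrite pchar_lalg pchar_num. Qed.

Lemma lists_roots_norm n (F : fieldType) (c : int) (g : {poly int}) (r : 'I_n -> F) :
  lists_roots g r ->
  (even_odd_norm c g)%:~R = (lead_coef g)%:~R ^+ 2 * \prod_i (r i ^+ 2 - c%:~R) :> F.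
Proof.
move=> gr; rewrite -(even_odd_norm_map intr) gr prod_XsubC_codom even_odd_norm_prod.
by rewrite codomE big_map big_enum.
Qed.

(** The constant coefficient of the lift is b^n times the leading coefficient of [g], so 0 is not a
    root. *)
Lemma lists_roots_neq0 n (b : int) (F : fieldType) (g : {poly int}) (alpha : 'I_n -> F) :
  [pchar F] =i pred0 -> b != 0 -> size g = n.+1 ->
  lists_roots (recip_lift n b g) (paired_roots b alpha) -> forall i, alpha i != 0.
Proof.
move=> /pcharf0P F0 b0 sz fr i; apply/eqP => ai.
have int0 (z : int) : z != 0 -> z%:~R != 0 :> F.
  by case: z => m; rewrite ?NegzE ?mulrNz ?oppr_eq0 -[_%:~R]/(_%:R) F0.
have [szf lf] := size_recip_lift b sz.
have : (map_poly intr (recip_lift n b g)).[0] = 0 :> F.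
  rewrite fr hornerZ horner_prod (bigD1 (i, false)) //= hornerXsubC /paired_roots /= ai.
  by rewrite subrr mul0r mulr0.
rewrite horner_coef0 coef_map /= => /eqP; apply/negP/int0.
have := centered_recip_lift b g (leqnn n); rewrite subnn addnn => ->.
rewrite mulf_neq0 ?expf_neq0 // -[n.*2]/(n.*2.+1.-1) -szf -lead_coefE lf.
by rewrite lead_coef_eq0 -size_poly_eq0 sz.
Qed.

(** The Galois group inside G1 fixes [sqrt_norm], which is therefore rational; times the leading
    coefficient of [g] its square is the integer norm, so it is itself an integer. *)
Lemma G1_norm_square n (b : int) (f : {poly int}) : b != 0 -> admissible b (G1 n) f ->
  exists (g : {poly int}) (C : int),
    [/\ size g = n.+1, f = recip_lift n b g & even_odd_norm (4 * b) g = C ^+ 2].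
Proof.
move=> b0 [_ fsep [g [L [alpha [/trace_polyP[sz fE] fr gr _ G1P]]]]].
have f0 : f != 0.
  by rewrite -size_poly_eq0 fE (size_recip_lift b sz).1.
have lf0 : (lead_coef f)%:~R != 0 :> L by rewrite intr_eq0_ratext lead_coef_eq0.
have bL : b%:~R != 0 :> L by rewrite intr_eq0_ratext.
have rI : injective (paired_roots b alpha).
  have : separable_poly (map_poly intr f : {poly L}).
    by rewrite -(map_intr_fixed (in_alg L)) separable_map.
  rewrite fr (eqp_separable (eqp_scale _ lf0)) prod_XsubC_codom separable_prod_XsubC.
  by move/injectiveP.
have a0 : forall i, alpha i != 0.
  by apply: (lists_roots_neq0 (pchar0_ratext L) b0 sz); rewrite -fE.
pose E : {subfield L} := <<1 & codom (paired_roots b alpha)>>%AS.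
have aE i : alpha i \in E.
  by apply/seqv_sub_adjoin/codomP; exists (i, false).
have dE : sqrt_norm b alpha \in E.
  by apply: rpred_prod => i _; rewrite rpredB ?rpredM ?rpredV ?rpred_int.
have : sqrt_norm b alpha \in fixedField 'Gal(E / 1)%g.
  apply/fixedFieldP => // t tG.
  have [s sE] := gal_perm t f0 fr rI.
  have [sG0 ->] := gal_sqrt_norm a0 bL rI sE.
  have : s \in G1 n.
    apply: (fintype.subsetP G1P); rewrite inE; apply/existsP; exists t.
    by rewrite tG; apply/forallP => k; rewrite sE.
  by rewrite mem_G1 // => /negPf ev; rewrite -signr_odd ev expr0 mul1r.
rewrite (galois_fixedField (galois_roots f0 fr rI)) => /vlineP[q qE].
have [C CE] : exists C : int, even_odd_norm (4 * b) g = C ^+ 2.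
  apply: (@rat_sqr_int ((lead_coef g)%:~R * q)); apply: (fmorph_inj (in_alg L)).
  rewrite [RHS]rmorph_int (lists_roots_norm _ gr) -sqrt_norm_sqr // qE.
  by rewrite rmorphXn rmorphM rmorph_int exprMn.
by exists g, C.
Qed.

Lemma splitting_field_paired n (b : int) (g : {poly int}) : b != 0 -> size g = n.+1 ->
  exists (L : splittingFieldType rat) (iota : {rmorphism L -> algC}) (alpha : 'I_n -> L),
    (forall i, alpha i != 0) /\ lists_roots g (fun i => alpha i + b%:~R / alpha i).
Proof.
move=> b0 sz.
have gn : lead_coef g != 0 by rewrite lead_coef_eq0 -size_poly_eq0 sz.
have [rs gE] := closed_field_poly_normal (map_poly intr g : {poly algC}).
have lE : lead_coef (map_poly intr g : {poly algC}) = (lead_coef g)%:~R.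
  by rewrite lead_coef_map_inj //; exact: intr_inj.
have lC : (lead_coef g)%:~R != 0 :> algC by rewrite intr_eq0.
have sz_rs : size rs = n.
  have := congr1 (fun q : {poly algC} => size q) gE.
  rewrite lE size_scale // size_prod_XsubC size_map_inj_poly ?sz //; last exact: intr_inj.
  by case.
(* The two roots of x^2 - r x + b have sum r and product b, so either of them serves as alpha for
   the root r of [g]. *)
have /choice[a aP] i : exists a : algC, a ^+ 2 - rs`_i * a + b%:~R = 0.
  have [a aE] := solve_monicpoly (fun j => if j == 0%N then - b%:~R else rs`_i : algC) (isT : (0 < 2)%N).
  by exists a; rewrite aE !big_ord_recl big_ord0 /= /bump /=; ring.
have bC : b%:~R != 0 :> algC by rewrite intr_eq0.
have a0 i : a i != 0.
  by apply: contra_neq bC => ai; have := aP i; rewrite ai => <-; ring.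
have aE i : a i + b%:~R / a i = rs`_i.
  have := aP i; move: (a0 i); move: (a i) => x x0 e.
  apply: (mulIf x0); rewrite mulrDl divfK //; apply/eqP; rewrite -subr_eq0; apply/eqP; rewrite -[RHS]e; ring.
have [Q [iota [s1 s1E genQ]]] := num_field_exists [seq a i | i <- iota 0 n].
have sz_s1 : size s1 = n by rewrite -(size_map iota) s1E size_map size_iota.
pose alpha (i : 'I_n) : Q := s1`_i.
have alphaE i : iota (alpha i) = a i.
  rewrite /alpha -(nth_map 0 0) ?sz_s1 // s1E (nth_map 0%N) ?size_iota //.
  by rewrite nth_iota.
have alpha0 i : alpha i != 0 by rewrite -(fmorph_eq0 iota) alphaE.
have gr : lists_roots g (fun i => alpha i + b%:~R / alpha i).
  apply: (map_inj_poly (fmorph_inj iota) (rmorph0 iota)).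
  rewrite map_intr_fixed gE lE map_polyZ rmorph_int rmorph_prod /=; congr (_ *: _).
  rewrite (big_nth 0) sz_rs big_mkord; apply: eq_bigr => i _.
  rewrite rmorphB /= map_polyX map_polyC /= rmorphD rmorphM fmorphV rmorph_int /=.
  by rewrite alphaE aE.
have fr := paired_rootsP (pchar0_ratext Q) sz alpha0 gr.
have [szf lf] := size_recip_lift b sz.
have Qsplit : SplittingField.axiom Q.
  exists (map_poly intr (recip_lift n b g)).
    by apply/polyOverP => i; rewrite coef_map /= rpred_int.
  exists (codom (paired_roots b alpha)).
    rewrite fr prod_XsubC_codom; apply: eqp_scale.
    by rewrite intr_eq0_ratext lf.
  apply/eqP; rewrite eqEsubv subvf /= -genQ; apply/Fadjoin_seqP; split.
    exact: subv_adjoin_seq.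
  move=> x /(nthP 0)[i]; rewrite sz_s1 => hi <-.
  by apply/seqv_sub_adjoin/codomP; exists (Ordinal hi, false).
pose L : splittingFieldType rat := HB.pack Q (FieldExt_isSplittingField.Build rat Q Qsplit).
by exists L, iota, alpha.
Qed.

(** From C != 0 no factor alpha_i - b/alpha_i vanishes; with distinct beta_i this makes all 2n roots
    distinct. The rational [sqrt_norm] is fixed and nonzero, so no automorphism can change its
    sign. *)
Lemma norm_square_G1 n (b : int) (g : {poly int}) (C : int) :
  b != 0 -> size g = n.+1 -> C != 0 -> even_odd_norm (4 * b) g = C ^+ 2 ->
  (forall (L : splittingFieldType rat) (iota : {rmorphism L -> algC}) (r : 'I_n -> L),
     lists_roots g r -> injective r /\ galois_perms r = [set: {perm 'I_n}]%SET) ->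
  admissible b (G1 n) (recip_lift n b g).
Proof.
move=> b0 sz C0 gC full.
have [L [iota [alpha [a0 gr]]]] := splitting_field_paired b0 sz.
have [betaI galb] := full L iota _ gr.
have fr := paired_rootsP (pchar0_ratext L) sz a0 gr.
have [szf lf] := size_recip_lift b sz.
have bL : b%:~R != 0 :> L by rewrite intr_eq0_ratext.
have gl : lead_coef g != 0 by rewrite lead_coef_eq0 -size_poly_eq0 sz.
have glL : (lead_coef g)%:~R != 0 :> L by rewrite intr_eq0_ratext.
have CL : C%:~R != 0 :> L by rewrite intr_eq0_ratext.
have dC : ((lead_coef g)%:~R * sqrt_norm b alpha) ^+ 2 = C%:~R ^+ 2.
  by rewrite exprMn sqrt_norm_sqr // -(lists_roots_norm _ gr) gC rmorphXn.
have d0 : sqrt_norm b alpha != 0.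
  apply: contra_neq CL => d0; apply/eqP; rewrite -sqrf_eq0 -dC d0 mulr0.
  by rewrite expr0n.
have rI : injective (paired_roots b alpha).
  have beta_pr (i : 'I_n) c : paired_roots b alpha (i, c) + b%:~R / paired_roots b alpha (i, c) =
      alpha i + b%:~R / alpha i.
    by rewrite paired_roots_partner //; case: c; rewrite /paired_roots //= addrC.
  move=> [i c] [j d] e.
  have ij : i = j by apply: betaI; rewrite -(beta_pr i c) -(beta_pr j d) e.
  subst j; have : alpha i - b%:~R / alpha i != 0.
    by move: d0; rewrite /sqrt_norm (bigD1 i) //= mulf_eq0 negb_or => /andP[].
  rewrite subr_eq0; move: e; rewrite /paired_roots /=.
  by case: c; case: d => //= e /eqP ne; case: ne; first [exact: e|exact: esym e].
split.
- exact: recip_lift_reciprocal.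
- rewrite -(separable_map (in_alg L)) map_intr_fixed fr.
  rewrite (eqp_separable (eqp_scale _ _)) ?lf // prod_XsubC_codom separable_prod_XsubC.
  exact/injectiveP.
- exists g, L, alpha; split=> //; first exact/trace_polyP.
  apply/fintype.subsetP => s; rewrite [s \in galois_perms _]inE => /existsP[t /andP[tG /forallP tE]].
  have [sG0 td] := gal_sqrt_norm (t := t) a0 bL rI (fun k => eqP (tE k)).
  have td' : t (sqrt_norm b alpha) = sqrt_norm b alpha.
    have tM : (lead_coef g)%:~R * t (sqrt_norm b alpha) = t ((lead_coef g)%:~R * sqrt_norm b alpha).
      by rewrite rmorphM rmorph_int.
    by move/eqP: dC; rewrite eqf_sqr => /orP[] /eqP e; apply: (mulfI glL);
      rewrite tM e ?rmorphN rmorph_int.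
  rewrite mem_G1 //; apply/negP => od; move: td; rewrite -signr_odd od expr1 mulN1r [LHS]td' => /eqP.
  rewrite -subr_eq0 opprK -mulr2n -mulr_natl mulf_eq0 (negPf d0) orbF.
  by rewrite -[2%:R]/(2%:~R) intr_eq0_ratext.
Qed.

(** * Squarefree parts and counting squares *)

Definition sqfree (s : nat) : Prop := forall e, (e ^ 2 %| s)%N -> e = 1%N.

Lemma sqfree_gt0 s : sqfree s -> (0 < s)%N.
Proof. by case: s => // /(_ 0%N); rewrite dvdn0 => /(_ isT). Qed.

Lemma sqfree_decomp m : (0 < m)%N -> exists s d, [/\ sqfree s, (0 < d)%N & m = (s * d ^ 2)%N].
Proof.
move=> m0.
have [|d|d d2 dmax] := @ex_maxnP (fun d => d ^ 2 %| m)%N m; first by exists 1%N; rewrite exp1n dvd1n.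
  move=> /(dvdn_leq m0); apply: leq_trans.
  by case: d => // d; rewrite -mulnn leq_pmulr.
have d0 : (0 < d)%N by case: d d2 {dmax} => //; rewrite exp0n // dvd0n; case: m m0.
exists (m %/ d ^ 2)%N, d; split=> //; last by rewrite divnK.
move=> e e2; apply/eqP; rewrite eqn_leq; apply/andP; split.
  have : ((d * e) ^ 2 %| m)%N.
    by rewrite expnMn -(divnK d2) mulnC dvdn_mul // .
  by move/dmax; rewrite -{2}[d]muln1 leq_pmul2l.
case: e e2 => //; rewrite exp0n // dvd0n; move: (divnK d2); case: (m %/ _)%N => //.
by move=> e _; rewrite -e in m0.
Qed.

(** Write x = x1 g with g = gcd(x, w). As x1 is coprime to w/g, it divides g; then x1^2 divides x
    and x1 = 1. *)
Lemma sqfree_dvd_sqr x w : sqfree x -> (x %| w ^ 2)%N -> (x %| w)%N.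
Proof.
move=> sx xw; have x0 := sqfree_gt0 sx.
have g0 : (0 < gcdn x w)%N by rewrite gcdn_gt0 x0.
pose g := gcdn x w; pose x1 := (x %/ g)%N; pose w1 := (w %/ g)%N.
have xE : x = (x1 * g)%N by rewrite divnK // dvdn_gcdl.
have wE : w = (w1 * g)%N by rewrite divnK // dvdn_gcdr.
have co : coprime x1 w1.
  rewrite /coprime; apply/eqP/(@eqP _ _ 1%N); rewrite -(eqn_pmul2r g0) mul1n muln_gcdl.
  by rewrite -/g -xE -wE.
have : (x1 %| w1 ^ 2 * g)%N.
  rewrite -(dvdn_pmul2r g0) -xE -mulnA mulnn -expnMn -wE.
  exact: xw.
rewrite Gauss_dvdr; last by rewrite coprimeXr.
move=> /dvdnP[u gE]; have : (x1 ^ 2 %| x)%N.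
  by rewrite xE gE -mulnn mulnCA dvdn_mull.
by move/sx => e; rewrite xE e mul1n dvdn_gcdr.
Qed.

Lemma sqfree_mul_sqr x W w : sqfree x -> (x * W = w ^ 2)%N -> exists v, W = (x * v ^ 2)%N.
Proof.
move=> sx e; have x0 := sqfree_gt0 sx.
have /dvdnP[v vE] : (x %| w)%N by apply: sqfree_dvd_sqr => //; rewrite -e dvdn_mulr.
exists v; apply/eqP; rewrite -(eqn_pmul2l x0) e vE expnMn -mulnn.
by apply/eqP; ring.
Qed.

(** The product k k' is a square, so k' = k v^2, and v = 1 because k' is squarefree. *)
Lemma sqfree_sqr_inj k k' y y' : sqfree k -> sqfree k' -> (0 < y)%N -> (0 < y')%N ->
  (k * y ^ 2 = k' * y' ^ 2)%N -> k = k' /\ y = y'.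
Proof.
move=> sk sk' y0 y0' e.
have k0 := sqfree_gt0 sk.
have ke : k = k'.
  have : (k * (k' * y' ^ 2) = (k * y) ^ 2)%N by rewrite -e expnMn mulnA mulnn.
  have /dvdnP[u uE] : (y' %| k * y)%N.
    by rewrite -(@dvdn_pexp2r _ _ 2) // expnMn -mulnn -mulnA e mulnCA mulnA dvdn_mull.
  rewrite uE expnMn mulnA => /eqP; rewrite eqn_pmul2r ?expn_gt0 ?y0' // => /eqP.
  move=> /(sqfree_mul_sqr sk)[v vE].
  have v1 : v = 1%N by apply: sk'; rewrite vE dvdn_mull.
  by rewrite vE v1 muln1.
split=> //; move: e; rewrite -ke => /eqP; rewrite eqn_pmul2l // => /eqP.
by move/eqP; rewrite eqn_exp2r // => /eqP.
Qed.

(* The largest T with k T^2 <= N. *)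
Definition isqrt_div (k N : nat) : nat := \max_(T < N.+1 | (k * T ^ 2 <= N)%N) T.

Lemma isqrt_divP k N : (k * isqrt_div k N ^ 2 <= N)%N.
Proof.
rewrite /isqrt_div; have [|T hT ->] := @eq_bigmax_cond _ [pred T : 'I_N.+1 | (k * T ^ 2 <= N)%N] val.
  by apply/card_gt0P; exists ord0; rewrite inE /= muln0.
exact: hT.
Qed.

Lemma isqrt_div_max k N T : (0 < k)%N -> (k * T ^ 2 <= N)%N -> (T <= isqrt_div k N)%N.
Proof.
move=> k0 hT; have TN : (T < N.+1)%N.
  rewrite ltnS; apply: leq_trans hT; apply: leq_trans (leq_pmull _ k0).
  by case: T => // T; rewrite -mulnn leq_pmulr.
exact: (@leq_bigmax_cond _ [pred T : 'I_N.+1 | (k * T ^ 2 <= N)%N] val (Ordinal TN)).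
Qed.

(** From k <= N the root T is at least 1, so T + 1 <= 2T; this is the source of the factor 4. *)
Lemma isqrt_div_ge k N : (0 < k)%N -> (k <= N)%N -> (N <= 4 * (k * isqrt_div k N ^ 2))%N.
Proof.
move=> k0 kN; set T := isqrt_div k N.
have T1 : (0 < T)%N by apply: isqrt_div_max => //; rewrite exp1n muln1.
have : ~~ (k * T.+1 ^ 2 <= N)%N.
  by apply/negP => /(isqrt_div_max k0); rewrite -/T ltnn.
rewrite -ltnNge => /ltnW h; apply: leq_trans h _.
have -> : (4 * (k * T ^ 2) = k * (2 * T) ^ 2)%N by rewrite expnMn mulnCA.
by rewrite leq_mul2l leq_exp2r //; apply/orP; right; lia.
Qed.

(** For fixed x both y and v run up to the square root of N/x, which leaves at most N/x pairs. *)
Lemma card_square_pairs (N : nat) :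
  (#|[set t : 'I_N.+1 * ('I_N.+1 * 'I_N.+1) |
      [&& (0 < t.1)%N, (0 < t.2.1)%N, (0 < t.2.2)%N, (t.1 * t.2.1 ^ 2 <= N)%N & (t.1 * t.2.2 ^ 2 <= N)%N]]%SET|
   <= \sum_(x < N.+1 | (0 < x)%N) N %/ x)%N.
Proof.
rewrite -sum1dep_card.
rewrite -(pair_big_dep (fun x : 'I_N.+1 => (0 < x)%N)
  (fun (x : 'I_N.+1) (t : 'I_N.+1 * 'I_N.+1) =>
    [&& (0 < t.1)%N, (0 < t.2)%N, (x * t.1 ^ 2 <= N)%N & (x * t.2 ^ 2 <= N)%N]) (fun _ _ => 1%N)) /=.
apply: leq_sum => x x0; rewrite sum1dep_card.
pose Y := [set y : 'I_N.+1 | (0 < y)%N && (x * y ^ 2 <= N)%N]%SET.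
apply: (@leq_trans (#|Y| * #|Y|)%N).
  rewrite -cardsX; apply/subset_leq_card/fintype.subsetP => -[y v]; rewrite !inE /=.
  by case/and4P => -> -> -> ->.
rewrite leq_divRL // mulnn mulnC; apply: leq_trans (isqrt_divP x N).
rewrite leq_mul2l leq_sqr; apply/orP; right.
rewrite cardE -(size_map val) -[isqrt_div x N](size_iota 1).
apply: uniq_leq_size; first by rewrite map_inj_uniq ?enum_uniq //; exact: val_inj.
move=> _ /mapP[y + ->]; rewrite mem_enum inE mem_iota /= => /andP[y0 yN].
by rewrite y0 add1n ltnS isqrt_div_max.
Qed.

(** * Harmonic sums *)

Section HarmonicSums.
Variable R : realType.
Implicit Types N : nat.

Lemma harmonic_le N : (0 < N)%N -> \sum_(1 <= x < N.+1) (x%:R)^-1 <= 1 + ln N%:R :> R.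
Proof.
elim: N => // N IHN _; case: N IHN => [|N] IHN.
  by rewrite big_nat1 invr1 ln1 addr0.
rewrite big_nat_recr //=; apply: le_trans (lerD (IHN isT) (lexx _)) _.
rewrite -addrA lerD2l.
have N1 : 0 < (N.+1)%:R :> R by rewrite ltr0n.
have N2 : 0 < (N.+2)%:R :> R by rewrite ltr0n.
have -> : (N.+1)%:R = (N.+2)%:R * (1 + - ((N.+2)%:R)^-1) :> R.
  by rewrite mulrDr mulr1 mulrN mulfV ?gt_eqF // -[X in X - 1]natr1 addrK.
have i1 : (N.+2)%:R^-1 < 1 :> R by rewrite invf_lt1 // ltr1n.
rewrite lnM ?posrE //; last by rewrite subr_gt0.
rewrite -addrA gerDl -lerBrDr sub0r; apply: le_ln1Dx.
by rewrite ltrN2.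
Qed.

Lemma harmonic_ge N : ln (N.+1)%:R <= \sum_(1 <= x < N.+1) (x%:R)^-1 :> R.
Proof.
elim: N => [|N IHN]; first by rewrite big_geq // ln1.
rewrite big_nat_recr //=; apply: le_trans (lerD IHN (lexx _)).
have N1 : 0 < (N.+1)%:R :> R by rewrite ltr0n.
have -> : (N.+2)%:R = (N.+1)%:R * (1 + ((N.+1)%:R)^-1) :> R.
  by rewrite mulrDr mulr1 mulfV ?gt_eqF // -natr1.
rewrite lnM ?posrE ?addr_gt0 ?invr_gt0 // lerD2l.
by apply: le_ln1Dx; apply: lt_trans (_ : 0 < _); rewrite ?ltrN10 ?invr_gt0.
Qed.

Lemma sum_inv_sqr_le N : \sum_(d < N.+1 | (0 < d)%N) ((d%:R) ^+ 2)^-1 <= 2%:R :> R.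
Proof.
case: N => [|N]; first by rewrite big_mkcond big_ord_recl big_ord0 /= addr0 ler0n.
(* The sharper bound 2 - 1/N is what telescopes in the induction. *)
apply: (@le_trans _ _ (2%:R - (N.+1)%:R^-1)); last by rewrite gerBl invr_ge0 ler0n.
elim: N => [|N IHN].
  by rewrite big_mkcond !big_ord_recl big_ord0 /= expr1n invr1; lra.
rewrite big_mkcond big_ord_recr /= -big_mkcond; apply: le_trans (lerD IHN (lexx _)) _.
have n1 : 0 < (N.+1)%:R :> R by rewrite ltr0n.
rewrite -[(N.+2)%:R]natr1; move: (N.+1)%:R n1 => n n1.
rewrite -addrA lerD2l -subr_ge0.
have -> : - (n + 1)^-1 - (- n^-1 + ((n + 1) ^+ 2)^-1) = (n * (n + 1) ^+ 2)^-1.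
  by field; lra.
by rewrite invr_ge0 mulr_ge0 ?exprn_ge0 //; lra.
Qed.

Lemma ler_sum_inj (I J : finType) (P : pred J) (F : J -> R) (phi : I -> J) :
  injective phi -> (forall i, P (phi i)) -> (forall j, P j -> 0 <= F j) ->
  \sum_i F (phi i) <= \sum_(j | P j) F j.
Proof.
move=> phiI phiP F0.
rewrite -(big_imset F (A := predT) (in2W phiI)) /= [leRHS](bigID (mem (phi @: predT))) /=.
have -> : \sum_(j | P j && (j \in phi @: predT)) F j = \sum_(j in phi @: predT) F j.
  by apply: eq_bigl => j; apply: andb_idl => /imsetP[i _ ->].
by rewrite lerDl sumr_ge0 // => j /andP[/F0].
Qed.

(* Every m = s d^2 with s squarefree contributes 1/m = (1/s)(1/d^2), and the
   sum of the 1/d^2 is at most 2. *)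
Lemma sqfree_harmonic (P : nat -> Prop) (m : nat -> nat) (J X : nat) :
  injective m -> (forall j, (j < J)%N -> (0 < m j <= X)%N) ->
  (forall j s d, (j < J)%N -> sqfree s -> m j = (s * d ^ 2)%N -> P s) ->
  \sum_(j < J) (m j)%:R^-1 <= 2%:R * \sum_(s < X.+1 | `[< sqfree s /\ P s >]) s%:R^-1 :> R.
Proof.
move=> mI mX mP.
have /choice[phi phiP] (j : 'I_J) : exists t : 'I_X.+1 * 'I_X.+1,
    [/\ sqfree t.1, (0 < t.2)%N & m j = (t.1 * t.2 ^ 2)%N].
  have /andP[m0 mx] := mX j (ltn_ord j).
  have [s [d [ss d0 mE]]] := sqfree_decomp m0.
  have s0 := sqfree_gt0 ss.
  have sX : (s < X.+1)%N by rewrite ltnS (leq_trans _ mx) // mE leq_pmulr // expn_gt0 d0.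
  have dX : (d < X.+1)%N.
    by rewrite ltnS (leq_trans _ mx) // mE (leq_trans _ (leq_pmull _ s0)) // -mulnn leq_pmulr.
  by exists (Ordinal sX, Ordinal dX).
pose Q (t : 'I_X.+1 * 'I_X.+1) := `[< sqfree t.1 /\ P t.1 >] && (0 < t.2)%N.
pose F (t : 'I_X.+1 * 'I_X.+1) : R := t.1%:R^-1 * (t.2%:R ^+ 2)^-1.
have -> : \sum_(j < J) (m j)%:R^-1 = \sum_(j < J) F (phi j).
  by apply: eq_bigr => j _; have [_ _ ->] := phiP j; rewrite natrM natrX invfM.
apply: le_trans (_ : \sum_(t | Q t) F t <= _).
  apply: ler_sum_inj.
  - move=> i j e; apply/ord_inj/mI; have [_ _ ->] := phiP i; have [_ _ ->] := phiP j.
    by rewrite e.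
  - move=> j; have [s1 d1 mE] := phiP j; rewrite /Q d1 andbT; apply/asboolP; split=> //.
    exact: mP mE.
  - by move=> t _; rewrite mulr_ge0 ?invr_ge0 ?exprn_ge0 ?ler0n.
rewrite -(pair_big_dep (fun s : 'I_X.+1 => `[< sqfree s /\ P s >]) (fun _ (d : 'I_X.+1) => (0 < d)%N)
  (fun (s d : 'I_X.+1) => s%:R^-1 * (d%:R ^+ 2)^-1 : R)) /= mulrC big_distrl /=.
apply: ler_sum => s _; rewrite -big_distrr /= ler_wpM2l ?invr_ge0 ?ler0n //.
exact: sum_inv_sqr_le.
Qed.

End HarmonicSums.

(** * Sizes of coefficients *)

Lemma recip_lift_bound n (b : int) : exists2 c : int, 0 <= c &
  forall (g : {poly int}) (N : int), (forall j, `|g`_j| <= N) ->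
  forall i, `|(recip_lift n b g)`_i| <= c * N.
Proof.
pose c := \sum_(k < n.+1) \sum_(i < n.*2.+1) `|(recip_basis n b k)`_i|.
have c0 : 0 <= c by apply: sumr_ge0 => k _; apply: sumr_ge0 => i _.
exists c => // g N gN i; have N0 : 0 <= N by apply: le_trans (gN 0%N).
rewrite coef_recip_lift /c big_distrl /=; apply: le_trans (ler_norm_sum _ _ _) _.
apply: ler_sum => k _; rewrite normrM mulrC ler_pM //.
have [hi|hi] := ltnP i n.*2.+1; first by rewrite (bigD1 (Ordinal hi)) //= lerDl sumr_ge0.
rewrite nth_default ?normr0 ?sumr_ge0 // size_recip_basis; last by rewrite -ltnS.
by have := ltn_ord k; lia.
Qed.

(** Back substitution in the unitriangular system: the induction treats the top [d] coefficients of
    [g], and each new one is a coefficient of f minus a combination of those already bounded. *)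
Lemma recip_lift_inv_bound n (b : int) : exists2 c : int, 0 <= c &
  forall (g : {poly int}) (N : int), (size g <= n.+1)%N ->
  (forall i, `|(recip_lift n b g)`_i| <= N) -> forall j, `|g`_j| <= c * N.
Proof.
suff [c c0 H] : exists2 c : int, 0 <= c &
    forall (g : {poly int}) (N : int), (size g <= n.+1)%N ->
    (forall i, `|(recip_lift n b g)`_i| <= N) -> forall j, (n < j + n.+1)%N -> `|g`_j| <= c * N.
  by exists c => // g N sz fN j; apply: H => //; lia.
elim: {3}n.+1 => [|d [c c0 IHd]].
  exists 0 => // g N sz _ j; rewrite addn0 => hj.
  by rewrite nth_default ?(leq_trans sz) // normr0 mul0r.
pose K := \sum_(k < n.+1) \sum_(i < n.*2.+1) `|(recip_basis n b k)`_i|.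
have K0 : 0 <= K by apply: sumr_ge0 => k _; apply: sumr_ge0 => i _.
exists (c + (1 + K * c)) => [|g N sz fN j hj]; first by rewrite !addr_ge0 ?mulr_ge0.
have N0 : 0 <= N by apply: le_trans (fN 0%N).
have [hj'|hj'] := ltnP n (j + d).
  apply: le_trans (IHd g N sz fN j hj') _.
  by rewrite ler_wpM2r // lerDl addr_ge0 ?mulr_ge0.
have jn : (j <= n)%N by lia.
have := recip_lift_top b g jn => e.
have -> : g`_j = (recip_lift n b g)`_(n + j) - \sum_(k < n.+1 | (j < k)%N) g`_k * (recip_basis n b k)`_(n + j).
  by rewrite e addrK.
apply: le_trans (ler_normB _ _) _; rewrite !mulrDl mul1r.
apply: le_trans (_ : N + K * c * N <= _); last by rewrite lerDr mulr_ge0.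
apply: lerD => //; apply: le_trans (ler_norm_sum _ _ _) _.
rewrite -mulrA /K big_distrl /= big_mkcond; apply: ler_sum => k _.
case: ifP => jk; last by rewrite mulr_ge0 ?sumr_ge0 ?mulr_ge0.
rewrite normrM mulrC ler_pM //; last by apply: IHd => //; lia.
have hi : (n + j < n.*2.+1)%N by lia.
by rewrite (bigD1 (Ordinal hi)) //= lerDl sumr_ge0.
Qed.

(** The inverse bound with N = 0, applied to the difference. *)
Lemma recip_lift_inj n (b : int) (g g' : {poly int}) :
  (size g <= n.+1)%N -> (size g' <= n.+1)%N -> recip_lift n b g = recip_lift n b g' -> g = g'.
Proof.
move=> sz sz' e; have [c c0 H] := recip_lift_inv_bound n b.
have d0 : recip_lift n b (g - g') = 0.
  apply/polyP => i; rewrite coef0 coef_recip_lift.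
  under eq_bigr do rewrite coefB mulrBl.
  by rewrite sumrB -!coef_recip_lift e subrr.
have szd : (size (g - g')%R <= n.+1)%N.
  by apply: leq_trans (size_polyD _ _) _; rewrite size_polyN geq_max sz.
have fd i : `|(recip_lift n b (g - g'))`_i| <= 0 by rewrite d0 coef0 normr0.
apply/polyP => j; apply/eqP; rewrite -subr_eq0 -coefB -normr_le0.
by have := H _ _ szd fd j; rewrite mulr0.
Qed.

Lemma even_odd_val_bound n (c : int) : exists2 K : int, 0 <= K &
  forall (g : {poly int}) (N : int), (size g <= n.+1)%N -> (forall j, `|g`_j| <= N) ->
  `|even_val c g| <= K * N /\ `|odd_val c g| <= K * N.
Proof.
exists (\sum_(i < n.+1) `|c| ^+ i) => [|g N sz gN].
  by apply: sumr_ge0 => i _; rewrite exprn_ge0.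
have sume (q : {poly int}) : (size q <= n.+1)%N -> (forall j, `|q`_j| <= N) ->
    `|q.[c]| <= (\sum_(i < n.+1) `|c| ^+ i) * N.
  move=> szq qN; rewrite (horner_coef_wide _ szq) big_distrl /=.
  apply: le_trans (ler_norm_sum _ _ _) _; apply: ler_sum => i _.
  by rewrite normrM mulrC normrX ler_wpM2l ?exprn_ge0.
split; apply: sume => [|j]; rewrite ?coef_even_poly ?coef_odd_poly //.
  by apply: leq_trans (size_even_poly _) _; move: (size g) sz => s; rewrite uphalf_half; lia.
by apply: leq_trans (size_odd_poly _) _; move: (size g) sz => s; lia.
Qed.

(** By linearity, once the coefficients of degree at least 2 are known, the even and odd values
    carry the same information as the two lowest coefficients. *)
Lemma even_odd_val_low (R : comNzRingType) (c : R) (d : {poly R}) :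
  (forall j, (2 <= j)%N -> d`_j = 0) -> even_val c d = d`_0 /\ odd_val c d = d`_1.
Proof.
move=> d2; have : d = (d`_0)%:P + d`_1 *: 'X.
  apply/polyP => -[|[|j]]; rewrite coefD coefC coefZ coefX /= ?mulr0 ?mulr1 ?addr0 ?add0r //.
  exact: d2.
move: (d`_0) (d`_1) => a0 a1 ->.
rewrite /even_val /odd_val even_polyD odd_polyD even_polyZ odd_polyZ even_polyC odd_polyC.
have -> : even_poly ('X : {poly R}) = 0 by rewrite -[X in even_poly X]mul1r even_polyMX -polyC1 odd_polyC mul0r.
have -> : odd_poly ('X : {poly R}) = 1 by rewrite -[X in odd_poly X]mul1r odd_polyMX -polyC1 even_polyC.
by rewrite scaler0 addr0 add0r hornerC hornerZ hornerC mulr1.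
Qed.

Lemma even_odd_val_inj (c : int) (g g' : {poly int}) : even_val c g = even_val c g' ->
  odd_val c g = odd_val c g' -> (forall j, (2 <= j)%N -> g`_j = g'`_j) -> g = g'.
Proof.
move=> eA eB e2.
have [|e0 e1] := @even_odd_val_low _ c (g - g').
  by move=> j j2; rewrite coefB e2 // subrr.
move: e0 e1; rewrite /even_val /odd_val even_polyD odd_polyD -scaleN1r even_polyZ odd_polyZ !scaleN1r.
rewrite !hornerD !hornerN -/(even_val c g) -/(even_val c g') -/(odd_val c g) -/(odd_val c g') eA eB !subrr.
rewrite !coefD !coefN => /esym/eqP; rewrite subr_eq0 => /eqP e0 /esym/eqP; rewrite subr_eq0 => /eqP e1.
by apply/polyP => -[|[|j]] //; apply: e2.
Qed.

(** * Upper bound: coding the solutions of the norm equation *)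

Lemma absz_sqr (z : int) : `|z ^+ 2|%N = (`|z| ^ 2)%N.
Proof. by rewrite abszX. Qed.

(* (A - C)(A + C) = 4 b B^2: write |A - C| = x y^2 with x squarefree; then x
   times 4|b||A + C| is a square up to y^2, whence 4|b||A + C| = x v^2. *)
Lemma norm_square_code (b A B C : int) : b != 0 -> B != 0 -> A ^+ 2 - 4 * b * B ^+ 2 = C ^+ 2 ->
  exists x y v : nat, [/\ (0 < x)%N, (0 < y)%N, (0 < v)%N,
    `|(A - C)%R|%N = (x * y ^ 2)%N & (4 * `|b| * `|(A + C)%R| = x * v ^ 2)%N].
Proof.
move=> b0 B0 e.
have XY : (A - C) * (A + C) = 4 * b * B ^+ 2.
  by transitivity (A ^+ 2 - C ^+ 2); [ring|rewrite -e; ring].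
have XY0 : (A - C) * (A + C) != 0 by rewrite XY !mulf_neq0 // expf_neq0.
have [X0 Y0] : (A - C != 0) /\ (A + C != 0).
  by move: XY0; rewrite mulf_eq0 negb_or => /andP.
have [x [y [sx y0 xy]]] : exists s d, [/\ sqfree s, (0 < d)%N & `|(A - C)%R|%N = (s * d ^ 2)%N].
  by apply: sqfree_decomp; rewrite absz_gt0.
have x0 := sqfree_gt0 sx.
have w2 : (x * y ^ 2 * (4 * `|b| * `|(A + C)%R|) = `|(4 * b * B)%R| ^ 2)%N.
  rewrite -xy -absz_sqr; have -> : (4 * b * B) ^+ 2 = 4 * b * ((A - C) * (A + C)) by rewrite XY; ring.
  by rewrite !abszM /=; ring.
have /dvdnP[w wE] : (y %| `|(4 * b * B)%R|)%N.
  by rewrite -(@dvdn_pexp2r _ _ 2) // -w2 -mulnA mulnCA dvdn_mulr.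
have [v vE] : exists v, (4 * `|b| * `|(A + C)%R| = x * v ^ 2)%N.
  apply: (sqfree_mul_sqr sx (w := w)); apply/eqP.
  rewrite -(@eqn_pmul2l (y ^ 2)) ?expn_gt0 ?y0 //; apply/eqP.
  by rewrite mulnA [(y ^ 2 * x)%N]mulnC w2 wE expnMn mulnC.
exists x, y, v; split=> //; case: v vE => // /eqP; rewrite muln0 !muln_eq0 /=.
by rewrite !absz_eq0 (negPf b0) (negPf Y0).
Qed.

Lemma norm_square_bound (b A B C Q : int) : `|A| <= Q -> `|B| <= Q ->
  A ^+ 2 - 4 * b * B ^+ 2 = C ^+ 2 -> `|C| <= (1 + 4 * `|b|) * Q.
Proof.
move=> AQ BQ e; have Q0 : 0 <= Q by apply: le_trans AQ.
rewrite -[leRHS]ger0_norm ?mulr_ge0 ?addr_ge0 ?mulr_ge0 //.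
rewrite -ler_sqr ?nnegrE // !real_normK ?num_real // -e.
have A2 : A ^+ 2 <= Q ^+ 2 by rewrite -[A ^+ 2]real_normK ?num_real // ler_sqr ?nnegrE.
have B2 : B ^+ 2 <= Q ^+ 2 by rewrite -[B ^+ 2]real_normK ?num_real // ler_sqr ?nnegrE.
have bB : - (4 * b * B ^+ 2) <= 4 * `|b| * Q ^+ 2.
  apply: le_trans (ler_norm _) _; rewrite normrN 2!normrM (ger0_norm (sqr_ge0 B)).
  by rewrite [X in X * _ * _]ger0_norm // ler_wpM2l ?mulr_ge0.
apply: le_trans (lerD A2 bB) _; rewrite exprMn.
have := normr_ge0 b; have : 0 <= Q ^+ 2 by rewrite exprn_ge0.
by move: (Q ^+ 2) `|b| => q c q0 c0; nra.
Qed.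

Lemma card_fset_set_le (X : choiceType) (S : set X) (T : finType) (P : {set T})
    (code : X -> T -> Prop) :
  finite_set S -> (forall f, S f -> exists2 t, t \in P & code f t) ->
  (forall f f' t, code f t -> code f' t -> f = f') -> (#|` fset_set S| <= #|P|)%N.
Proof.
move=> Sfin Scode codeI.
have [->|/set0P[f0 Sf0]] := eqVneq S set0; first by rewrite fset_set0 cardfs0.
have [t0 _ _] := Scode f0 Sf0.
have /choice[F FP] f : exists t, S f -> t \in P /\ code f t.
  have [/Scode[t tP tc]|nS] := pselect (S f); first by exists t.
  by exists t0.
rewrite cardfE cardE.
rewrite -cardE -(card_imset predT (f := fun x : fset_set S => F (val x))); last first.
  move=> x y e; apply: val_inj; have /= xS := valP x; have /= yS := valP y.
  rewrite in_fset_set // inE in xS; rewrite in_fset_set // inE in yS.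
  by apply: (codeI _ _ (F (val x))); [exact: (FP _ xS).2|rewrite e; exact: (FP _ yS).2].
apply/subset_leq_card/fintype.subsetP => _ /imsetP[x _ ->].
have /= xS := valP x; rewrite in_fset_set // inE in xS.
exact: (FP _ xS).1.
Qed.

Lemma int_code (q : int) (m : nat) (z : int) : `|z| <= q -> 2 * q + 1 <= m%:Z ->
  exists u : 'I_m, (u : nat)%:Z = z + q.
Proof.
move=> zq qm; have h : (`|(z + q)%R|%N < m)%N by lia.
by exists (Ordinal h) => /=; lia.
Qed.

(** The triple and two signs recover A - C and A + C, hence B^2, and the third sign gives B. When B
    = 0 the factors may vanish, and A itself is recorded, shifted by [q] to be nonnegative. *)
Definition norm_code (b A B C q : int) (m M : nat)
    (t : (bool * bool * bool) * ('I_M.+1 * ('I_M.+1 * 'I_M.+1)) + 'I_m) : Prop :=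
  match t with
  | inl (e, (x, (y, v))) =>
      [/\ A - C = (-1) ^+ e.1.1 * (x * y ^ 2)%N%:Z,
          4 * `|b| * (A + C) = (-1) ^+ e.1.2 * (x * v ^ 2)%N%:Z
        & B = (-1) ^+ e.2 * `|B|]
  | inr u => B = 0 /\ u%:Z = A + q
  end.

Lemma norm_code_inj (b A B C A' B' C' q : int) (m M : nat) t :
  b != 0 -> A ^+ 2 - 4 * b * B ^+ 2 = C ^+ 2 -> A' ^+ 2 - 4 * b * B' ^+ 2 = C' ^+ 2 ->
  @norm_code b A B C q m M t -> @norm_code b A' B' C' q m M t -> A = A' /\ B = B'.
Proof.
move=> b0 e e'; case: t => [[s [x [y v]]]|u] /=; last first.
  by move=> [-> uE] [-> uE']; split=> //; apply: (addIr q); rewrite -uE -uE'.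
move=> [h1 h2 h3] [h1' h2' h3'].
have h12 : A - C = A' - C' by rewrite h1 h1'.
have b4 : 4 * `|b| != 0 by rewrite mulf_neq0 ?normr_eq0.
have h22 : A + C = A' + C' by apply: (mulfI b4); rewrite h2 h2'.
have AA : A = A' by move: h12 h22; clear; lia.
have CC : C = C' by move: h12 h22; clear; lia.
split=> //; rewrite h3 h3'; congr (_ * _).
have : 4 * b * B ^+ 2 = 4 * b * B' ^+ 2 by apply/oppr_inj/(addrI (A ^+ 2)); rewrite e AA e' CC.
have b4' : 4 * b != 0 by rewrite mulf_neq0.
move=> /(mulfI b4')/eqP; rewrite eqf_sqr => /orP[]/eqP ->; by rewrite ?normrN.
Qed.

Lemma norm_code_exists (b A B C q : int) (m M : nat) :
  b != 0 -> A ^+ 2 - 4 * b * B ^+ 2 = C ^+ 2 -> `|A| <= q -> `|B| <= q ->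
  2 * q + 1 <= m%:Z -> (4 * `|b| + 1) * (2 + 4 * `|b|) * q <= M%:Z ->
  exists2 t, @norm_code b A B C q m M t & forall e x y v, t = inl (e, (x, (y, v))) ->
    [&& (0 < x)%N, (0 < y)%N, (0 < v)%N, (x * y ^ 2 <= M)%N & (x * v ^ 2 <= M)%N].
Proof.
move=> b0 e Aq Bq qm qM.
have [B0|B0] := eqVneq B 0.
  by have [u uE] := int_code Aq qm; exists (inr u).
have [x [y [v [x0 y0 v0 xy xv]]]] := norm_square_code b0 B0 e.
have Cq := norm_square_bound Aq Bq e.
have q0 : 0 <= q by apply: le_trans Aq.
have ACq : `|A - C| <= (2 + 4 * `|b|) * q.
  apply: le_trans (ler_normB _ _) _; apply: le_trans (lerD Aq Cq) _.
  by rewrite !mulrDl mul1r addrA -mulr2n -mulr_natl.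
have ACq' : `|A + C| <= (2 + 4 * `|b|) * q.
  apply: le_trans (ler_normD _ _) _; apply: le_trans (lerD Aq Cq) _.
  by rewrite !mulrDl mul1r addrA -mulr2n -mulr_natl.
have xyM : (x * y ^ 2 <= M)%N.
  rewrite -xy -lez_nat abszE; apply: le_trans ACq _; apply: le_trans qM.
  by rewrite -mulrA ler_peMl ?mulr_ge0 ?addr_ge0 // lerDr mulr_ge0.
have xvM : (x * v ^ 2 <= M)%N.
  rewrite -xv -lez_nat !PoszM !abszE; apply: le_trans qM; rewrite -[leRHS]mulrA.
  by apply: ler_pM; rewrite ?mulr_ge0 // lerDl.
have leM a d : (0 < a)%N -> (0 < d)%N -> (a * d ^ 2 <= M)%N -> (a < M.+1)%N /\ (d < M.+1)%N.
  move=> a0 d0 h; rewrite !ltnS; split; apply: leq_trans h.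
    by rewrite leq_pmulr // expn_gt0 d0.
  by apply: leq_trans (leq_pmull _ a0); rewrite -mulnn leq_pmulr.
have [xM yM] := leM _ _ x0 y0 xyM; have [_ vM] := leM _ _ x0 v0 xvM.
have sgnE (z : int) : z = (-1) ^+ (z < 0)%R * `|z|.
  exact: numEsign.
exists (inl ((((A - C < 0)%R, (A + C < 0)%R), (B < 0)%R), (Ordinal xM, (Ordinal yM, Ordinal vM)))).
  split=> /=; last exact: sgnE.
    by rewrite {1}[A - C]sgnE -xy abszE.
  by rewrite {1}[A + C]sgnE mulrCA -xv !PoszM !abszE.
by move=> e' x' y' v' [_ <- <- <-] /=; rewrite x0 y0 v0 xyM xvM.
Qed.

(** There are n - 1 coefficients of [g] of degree at least 2, one of them prescribed in the monic
    case, each with O(N) values. The pair (A, B) has 8 sign patterns for each triple, plus the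
    linearly many codes with B = 0. *)
Lemma admissible_upper n (b : int) (mon : bool) : (mon < n)%N -> b != 0 ->
  exists2 c : nat, (0 < c)%N & forall (N : nat) (S : set {poly int}), (0 < N)%N -> finite_set S ->
    (forall f, S f -> [/\ admissible b (G1 n) f, forall i, `|f`_i| <= N%:Z & mon -> f \is monic]) ->
    (#|` fset_set S| <= (c * N) ^ (n - 1 - mon) *
      (8 * (\sum_(x < (c * N).+1 | (0 < x)%N) (c * N) %/ x) + c * N))%N.
Proof.
move=> monn b0.
have [c1 c10 H1] := recip_lift_inv_bound n b.
have [K K0 HK] := even_odd_val_bound n (4 * b).
have [u uE] : exists u, u = K * c1 by exists (K * c1).
have u0 : 0 <= u by rewrite uE mulr_ge0.
have [w wE] : exists w, w = (4 * `|b| + 1) * (2 + 4 * `|b|) * u by exists ((4 * `|b| + 1) * (2 + 4 * `|b|) * u).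
have w0 : 0 <= w by rewrite wE !mulr_ge0 ?addr_ge0 ?mulr_ge0.
(* One summand for each requirement [Q1], [Q2], [Q3] on the ranges of the codes. *)
pose c : nat := `|(2 * c1 + 1 + (2 * u + 1) + w)%R|%N.
have cE : c%:Z = 2 * c1 + 1 + (2 * u + 1) + w.
  by rewrite /c abszE ger0_norm // !addr_ge0 ?mulr_ge0.
exists c => [|N S N0 Sfin SP].
  by rewrite -ltz_nat cE; move: c10 u0 w0; clear; lia.
pose q := c1 * N%:Z; pose q2 := K * q.
have N1 : 1 <= N%:Z by rewrite lez_nat.
have q2E : q2 = u * N%:Z by rewrite /q2 /q mulrA uE.
have cN : (c * N)%N%:Z = (2 * c1 + 1 + (2 * u + 1) + w) * N%:Z by rewrite PoszM cE.
have Q1 : 2 * q + 1 <= (c * N)%N%:Z.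
  rewrite cN /q; move: c10 u0 w0 N1; clear; move: (Posz N) => M; nra.
have Q2 : 2 * q2 + 1 <= (c * N)%N%:Z.
  rewrite cN q2E; move: c10 u0 w0 N1; clear; move: (Posz N) => M; nra.
have Q3 : (4 * `|b| + 1) * (2 + 4 * `|b|) * q2 <= (c * N)%N%:Z.
  rewrite cN q2E mulrA -wE; move: c10 u0 w0 N1; clear; move: (Posz N) => M; nra.
pose r := (n - 1 - mon)%N.
pose T3 := [set t : 'I_(c * N).+1 * ('I_(c * N).+1 * 'I_(c * N).+1) |
      [&& (0 < t.1)%N, (0 < t.2.1)%N, (0 < t.2.2)%N, (t.1 * t.2.1 ^ 2 <= c * N)%N & (t.1 * t.2.2 ^ 2 <= c * N)%N]]%SET.
pose PN : {set (bool * bool * bool) * ('I_(c * N).+1 * ('I_(c * N).+1 * 'I_(c * N).+1)) + 'I_(c * N)} :=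
  (inl @: finset.setX [set: bool * bool * bool] T3 :|: inr @: [set: 'I_(c * N)])%SET.
pose P := finset.setX [set: {ffun 'I_r -> 'I_(c * N)}]%SET PN.
apply: (@leq_trans #|P|); last first.
  rewrite cardsX cardsT card_ffun !card_ord leq_mul2l; apply/orP; right.
  apply: leq_trans (leq_card_setU _ _) _.
  apply: leq_add; last by apply: leq_trans (leq_imset_card _ _) _; rewrite cardsT card_ord.
  apply: leq_trans (leq_imset_card _ _) _; rewrite cardsX cardsT !card_prod card_bool.
  by rewrite leq_mul2l card_square_pairs orbT.
pose code (f : {poly int}) (t : {ffun 'I_r -> 'I_(c * N)} *
    ((bool * bool * bool) * ('I_(c * N).+1 * ('I_(c * N).+1 * 'I_(c * N).+1)) + 'I_(c * N))) := exists (g : {poly int}) (C : int),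
  [/\ size g = n.+1, f = recip_lift n b g, (mon -> g`_n = 1) /\ even_odd_norm (4 * b) g = C ^+ 2,
      forall i : 'I_r, (t.1 i : nat)%:Z = g`_(i + 2) + q
    & norm_code b (even_val (4 * b) g) (odd_val (4 * b) g) C q2 t.2].
apply: (@card_fset_set_le _ S _ P code Sfin).
  move=> f /SP[/(G1_norm_square b0)[g [C [sz fE gC]]] fN fm].
  have gq j : `|g`_j| <= q by apply: H1 => [|i]; rewrite ?sz // -fE.
  have [Aq Bq] := HK g q (eq_leq sz) gq.
  have [t2 t2c t2P] := norm_code_exists b0 gC Aq Bq Q2 Q3.
  have /choice[t1 t1E] (i : 'I_r) : exists u : 'I_(c * N), (u : nat)%:Z = g`_(i + 2) + q.
    exact: int_code.
  exists ([ffun i => t1 i], t2).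
    rewrite !inE /=; case: t2 {t2c} t2P => [[e [x [y v]]]|j] t2P; apply/orP; [left|right].
      apply: imset_f; rewrite !inE /=; exact: (t2P e x y v).
    by apply: imset_f; rewrite inE.
  exists g, C; split=> //; last by move=> i; rewrite ffunE.
  split=> // /fm/monicP; rewrite fE (size_recip_lift b sz).2 lead_coefE sz.
  by [].
move=> f f' t [g [C [sz fE [gm gC] tg tc]]] [g' [C' [sz' fE' [gm' gC'] tg' tc']]].
rewrite fE fE'; congr (recip_lift _ _ _).
have [AA BB] := norm_code_inj b0 gC gC' tc tc'.
apply: even_odd_val_inj AA BB _ => j j2.
have [jr|jr] := ltnP (j - 2) r.
  have := tg (Ordinal jr); rewrite tg' /= subnK // => /addIr ->.
  by [].
have [jn|jn] := ltnP n j; first by rewrite !nth_default ?sz ?sz'.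
(* The only coefficient of degree at least 2 not recorded is the leading one of a monic
   polynomial. *)
have [mE jE] : mon /\ j = n.
  by move: jr jn j2 monn; rewrite /r; case: (mon) => /=; split=> //; lia.
by rewrite jE gm ?gm'.
Qed.

(** * Lower bound: the parametrized family *)

Lemma card_fset_set_ge (X : choiceType) (S : set X) (T : finType) (P : {set T}) (F : T -> X) :
  finite_set S -> {in P &, injective F} -> {in P, forall t, S (F t)} -> (#|P| <= #|` fset_set S|)%N.
Proof.
move=> Sfin FI FS; rewrite cardE -(size_map F); apply: uniq_leq_size.
  by rewrite map_inj_in_uniq ?enum_uniq // => s t; rewrite !mem_enum; exact: FI.
by move=> _ /mapP[t + ->]; rewrite mem_enum => /FS St; rewrite /= in_fset_set // inE.
Qed.

(** Representatives run over 1, ..., M rather than 0, ..., M - 1, so that y, z and the start of the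
    progression of k are positive. *)
Definition residue (M : nat) (x : int) : nat := `|((x - 1) %% M)%Z|%N.+1.

Lemma residueP M x : (0 < M)%N -> (residue M x <= M)%N /\ (M %| (residue M x)%:Z - x)%Z.
Proof.
move=> M0; have M0' : M%:Z != 0 by case: M M0.
have r0 := modz_ge0 (x - 1) M0'.
have rM : ((x - 1) %% M)%Z < M%:Z by rewrite -[X in _ < X]ger0_norm // ltz_mod.
split; first by rewrite -ltz_nat gez0_abs.
rewrite /residue -addn1 PoszD gez0_abs //.
have -> : ((x - 1) %% M)%Z + 1 - x = - ((x - 1) %/ M)%Z * M.
  by rewrite [X in _ - X](_ : x = (x - 1) + 1); last ring; rewrite {2}(divz_eq (x - 1) M); ring.
exact: dvdz_mull.
Qed.

(** Modulo [M] such a polynomial is its linear part, whose even and odd values are its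
    coefficients. *)
Lemma poly_mod_low (M c : int) (d : {poly int}) : (forall j, (2 <= j)%N -> (M %| d`_j)%Z) ->
  (M %| even_val c d)%Z -> (M %| odd_val c d)%Z -> forall j, (M %| d`_j)%Z.
Proof.
move=> d2 dA dB; pose d' := (d`_0)%:P + d`_1 *: 'X.
have dd' : poly_mod M d d'.
  apply: poly_modP => -[|[|j]]; rewrite coefD coefC coefZ coefX /= ?mulr0 ?mulr1 ?addr0 ?add0r ?subrr ?dvdz0 //.
  by rewrite ?oppr0 ?addr0 ?subr0 d2.
have [|eA eB] := @even_odd_val_low _ c d'.
  by case=> [|[|j]] // _; rewrite coefD coefC coefZ coefX /= mulr0 addr0.
have d'0 : d'`_0 = d`_0 by rewrite coefD coefC coefZ coefX /= mulr0 addr0.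
have d'1 : d'`_1 = d`_1 by rewrite coefD coefC coefZ coefX /= mulr1 add0r.
move: (poly_mod_even_val c dd') (poly_mod_odd_val c dd'); rewrite eA eB d'0 d'1 => hA hB.
case=> [|[|j]]; last exact: d2.
- by rewrite -[d`_0](subKr (even_val c d)) rpredB.
- by rewrite -[d`_1](subKr (odd_val c d)) rpredB.
Qed.

(** A and B determine C^2, and positivity of C = k(y^2 - b z^2) fixes its sign. Then A + C = 2k y^2
    and A - C = 2bk z^2, and a squarefree part is unique. *)
Lemma norm_param_inj (b : int) (k y z k' y' z' : nat) : b != 0 -> sqfree k -> sqfree k' ->
  (0 < y)%N -> (0 < y')%N -> (0 < z)%N -> (0 < z')%N ->
  0 < y%:Z ^+ 2 - b * z%:Z ^+ 2 -> 0 < y'%:Z ^+ 2 - b * z'%:Z ^+ 2 ->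
  k%:Z * (y%:Z ^+ 2 + b * z%:Z ^+ 2) = k'%:Z * (y'%:Z ^+ 2 + b * z'%:Z ^+ 2) ->
  k%:Z * y%:Z * z%:Z = k'%:Z * y'%:Z * z'%:Z -> [/\ k = k', y = y' & z = z'].
Proof.
move=> b0 sk sk' y0 y0' z0 z0' C0 C0' eA eB.
have k0 : 0 < k%:Z by have := sqfree_gt0 sk.
have k0' : 0 < k'%:Z by have := sqfree_gt0 sk'.
have eC : k%:Z * (y%:Z ^+ 2 - b * z%:Z ^+ 2) = k'%:Z * (y'%:Z ^+ 2 - b * z'%:Z ^+ 2).
  have e2 : (k%:Z * (y%:Z ^+ 2 - b * z%:Z ^+ 2)) ^+ 2 = (k'%:Z * (y'%:Z ^+ 2 - b * z'%:Z ^+ 2)) ^+ 2.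
    have id (K Y Z : int) : (K * (Y ^+ 2 - b * Z ^+ 2)) ^+ 2 =
        (K * (Y ^+ 2 + b * Z ^+ 2)) ^+ 2 - 4 * b * (K * Y * Z) ^+ 2 by ring.
    by rewrite !id eA eB.
  move/eqP: e2; rewrite eqf_sqr => /orP[/eqP//|/eqP e].
  by have := mulr_gt0 k0 C0; rewrite e oppr_gt0 ltNge ltW // mulr_gt0.
have two0 : 2 != 0 :> int by [].
have ky : (k * y ^ 2 = k' * y' ^ 2)%N.
  apply/eqP; rewrite -eqz_nat (PoszM k) (PoszM k') -[(y ^ 2)%N%:Z]/(y%:Z ^+ 2) -[(y' ^ 2)%N%:Z]/(y'%:Z ^+ 2).
  apply/eqP/(mulfI two0).
  transitivity (k%:Z * (y%:Z ^+ 2 + b * z%:Z ^+ 2) + k%:Z * (y%:Z ^+ 2 - b * z%:Z ^+ 2)); first by ring.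
  by rewrite eA eC; ring.
have kz : (k * z ^ 2 = k' * z' ^ 2)%N.
  apply/eqP; rewrite -eqz_nat (PoszM k) (PoszM k') -[(z ^ 2)%N%:Z]/(z%:Z ^+ 2) -[(z' ^ 2)%N%:Z]/(z'%:Z ^+ 2).
  apply/eqP/(mulfI (mulf_neq0 two0 b0)).
  transitivity (k%:Z * (y%:Z ^+ 2 + b * z%:Z ^+ 2) - k%:Z * (y%:Z ^+ 2 - b * z%:Z ^+ 2)); first by ring.
  by rewrite eA eC; ring.
have [-> ->] := sqfree_sqr_inj sk sk' y0 y0' ky.
by have [_ ->] := sqfree_sqr_inj sk sk' z0 z0' kz.
Qed.

Lemma norm_param_bound (b : int) (k y z Y : nat) : (y <= Y)%N -> (z <= Y)%N ->
  `|k%:Z * (y%:Z ^+ 2 + b * z%:Z ^+ 2)| <= (k * ((1 + `|b|) * Y ^ 2))%N%:Z /\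
  `|k%:Z * y%:Z * z%:Z| <= (k * ((1 + `|b|) * Y ^ 2))%N%:Z.
Proof.
move=> yY zY.
have y2 : (y ^ 2 <= Y ^ 2)%N by rewrite leq_exp2r.
have z2 : (z ^ 2 <= Y ^ 2)%N by rewrite leq_exp2r.
have zE (u : nat) : u%:Z ^+ 2 = (u ^ 2)%N%:Z by [].
split; last first.
  rewrite -!PoszM ger0_norm // lez_nat -mulnA leq_mul2l; apply/orP; right; rewrite mulnDl mul1n.
  by apply: leq_trans (leq_addr _ _); rewrite -mulnn leq_mul.
rewrite normrM PoszM ger0_norm // ler_wpM2l // mulnDl mul1n PoszD.
apply: le_trans (ler_normD _ _) _; apply: lerD; first by rewrite zE ger0_norm // lez_nat.
by rewrite zE normrM (PoszM `|b|%N) abszE ler_wpM2l // ger0_norm // lez_nat.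
Qed.

Section LowerFamily.
Variables (n : nat) (b : int) (mon : bool) (M : nat) (g0 : {poly int}) (k0 y0 z0 : int).
Hypotheses (monn : (mon < n)%N) (b0 : b != 0) (M0 : (0 < M)%N).
Hypothesis g0_class : norm_class n b M g0 k0 y0 z0.
Let r := (n - 1 - mon)%N.
Variables (P : nat) (t : {ffun 'I_r -> 'I_P}).

(** For 2 <= j <= n the default 1 is reached only at j = n in the monic case; other coefficients
    keep the residue of [g0] and vary with [t]. *)
Definition tail_coef (j : nat) : int :=
  if insub (j - 2)%N is Some i then (residue M g0`_j + M * t i)%N%:Z else 1.

Definition tail_poly : {poly int} := \poly_(j < n.+1) (if (j < 2)%N then 0 else tail_coef j).

(** The linear correction gives the polynomial exactly the even and odd values [A] and [B] at 4b. *)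
Definition lower_poly (A B : int) : {poly int} :=
  tail_poly + ((A - even_val (4 * b) tail_poly)%:P + (B - odd_val (4 * b) tail_poly) *: 'X).

Variables (A B : int).
Let g := lower_poly A B.

Lemma coef_tail_poly j : tail_poly`_j = if (2 <= j <= n)%N then tail_coef j else 0.
Proof. by rewrite coef_poly ltnS; case: (j <= n)%N; rewrite ?andbF // andbT; case: (ltnP j 2). Qed.

Lemma coef_lower_poly_ge2 j : (2 <= j)%N -> g`_j = tail_poly`_j.
Proof. by case: j => [|[|j]] // _; rewrite !coefD coefC coefZ coefX /= mulr0 !addr0. Qed.

Lemma lower_poly_val : even_val (4 * b) g = A /\ odd_val (4 * b) g = B.
Proof.
pose d := (A - even_val (4 * b) tail_poly)%:P + (B - odd_val (4 * b) tail_poly) *: 'X.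
have [|eA eB] := @even_odd_val_low _ (4 * b) d.
  by case=> [|[|j]] // _; rewrite coefD coefC coefZ coefX /= mulr0 addr0.
have add u v : even_val (4 * b) (u + v) = even_val (4 * b) u + even_val (4 * b) v.
  by rewrite /even_val even_polyD hornerD.
have add' u v : odd_val (4 * b) (u + v) = odd_val (4 * b) u + odd_val (4 * b) v.
  by rewrite /odd_val odd_polyD hornerD.
rewrite /g /lower_poly -/d add add' eA eB !coefD !coefC !coefZ !coefX /= mulr0 mulr1 addr0 add0r.
by split; rewrite addrC subrK.
Qed.

Lemma tail_coef_gt0 j : 0 < tail_coef j.
Proof. by rewrite /tail_coef; case: insub. Qed.

(** For n = 1 there is no tail and the leading coefficient is [B] itself, whence the hypothesis. *)
Lemma size_lower_poly : (n = 1%N -> 0 < B) -> size g = n.+1.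
Proof.
move=> nB; have gn : g`_n != 0.
  have [n2|n2] := leqP 2 n.
    by rewrite coef_lower_poly_ge2 // coef_tail_poly n2 leqnn gt_eqF ?tail_coef_gt0.
  have n1 : n = 1%N by move: monn n2; clear; lia.
  have t0 : tail_poly = 0.
    apply/polyP => j; rewrite coef_tail_poly coef0; case: ifP => //.
    by move=> /andP[j2 jn]; move: j2 jn; rewrite n1; clear; lia.
  rewrite /g /lower_poly t0 add0r /even_val /odd_val.
  have -> : even_poly (0 : {poly int}) = 0 by rewrite -polyC0 even_polyC.
  have -> : odd_poly (0 : {poly int}) = 0 by rewrite -polyC0 odd_polyC.
  by rewrite !horner0 !subr0 n1 coefD coefC coefZ coefX /= add0r mulr1 gt_eqF ?nB.
apply/eqP; rewrite eqn_leq; apply/andP; split; last first.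
  by rewrite ltnNge; apply: contra gn => /leq_sizeP/(_ _ (leqnn _)) ->.
apply/leq_sizeP => j nj; rewrite coef_lower_poly_ge2; last by move: monn nj; clear; lia.
by rewrite coef_tail_poly [(j <= n)%N]leqNgt nj andbF.
Qed.

Lemma lower_poly_monic : (n = 1%N -> 0 < B) -> mon -> lead_coef g = 1.
Proof.
move=> nB hm; rewrite lead_coefE size_lower_poly //=.
have n2 : (2 <= n)%N by move: monn; rewrite hm; clear; lia.
rewrite coef_lower_poly_ge2 // coef_tail_poly n2 leqnn /= /tail_coef insubF //.
by rewrite /r hm; move: n2; clear; lia.
Qed.

(** Scaling (y0, z0) by v multiplies both quadratic forms by v^2, which compensates the replacement
    of k0 by k. *)
Lemma lower_poly_mod (k : nat) (v y z : int) : (M %| k%:Z * v ^+ 2 - k0)%Z ->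
  (M %| y - v * y0)%Z -> (M %| z - v * z0)%Z ->
  A = k%:Z * (y ^+ 2 + b * z ^+ 2) -> B = k%:Z * y * z -> poly_mod M g g0.
Proof.
move=> hk hy hz AE BE; have [sz0 lg0 A0 B0] := g0_class.
have [gA gB] := lower_poly_val.
apply: poly_modP => i; rewrite -coefB.
have sub u w : even_val (4 * b) (u - w) = even_val (4 * b) u - even_val (4 * b) w.
  by rewrite /even_val even_polyD -scaleN1r even_polyZ hornerD hornerZ mulN1r.
have sub' u w : odd_val (4 * b) (u - w) = odd_val (4 * b) u - odd_val (4 * b) w.
  by rewrite /odd_val odd_polyD -scaleN1r odd_polyZ hornerD hornerZ mulN1r.
apply: (@poly_mod_low _ (4 * b)).
- move=> j j2; rewrite coefB coef_lower_poly_ge2 // coef_tail_poly j2 /=.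
  case: leqP => jn; last by rewrite [g0`_j]nth_default ?sz0 // subr0 dvdz0.
  rewrite /tail_coef; case: insubP => [u _ _|]; last first.
    rewrite -leqNgt => rj; have -> : j = n by move: rj jn j2 monn; rewrite /r; case: (mon) => /=; clear; lia.
    by rewrite -opprB rpredN.
  have [_ hr] := residueP g0`_j M0.
  by rewrite PoszD addrAC rpredD // PoszM dvdz_mulr.
- rewrite sub gA AE.
  have -> : k%:Z * (y ^+ 2 + b * z ^+ 2) - even_val (4 * b) g0 =
     - (even_val (4 * b) g0 - k0 * (y0 ^+ 2 + b * z0 ^+ 2)) + ((k%:Z * v ^+ 2 - k0) * (y0 ^+ 2 + b * z0 ^+ 2)
     + ((y - v * y0) * (k%:Z * (y + v * y0)) + (z - v * z0) * (k%:Z * b * (z + v * z0)))) by ring.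
  by rewrite rpredD ?rpredN //; apply: rpredD; [|apply: rpredD]; apply: dvdz_mulr.
- rewrite sub' gB BE.
  have -> : k%:Z * y * z - odd_val (4 * b) g0 =
     - (odd_val (4 * b) g0 - k0 * y0 * z0) + ((k%:Z * v ^+ 2 - k0) * (y0 * z0)
     + ((y - v * y0) * (k%:Z * z) + (z - v * z0) * (k%:Z * v * y0))) by ring.
  by rewrite rpredD ?rpredN //; apply: rpredD; [|apply: rpredD]; apply: dvdz_mulr.
Qed.

Lemma lower_poly_bound (K Z : int) : 0 <= K -> `|A| <= Z -> `|B| <= Z -> 1 <= Z -> (M * P)%N%:Z <= Z ->
  (forall (q : {poly int}) (N : int), (size q <= n.+1)%N -> (forall j, `|q`_j| <= N) ->
    `|even_val (4 * b) q| <= K * N /\ `|odd_val (4 * b) q| <= K * N) ->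
  forall j, `|g`_j| <= (1 + K) * Z.
Proof.
move=> K0 AZ BZ Z1 MPZ HK.
have Z0 : 0 <= Z by apply: le_trans Z1.
have tZ j : `|tail_poly`_j| <= Z.
  rewrite coef_tail_poly; case: ifP => _; last by rewrite normr0.
  rewrite /tail_coef; case: insubP => [u _ _|_]; last by rewrite normr1.
  rewrite ger0_norm //; apply: le_trans MPZ; rewrite lez_nat.
  have [hr _] := residueP g0`_j M0.
  apply: leq_trans (leq_add hr (leqnn _)) _; rewrite -mulnS leq_mul2l.
  by apply/orP; right; exact: ltn_ord.
have [tA tB] := HK tail_poly Z (size_poly _ _) tZ.
have bd u w : `|u| <= Z -> `|w| <= K * Z -> `|u - w| <= (1 + K) * Z.
  by move=> h1 h2; apply: le_trans (ler_normB _ _) _; rewrite mulrDl mul1r lerD.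
case=> [|[|j]]; last first.
- rewrite coef_lower_poly_ge2 //; apply: le_trans (tZ _) _.
  by rewrite mulrDl mul1r lerDl mulr_ge0.
- rewrite coefD coef_tail_poly /= add0r coefD coefC coefZ coefX /= add0r mulr1; exact: bd.
- rewrite coefD coef_tail_poly /= add0r coefD coefC coefZ coefX /= mulr0 addr0; exact: bd.
Qed.

End LowerFamily.

(** [Z] bounds A, B and the tail. Each free tail coefficient has Z/M values, and each k allows T^2
    pairs (y, z), where k W T^2 <= Z. *)
Lemma admissible_lower n (b : int) (mon : bool) : (mon < n)%N -> b != 0 ->
  exists (M W c e : nat) (Kp : nat -> Prop),
    [/\ (0 < M)%N, (0 < W)%N, (0 < c)%N, (0 < e <= M)%N
      & (forall j s d, (e + M * j = s * d ^ 2)%N -> Kp s) /\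
        forall (Z N : nat) (S : set {poly int}), (c * Z <= N)%N -> finite_set S ->
          (forall f, admissible b (G1 n) f -> (forall i, `|f`_i| <= N%:Z) -> (mon -> f \is monic) -> S f) ->
          ((Z %/ M) ^ (n - 1 - mon) *
            (\sum_(k < Z.+1 | `[< sqfree k /\ Kp k >]) isqrt_div (k * W) Z ^ 2) <= #|` fset_set S|)%N].
Proof.
move=> monn b0; have n0 : (0 < n)%N by apply: leq_ltn_trans monn.
have [M [g0 [k0 [y0 [z0 [M0 g0c full]]]]]] := full_class_exists n0 b0.
have [cf cf0 Hf] := recip_lift_bound n b.
have [K K0 HK] := even_odd_val_bound n (4 * b).
(* With D > |b|, the inequality y > D z gives y^2 > b z^2, the positivity behind
   [norm_param_inj]. *)
pose D := `|b|%N.+1.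
(* Since y and z are at most M (D + 1) T, both |A| and |B| are at most k W T^2. *)
pose W := ((1 + `|b|) * (M * D.+1) ^ 2)%N.
pose c := `|(cf * (1 + K))%R|%N.+1.
(* The condition holds for the squarefree part s of every integer s d^2 congruent to [k0], with v =
   d. *)
pose Kp (k : nat) := exists v : int, (M %| k%:Z * v ^+ 2 - k0)%Z.
have W0 : (0 < W)%N by rewrite muln_gt0 /= expn_gt0 muln_gt0 M0.
exists M, W, c, (residue M k0), Kp; split=> //.
  by have [] := residueP k0 M0.
split=> [j s d e|Z N S cZ Sfin SP].
  have [_ hr] := residueP k0 M0; exists d%:Z.
  have -> : s%:Z * d%:Z ^+ 2 = (s * d ^ 2)%N%:Z by rewrite PoszM.
  by rewrite -e PoszD addrAC rpredD // PoszM dvdz_mulr.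
have /choice[v vP] k : exists v : int, Kp k -> (M %| k%:Z * v ^+ 2 - k0)%Z.
  by have [[v hv]|nK] := pselect (Kp k); [exists v|exists 0].
pose T (k : nat) := isqrt_div (k * W) Z.
(* The shift by D T puts y above D M T, while z stays at most M T. *)
pose yy (k t : nat) := (residue M (v k * y0) + M * (t + D * T k))%N.
pose zz (k t : nat) := (residue M (v k * z0) + M * t)%N.
pose Av (k y z : nat) : int := k%:Z * (y%:Z ^+ 2 + b * z%:Z ^+ 2).
pose Bv (k y z : nat) : int := k%:Z * y%:Z * z%:Z.
pose r := (n - 1 - mon)%N.
pose gg (t : {ffun 'I_r -> 'I_(Z %/ M)}) (k y z : nat) := @lower_poly n b mon M g0 (Z %/ M)%N t (Av k y z) (Bv k y z).
pose PK := [set u : 'I_Z.+1 * ('I_Z.+1 * 'I_Z.+1) |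
  `[< sqfree u.1 /\ Kp u.1 >] && ((u.2.1 < T u.1)%N && (u.2.2 < T u.1)%N)]%SET.
pose PT := finset.setX [set: {ffun 'I_r -> 'I_(Z %/ M)}]%SET PK.
have TZ k : (0 < k)%N -> (T k <= Z)%N.
  move=> k_gt0; have := isqrt_divP (k * W) Z; rewrite -/(T k); apply: leq_trans.
  apply: leq_trans (leq_pmull _ _); last by rewrite muln_gt0 k_gt0.
  by case: (T k) => // m; rewrite -mulnn leq_pmulr.
apply: (@leq_trans #|PT|).
  rewrite cardsX cardsT card_ffun !card_ord leq_mul2l; apply/orP; right.
  rewrite -[#|PK|]sum1dep_card.
  rewrite -(pair_big_dep (fun k : 'I_Z.+1 => `[< sqfree k /\ Kp k >])
    (fun (k : 'I_Z.+1) (u : 'I_Z.+1 * 'I_Z.+1) => (u.1 < T k)%N && (u.2 < T k)%N) (fun _ _ => 1%N)) /=.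
  apply: leq_sum => k /asboolP[sk _]; rewrite sum1dep_card.
  have k_gt0 := sqfree_gt0 sk.
  pose I := [set u : 'I_Z.+1 | (u < T k)%N]%SET.
  have -> : #|[set u : 'I_Z.+1 * 'I_Z.+1 | (u.1 < T k)%N && (u.2 < T k)%N]%SET| = #|finset.setX I I|.
    by apply: eq_card => -[u1 u2]; rewrite !inE.
  rewrite cardsX -/(T k) -mulnn.
  suff -> : #|I| = T k by [].
  have TZk : (T k <= Z.+1)%N by apply: leqW; exact: TZ.
  rewrite -[RHS]card_ord -(card_imset predT (f := widen_ord TZk)); last by move=> i j /(congr1 val) /= /val_inj.
  apply: eq_card => u; rewrite inE; apply/idP/imsetP => [h|[i _ ->]]; last by rewrite /= ltn_ord.
  by exists (Ordinal h) => //; apply: val_inj.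
have memPT (u : {ffun 'I_r -> 'I_(Z %/ M)} * ('I_Z.+1 * ('I_Z.+1 * 'I_Z.+1))) : u \in PT ->
    [/\ sqfree u.2.1, Kp u.2.1, (u.2.2.1 < T u.2.1)%N & (u.2.2.2 < T u.2.1)%N].
  by rewrite !inE /= => /andP[/asboolP[? ?] /andP[]].
have facts k t1 t2 : sqfree k -> Kp k -> (t1 < T k)%N -> (t2 < T k)%N ->
   [/\ 0 < (yy k t2)%:Z ^+ 2 - b * (zz k t1)%:Z ^+ 2, 0 < Bv k (yy k t2) (zz k t1), 
       `|Av k (yy k t2) (zz k t1)| <= Z%:Z, `|Bv k (yy k t2) (zz k t1)| <= Z%:Z & (0 < Z)%N].
  move=> sk Kk h1 h2; have k_gt0 := sqfree_gt0 sk.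
  have [ry _] := residueP (v k * y0) M0; have [rz _] := residueP (v k * z0) M0.
  have zle : (zz k t1 <= M * T k)%N.
    rewrite /zz; apply: leq_trans (leq_add rz (leqnn _)) _.
    by rewrite -mulnS leq_mul2l h1 orbT.
  have yge : (D * (M * T k) < yy k t2)%N.
    rewrite /yy mulnDr addnA [X in (X < _)%N](_ : _ = (0 + M * (D * T k))%N); last by rewrite mulnCA.
    by rewrite -addSn leq_add2r.
  have yle : (yy k t2 <= M * D.+1 * T k)%N.
    rewrite /yy; apply: leq_trans (leq_add ry (leqnn _)) _.
    by rewrite -mulnS -mulnA leq_mul2l mulSn -addSn leq_add2r h2 orbT.
  have zle' : (zz k t1 <= M * D.+1 * T k)%N.
    by apply: leq_trans zle _; rewrite leq_mul2r leq_pmulr ?orbT.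
  have bd : (k * ((1 + `|b|) * (M * D.+1 * T k) ^ 2) <= Z)%N.
    have := isqrt_divP (k * W) Z; rewrite -/(T k); apply: leq_trans.
    by rewrite /W (expnMn _ (T k)) !mulnA leqnn.
  have [hA hB] := norm_param_bound b k yle zle'.
  split.
  - have h : (D * zz k t1 < yy k t2)%N by apply: leq_ltn_trans yge; rewrite leq_mul2l zle orbT.
    have bD : b <= D%:Z by rewrite /D; move: (b); clear; lia.
    move: h; rewrite -ltz_nat PoszM; move: (yy k t2) (zz k t1) => y z h.
    have z0' : 0 <= z%:Z by []. 
    have D1 : 1 <= D%:Z by [].
    move: bD h z0' D1; move: (D%:Z) (y%:Z) (z%:Z); clear => D y z h1 h2 h3 h4.
    have h5 : b * z ^+ 2 <= (D * z) ^+ 2.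
      apply: le_trans (ler_wpM2r (sqr_ge0 z) h1) _; rewrite exprMn ler_wpM2r ?sqr_ge0 //.
      by rewrite expr2 ler_peMl // (le_trans _ h4).
    rewrite subr_gt0; apply: le_lt_trans h5 _.
    by rewrite ltr_sqr ?nnegrE ?mulr_ge0 // ltW // (le_lt_trans _ h2) // mulr_ge0 // (le_trans _ h4).
  - by rewrite /Bv -!PoszM ltz_nat !muln_gt0 k_gt0 /yy /zz !addn_gt0.
  - by apply: le_trans hA _; rewrite lez_nat.
  - by apply: le_trans hB _; rewrite lez_nat.
  - apply: leq_trans bd; rewrite muln_gt0 k_gt0 /= muln_gt0 /= expn_gt0 !muln_gt0 M0 /=.
    by rewrite (leq_ltn_trans _ h1).
have vals (w : {ffun 'I_r -> 'I_(Z %/ M)}) a d :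
    even_val (4 * b) (@lower_poly n b mon M g0 (Z %/ M)%N w a d) = a /\
    odd_val (4 * b) (@lower_poly n b mon M g0 (Z %/ M)%N w a d) = d.
  exact: lower_poly_val.
apply: (@card_fset_set_ge _ S _ PT (fun u => recip_lift n b
   (gg u.1 u.2.1 (yy u.2.1 u.2.2.2) (zz u.2.1 u.2.2.1)))) => //.
  move=> [t [k [t1 t2]]] [t' [k' [t1' t2']]] /memPT /= [sk Kk h1 h2] /memPT /= [sk' Kk' h1' h2'].
  have [C0 B0 _ _ _] := facts _ _ _ sk Kk h1 h2; have [C0' B0' _ _ _] := facts _ _ _ sk' Kk' h1' h2'.
  have szg : size (gg t k (yy k t2) (zz k t1)) = n.+1 by apply: size_lower_poly.
  have szg' : size (gg t' k' (yy k' t2') (zz k' t1')) = n.+1 by apply: size_lower_poly.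
  move=> /(recip_lift_inj (eq_leq szg) (eq_leq szg')) e.
  have [eA eB] : Av k (yy k t2) (zz k t1) = Av k' (yy k' t2') (zz k' t1') /\
      Bv k (yy k t2) (zz k t1) = Bv k' (yy k' t2') (zz k' t1').
    have [vA vB] := vals t (Av k (yy k t2) (zz k t1)) (Bv k (yy k t2) (zz k t1)).
    have [vA' vB'] := vals t' (Av k' (yy k' t2') (zz k' t1')) (Bv k' (yy k' t2') (zz k' t1')).
    split.
      by rewrite -[LHS]vA -[RHS]vA' -/(gg t k (yy k t2) (zz k t1)) e.
    by rewrite -[LHS]vB -[RHS]vB' -/(gg t k (yy k t2) (zz k t1)) e.
  have [||||/ord_inj kE yE zE] := norm_param_inj b0 sk sk' _ _ _ _ C0 C0' eA eB; rewrite ?addn_gt0 //.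
  subst k'.
  have t2E : t2 = t2' by apply/ord_inj; move/addnI: yE => /eqP; rewrite eqn_pmul2l // => /eqP/addIn.
  have t1E : t1 = t1' by apply/ord_inj; move/addnI: zE => /eqP; rewrite eqn_pmul2l // => /eqP.
  rewrite t1E t2E; congr (_, _); apply/ffunP => i; apply/ord_inj.
  have i2 : (2 <= i + 2 <= n)%N by have := ltn_ord i; rewrite {2}/r; move: (monn); clear; case: (mon) => /=; lia.
  have cE (w : {ffun 'I_r -> 'I_(Z %/ M)}) a d :
      (@lower_poly n b mon M g0 (Z %/ M)%N w a d)`_(i + 2) = (residue M g0`_(i + 2) + M * w i)%N%:Z.
    rewrite coef_lower_poly_ge2 ?leq_addl // coef_tail_poly i2 /tail_coef addnK.
    by rewrite valK.
  have := congr1 (fun q : {poly int} => q`_(i + 2)) e; rewrite !cE => -[] /addnI/eqP.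
  by rewrite eqn_pmul2l // => /eqP.
move=> [t [k [t1 t2]]] /memPT /= [sk Kk h1 h2].
have [C0 B0 hA hB Z0] := facts _ _ _ sk Kk h1 h2.
set y := yy k t2 in C0 B0 hA hB *; set z := zz k t1 in C0 B0 hA hB *.
have szg : size (gg t k y z) = n.+1 by apply: size_lower_poly.
have [gA gB] := vals t (Av k y z) (Bv k y z).
have gmod : poly_mod M (gg t k y z) g0.
  apply: (@lower_poly_mod n b mon M g0 k0 y0 z0 monn M0 g0c _ t (Av k y z) (Bv k y z) k (v k) y%:Z z%:Z (vP k Kk)) => //.
    have [_ hr] := residueP (v k * y0) M0.
    by rewrite /y /yy PoszD addrAC rpredD // PoszM dvdz_mulr.
  have [_ hr] := residueP (v k * z0) M0.
  by rewrite /z /zz PoszD addrAC rpredD // PoszM dvdz_mulr.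
apply: SP.
- apply: (norm_square_G1 (C := k%:Z * (y%:Z ^+ 2 - b * z%:Z ^+ 2))) => //.
  + by rewrite mulf_neq0 ?gt_eqF // ltz_nat sqfree_gt0.
  + by rewrite /even_odd_norm gA gB /Av /Bv; ring.
  + by move=> L iota rt; apply: full.
- have gb j : `|(gg t k y z)`_j| <= (1 + K) * Z%:Z.
    by apply: lower_poly_bound => //; rewrite lez_nat // mulnC leq_trunc_div.
  move=> i; apply: le_trans (Hf _ _ gb i) _.
  apply: (@le_trans _ _ (c * Z)%N%:Z); last by rewrite lez_nat.
  rewrite mulrA PoszM ler_wpM2r // /c -addn1 PoszD abszE.
  by apply: le_trans (ler_norm _) _; rewrite lerDl.
- move=> hm; rewrite monicE (size_recip_lift b szg).2.
  by apply/eqP/lower_poly_monic.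
Qed.

(** * Asymptotics *)

Section Asymptotics.
Variable R : realType.

Lemma sum_divn_le (Q : nat) : (0 < Q)%N ->
  (\sum_(x < Q.+1 | (0 < x)%N) Q %/ x)%N%:R <= Q%:R * (1 + ln Q%:R) :> R.
Proof.
move=> Q0; apply: (@le_trans _ _ (Q%:R * \sum_(1 <= x < Q.+1) (x%:R)^-1)); last first.
  by rewrite ler_wpM2l ?ler0n // harmonic_le.
rewrite natr_sum big_mkcond big_ord_recl /= add0r big_add1 /= big_mkord big_distrr /=.
apply: ler_sum => i _; rewrite /bump /= add1n.
by rewrite ler_pdivlMr ?ltr0n // -natrM ler_nat leq_trunc_div.
Qed.

(** For k <= Z/W the squared root is at least Z/(4kW). The sum of 1/k over admissible k is at least
    half the sum over the progression e + M j, which is at least (1/M) times a harmonic sum; hence 8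
    W M. *)
Lemma sum_isqrt_ge (Kp : nat -> Prop) (e M W Z : nat) :
  (0 < M)%N -> (0 < W)%N -> (0 < e <= M)%N ->
  (forall j s d, (e + M * j = s * d ^ 2)%N -> Kp s) ->
  Z%:R / (8%:R * W%:R * M%:R) * ln (Z %/ W %/ M).+1%:R <=
  (\sum_(k < Z.+1 | `[< sqfree k /\ Kp k >]) isqrt_div (k * W) Z ^ 2)%N%:R :> R.
Proof.
move=> M0 W0 /andP[e0 eM] HK; set X := (Z %/ W)%N; set J := (X %/ M)%N.
have WR : 0 < W%:R :> R by rewrite ltr0n.
have MR : 0 < M%:R :> R by rewrite ltr0n.
have XZ : (X <= Z)%N by rewrite leq_div.
pose s1 : R := \sum_(k < X.+1 | `[< sqfree k /\ Kp k >]) k%:R^-1.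
have h1 : Z%:R / (4%:R * W%:R) * s1 <=
    (\sum_(k < Z.+1 | `[< sqfree k /\ Kp k >]) isqrt_div (k * W) Z ^ 2)%N%:R.
  rewrite natr_sum /s1 big_distrr /=.
  rewrite (big_ord_widen_cond Z.+1 (fun k => `[< sqfree k /\ Kp k >]) (fun k => Z%:R / (4%:R * W%:R) * (k%:R^-1 : R))) //.
  rewrite big_mkcond [leRHS]big_mkcond /=; apply: ler_sum => k _.
  case: ifPn => [/andP[kK kX]|_]; last by case: ifP => // _; rewrite ler0n.
  rewrite kK; move/asboolP: kK => [/sqfree_gt0 k0 _].
  have kW : (k * W <= Z)%N by rewrite -leq_divRL.
  have kR : 0 < k%:R :> R by rewrite ltr0n.
  have kW0 : (0 < k * W)%N by rewrite muln_gt0 k0 W0.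
  have h : Z%:R <= 4%:R * (k%:R * W%:R * (isqrt_div (k * W) Z)%:R ^+ 2) :> R.
    by rewrite -natrX -!natrM ler_nat isqrt_div_ge.
  rewrite natrX; apply: (@le_trans _ _ (Z%:R / (4%:R * (k%:R * W%:R)))).
    by rewrite le_eqVlt; apply/orP; left; apply/eqP; field; rewrite !gt_eqF.
  rewrite ler_pdivrMr ?mulr_gt0 // mulrC; apply: le_trans h _.
  by rewrite le_eqVlt; apply/orP; left; apply/eqP; ring.
apply: le_trans h1.
have h2 : \sum_(j < J) ((e + M * j)%N%:R)^-1 <= 2%:R * s1.
  apply: (@sqfree_harmonic R Kp (fun j => e + M * j)%N).
  - by move=> i j /addnI/eqP; rewrite eqn_pmul2l // => /eqP.
  - move=> j jJ; rewrite addn_gt0 e0 /=; apply: (@leq_trans (M * J)%N); last by rewrite mulnC leq_trunc_div.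
    apply: (@leq_trans (M * j.+1)%N); first by rewrite mulnS leq_add2r.
    by rewrite leq_mul2l jJ orbT.
  - by move=> j s d _ _; apply: HK.
have h3 : M%:R^-1 * ln J.+1%:R <= \sum_(j < J) ((e + M * j)%N%:R)^-1 :> R.
  apply: le_trans (_ : M%:R^-1 * \sum_(1 <= x < J.+1) (x%:R)^-1 <= _).
    by rewrite ler_wpM2l ?invr_ge0 ?ler0n // harmonic_ge.
  rewrite big_add1 /= big_mkord big_distrr /=; apply: ler_sum => j _.
  rewrite -invfM lef_pV2 ?posrE ?mulr_gt0 ?ltr0n ?addn_gt0 ?e0 //.
  by rewrite -natrM ler_nat mulnS leq_add2r.
have h4 : M%:R^-1 * ln J.+1%:R <= 2%:R * s1 := le_trans h3 h2.
apply: (@le_trans _ _ (Z%:R / (8%:R * W%:R) * (M%:R^-1 * ln J.+1%:R))).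
  by rewrite le_eqVlt; apply/orP; left; apply/eqP; field; rewrite !gt_eqF.
apply: le_trans (ler_wpM2l _ h4) _; first by rewrite divr_ge0 ?mulr_ge0 ?ler0n.
by rewrite le_eqVlt; apply/orP; left; apply/eqP; field; rewrite !gt_eqF.
Qed.

Lemma coef_boundedP (H : R) (f : {poly int}) : 0 <= H ->
  coef_bounded H f <-> forall i, `|f`_i| <= (Num.truncn H)%:Z.
Proof.
move=> H0.
have E i : (`|f`_i| <= (Num.truncn H)%:Z) = (- H <= (f`_i)%:~R <= H).
  rewrite -abszE lez_nat truncn_ge_nat // -ler_norml -intr_norm -abszE.
  by [].
by split=> h i; [rewrite E|rewrite -E].
Qed.

(** The boolean [mon], read as 0 or 1, treats both counts at once: one coefficient fewer is free in
    the monic case. *)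
Lemma count_asymp n (b : int) (mon : bool) (S : R -> set {poly int}) :
  (mon < n)%N -> b != 0 -> (forall H, finite_set (S H)) ->
  (forall H f, S H f <-> [/\ admissible b (G1 n) f, coef_bounded H f & mon -> f \is monic]) ->
  asymp (fun H : R => #|` fset_set (S H)|%:R) (fun H : R => H ^+ (n - mon) * ln H).
Proof.
move=> monn b0 Sfin SE; have rE : (n - mon = (n - 1 - mon).+1)%N by move: monn; clear; lia.
rewrite rE; move: (n - 1 - mon)%N rE => r rE.
have rE' : (n - 1 - mon = r)%N by move: rE; clear; lia.
split.
  have [c c0 up] := admissible_upper monn b0.
  have cR : 1 <= c%:R :> R by rewrite ler1n.
  (* For Q <= c H and ln H >= 1, 8(1 + ln Q) + 1 is at most (17 + 8 ln c) ln H. *)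
  exists (c%:R ^+ r.+1 * (17%:R + 8%:R * ln c%:R)).
    by rewrite mulr_gt0 ?exprn_gt0 ?ltr0n // ltr_wpDr ?mulr_ge0 ?ln_ge0.
  near=> H.
  have H1 : expR 1 <= H by near: H; apply: nbhs_pinfty_ge; rewrite num_real.
  have H0 : 0 < H by apply: lt_le_trans H1; exact: expR_gt0.
  have lnH : 1 <= ln H by rewrite -[1]expRK ler_ln // posrE expR_gt0.
  have H1' : 1 <= H by apply: le_trans H1; rewrite -{1}[1]expR0 ler_expR.
  set N := Num.truncn H.
  have NH : N%:R <= H by rewrite truncn_le ltW.
  have N0 : (0 < N)%N by rewrite truncn_ge_nat // ltW.
  have upN := up N (S H) N0 (Sfin H); rewrite rE' in upN.
  have {}upN := upN (fun f Sf => let: And3 fa fb fm := (SE H f).1 Sf in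
    And3 fa ((coef_boundedP f (ltW H0)).1 fb) fm).
  set Q := (c * N)%N in upN.
  have Q0 : (0 < Q)%N by rewrite muln_gt0 c0.
  have QR : Q%:R <= c%:R * H by rewrite natrM ler_wpM2l ?ler0n.
  have QR0 : 0 < Q%:R :> R by rewrite ltr0n.
  rewrite ger0_norm ?ler0n // ger0_norm; last by rewrite mulr_ge0 ?exprn_ge0 ?ltW // (lt_le_trans _ lnH).
  apply: (@le_trans _ _ ((Q ^ r * (8 * (\sum_(x < Q.+1 | (0 < x)%N) Q %/ x) + Q))%N%:R)).
    by rewrite ler_nat.
  rewrite natrM natrX natrD natrM.
  apply: (@le_trans _ _ (Q%:R ^+ r * (8%:R * (Q%:R * (1 + ln Q%:R)) + Q%:R))).
    by rewrite ler_wpM2l ?exprn_ge0 ?ler0n // lerD2r ler_wpM2l ?ler0n // sum_divn_le.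
  have lnQ : ln Q%:R <= ln c%:R + ln H.
    by rewrite -lnM ?posrE ?ltr0n // ler_ln ?posrE ?mulr_gt0 ?ltr0n.
  have lnc : 0 <= ln c%:R :> R by rewrite ln_ge0.
  apply: (@le_trans _ _ (Q%:R ^+ r.+1 * ((17%:R + 8%:R * ln c%:R) * ln H))).
    rewrite exprSr -mulrA ler_wpM2l ?exprn_ge0 ?ler0n //.
    have -> : 8%:R * (Q%:R * (1 + ln Q%:R)) + Q%:R = Q%:R * (9%:R + 8%:R * ln Q%:R) :> R by ring.
    rewrite ler_wpM2l ?ler0n //; move: (ln Q%:R) (ln c%:R) (ln H) lnQ lnc lnH => x y z h1 h2 h3.
    by clear -h1 h2 h3; nra.
  have -> : c%:R ^+ r.+1 * (17%:R + 8%:R * ln c%:R) * (H ^+ r.+1 * ln H) =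
    (c%:R * H) ^+ r.+1 * ((17%:R + 8%:R * ln c%:R) * ln H) by rewrite exprMn; ring.
  rewrite ler_wpM2r ?mulr_ge0 ?addr_ge0 ?mulr_ge0 ?ler0n // ?(le_trans _ lnH) //.
  by rewrite lerXn2r ?nnegrE ?ler0n // mulr_ge0 ?ler0n // ltW.
have [M [W [c [e [Kp [M0 W0 c0 eM [HK low]]]]]]] := admissible_lower monn b0.
pose La := (c * W * M)%N.
have La0 : (0 < La)%N by rewrite !muln_gt0 c0 W0 M0.
have LaR : 1 <= La%:R :> R by rewrite ler1n.
(* Here H <= 2 La J and ln H <= 2 ln (J + 1), where J is the integer part of N/La; 16 W M cancels
   the denominator 8 W M and this last 2. *)
exists ((2%:R * La%:R) ^+ r.+1 * (16%:R * W%:R * M%:R)).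
  by rewrite !mulr_gt0 ?exprn_gt0 ?mulr_gt0 ?ltr0n.
near=> H.
(* As H <= La (J + 1), H >= 2 La gives J >= H/(2 La), and H >= La^2 gives (J + 1)^2 >= H. *)
have HL : 2%:R * La%:R ^+ 2 <= H by near: H; apply: nbhs_pinfty_ge; rewrite num_real.
have H1 : 1 <= H by apply: le_trans HL; nra.
have H0 : 0 < H by apply: lt_le_trans H1.
have lnH0 : 0 <= ln H by rewrite ln_ge0.
set N := Num.truncn H.
have cN : (c * (N %/ c) <= N)%N by rewrite mulnC leq_trunc_div.
have lo := low (N %/ c)%N N (S H) cN (Sfin H); rewrite rE' in lo.
have {}lo := lo (fun f fa fN fm => (SE H f).2 (And3 fa ((coef_boundedP f (ltW H0)).2 fN) fm)).
set Z := (N %/ c)%N in lo.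
have JE : (Z %/ W %/ M = N %/ La)%N by rewrite -!divnMA mulnA.
pose J := (N %/ La)%N.
have JZM : (J <= Z %/ M)%N by rewrite /J -JE divnAC leq_div.
have JZ : (J <= Z)%N by apply: leq_trans JZM (leq_div _ _).
have JH : H <= La%:R * J.+1%:R.
  apply: (@le_trans _ _ N.+1%:R); first by rewrite ltW // truncnS_gt.
  by rewrite -natrM ler_nat mulnC ltn_ceil.
have J1 : H / (2%:R * La%:R) <= J%:R.
  rewrite ler_pdivrMr ?mulr_gt0 ?ltr0n //; move: JH HL; rewrite -natr1.
  by move: (J%:R : R) (La%:R : R) LaR => j l l1 h1 h2; nra.
have lnJ : ln H / 2%:R <= ln J.+1%:R :> R.
  rewrite ler_pdivrMr ?ltr0n // mulr_natr -lnXn ?ltr0n // ler_ln ?posrE ?exprn_gt0 ?ltr0n //.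
  move: JH HL J1; move: (J.+1%:R : R) (ler0n R J.+1) (La%:R : R) LaR => j j0 l l1 h1 h2 _.
  have lH : l ^+ 2 <= H by have := sqr_ge0 l; lra.
  rewrite -(ler_pM2l H0); apply: (@le_trans _ _ ((l * j) * (l * j))).
    by apply: ler_pM => //; exact: ltW.
  rewrite [leLHS](_ : _ = l ^+ 2 * j ^+ 2); last by ring.
  by rewrite ler_wpM2r ?sqr_ge0.
rewrite ger0_norm; last by apply: mulr_ge0 => //; apply/exprn_ge0/ltW.
rewrite ger0_norm ?ler0n //.
have lo' : J%:R ^+ r * (Z%:R / (8%:R * W%:R * M%:R) * ln J.+1%:R) <= #|` fset_set (S H)|%:R :> R.
  have loR : ((Z %/ M) ^ r * (\sum_(k < Z.+1 | `[< sqfree k /\ Kp k >]) isqrt_div (k * W) Z ^ 2))%N%:R <= #|` fset_set (S H)|%:R :> R by rewrite ler_nat.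
  apply: le_trans loR.
  rewrite natrM natrX; apply: ler_pM.
  - by rewrite exprn_ge0 ?ler0n.
  - by rewrite mulr_ge0 ?divr_ge0 ?mulr_ge0 ?ler0n ?ln_ge0 ?ler1n.
  - by rewrite lerXn2r ?nnegrE ?ler0n // ler_nat.
  - by rewrite /J -JE; exact: (sum_isqrt_ge _ M0 W0 eM HK).
have WM : 0 < W%:R * M%:R :> R by rewrite mulr_gt0 ?ltr0n.
apply: le_trans (ler_wpM2l _ lo'); last by rewrite ltW // !mulr_gt0 ?exprn_gt0 ?mulr_gt0 ?ltr0n.
have -> : (2%:R * La%:R) ^+ r.+1 * (16%:R * W%:R * M%:R) *
  (J%:R ^+ r * (Z%:R / (8%:R * W%:R * M%:R) * ln J.+1%:R)) =
  (2%:R * La%:R) ^+ r.+1 * (J%:R ^+ r * Z%:R) * (2%:R * ln J.+1%:R) :> R.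
  by field; rewrite !gt_eqF ?ltr0n.
apply: ler_pM => //; [by apply/exprn_ge0/ltW| |].
  apply: (@le_trans _ _ ((2%:R * La%:R) ^+ r.+1 * J%:R ^+ r.+1)).
    have HJ : H <= 2%:R * La%:R * J%:R.
      by move: J1; rewrite ler_pdivrMr ?mulr_gt0 ?ltr0n // mulrC.
    have H0' := ltW H0.
    by rewrite -exprMn; apply: lerXn2r => //; rewrite nnegrE !mulr_ge0 ?ler0n.
  rewrite ler_wpM2l ?exprn_ge0 ?mulr_ge0 ?ler0n // exprSr ler_wpM2l ?exprn_ge0 ?ler0n //.
  by rewrite ler_nat.
by move: lnJ; rewrite ler_pdivrMr ?ltr0n // mulrC.
Unshelve. all: by end_near.
Qed.

End Asymptotics.

Theorem theorem2p5 (R : realType) (n : nat) (b : int)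
    (hn : (1 <= n)%N) (hb : b != 0) :
  asymp (fun H : R => (Ecount b (G1 n) H)%:R)
        (fun H : R => H ^+ n * ln H)
  /\ ((2 <= n)%N ->
      asymp (fun H : R => (Ecount_monic b (G1 n) H)%:R)
            (fun H : R => H ^+ (n - 1) * ln H)).
Proof.
split=> [|n2].
  have := @count_asymp R n b false (fun H => Eset b (G1 n) H) hn hb.
  rewrite subn0; apply=> [H|H f]; first exact: finite_Eset.
  by split=> [[]|[]].
apply: (@count_asymp R n b true (fun H => Eset b (G1 n) H `&` [set f | f \is monic])%classic n2 hb).
  by move=> H; apply: sub_finite_set (finite_Eset b (G1 n) H) => f [].
by move=> H f; split=> [[[]]|[fa fb fm]]; split=> //; exact: fm.
Qed.
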